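(* Let $\lambda\in(\frac{\sqrt2}6,\frac56)$ and let $\mu_\lambda,\tau_{\mu_\lambda},\tau^*_{\mu_\lambda},\gamma_\lambda$ be as in the context. (i) The support $\{\alpha: d_{F^\lambda}(\alpha)\neq-\infty\}$ of $d_{F^\lambda}$ is $[\alpha_{\lambda,\min},1]$, where $\alpha_{\lambda,\min}=1-\frac{\log(6\lambda+1)}{\log6}$. (ii) For every $\alpha\in[\alpha_{\lambda,\min},1]$, $d_{F^\lambda}(\alpha)=\tau^*_{\mu_\lambda}(\alpha+\gamma_\lambda-1)$. In particular $d_{F^\lambda}$ is strictly concave on its support, its maximum equals $1$ and is reached at $\alpha_{\lambda,\mathcal L}=1-\frac{\log(36\lambda^2-1)}{4\log3+2\log6}$. (iii) Let $\mathrm{Gr}(d_{F^\lambda})=\{(\alpha,d_{F^\lambda}(\alpha)):\alpha\in[\alpha_{\lambda,\min},1]\}$ and let $\mathcal K(\mathbb R^2)$ be the space of nonempty compact subsets of $\mathbb R^2$ with the Hausdorff distance. The map $\lambda\in(\frac{\sqrt2}6,\frac56)\mapsto\mathrm{Gr}(d_{F^\lambda})\in\mathcal K(\mathbb R^2)$ is continuous except at $\lambda=\frac13$.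
   Context: Construction of $F^\lambda$: $F^\lambda_0\equiv0$ on $[0,1]$ (one interval of generation $0$). Given $F^\lambda_n$ with its $4^n$ closed intervals of generation $n$ (covering $[0,1]$, disjoint interiors, $F^\lambda_n$ affine on each), on each interval $[a,b]$ of generation $n$, with $\ell=b-a$ and $m$ the slope of $F^\lambda_n$ there, $F^\lambda_{n+1}$ coincides with $F^\lambda_n$ at $a,a+\ell/3,a+2\ell/3,b$, equals $F^\lambda_n(a+\ell/2)+\lambda\ell\sqrt{1+m^2}$ at $a+\ell/2$, and is affine on each of the four intervals $[a,a+\ell/3],[a+\ell/3,a+\ell/2],[a+\ell/2,a+2\ell/3],[a+2\ell/3,b]$ (generation $n+1$). $F^\lambda=\lim_n F^\lambda_n$ (finite and continuous for $\lambda\in(\frac16,\frac56)$). Pointwise regularity: for bounded $f$ on $[0,1]$, $x_0\in[0,1]$, $\alpha\ge0$, $f\in\mathcal C^\alpha(x_0)$ if there exist a polynomial $P$ of degree at most $\lfloor\alpha\rfloor$ and $C,\delta>0$ with $|f(x)-P(x-x_0)|\le C|x-x_0|^\alpha$ for all $x\in[0,1]$ with $|x-x_0|<\delta$; $h_f(x_0)=\sup\{\alpha\ge0: f\in\mathcal C^\alpha(x_0)\}$. The multifractal spectrum is $d_f(\alpha)=\dim_H\{x\in[0,1]:h_f(x)=\alpha\}$ with $\dim_H\emptyset=-\infty$. Measure: for $\lambda>\frac16$, $\gamma_\lambda\ge1$ is the unique real with $2\cdot3^{-\gamma_\lambda}+(6\lambda+1)6^{-\gamma_\lambda}+(6\lambda-1)6^{-\gamma_\lambda}=1$;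 $p_0=p_3=3^{-\gamma_\lambda}$, $p_1=(6\lambda+1)6^{-\gamma_\lambda}$, $p_2=(6\lambda-1)6^{-\gamma_\lambda}$; $S_0(x)=x/3$, $S_1(x)=x/6+1/3$, $S_2(x)=-x/6+2/3$, $S_3(x)=x/3+2/3$ with ratios $r_0=r_3=1/3$, $r_1=r_2=1/6$; $\mu_\lambda$ is the unique Borel probability measure with $\mu_\lambda=\sum_{i=0}^3p_i\,\mu_\lambda\circ S_i^{-1}$. $\tau_{\mu_\lambda}(q)$ is the unique real solution of $\sum_{i=0}^3p_i^q r_i^{-\tau_{\mu_\lambda}(q)}=1$, and $\tau^*_{\mu_\lambda}(\alpha)=\inf_{q\in\mathbb R}(\alpha q-\tau_{\mu_\lambda}(q))$. *)

(* Defs.v *)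
From Stdlib Require Import Reals Lra List ClassicalEpsilon.
From Coquelicot Require Import Coquelicot.
Import ListNotations.
Open Scope R_scope.

(* F^lambda_n is represented by its list of nodes (x, F_n(x)) at the endpoints of
   the generation-n intervals, in increasing order of x; F_n is affine in between. *)

Definition mid_nodes (lam : R) (p q : R * R) : list (R * R) :=
  let a := fst p in let ya := snd p in
  let b := fst q in let yb := snd q in
  let l := b - a in let m := (yb - ya) / l in
  [ (a + l / 3, ya + m * (l / 3));
    (a + l / 2, (ya + m * (l / 2)) + lam * l * sqrt (1 + m ^ 2));
    (a + 2 * l / 3, ya + m * (2 * l / 3)) ].

Fixpoint refine_aux (lam : R) (p : R * R) (l : list (R * R)) : list (R * R) :=
  match l with
  | [] => [p]
  | q :: rest => p :: mid_nodes lam p q ++ refine_aux lam q rest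
  end.

Definition refine (lam : R) (l : list (R * R)) : list (R * R) :=
  match l with
  | [] => []
  | p :: rest => refine_aux lam p rest
  end.

Fixpoint nodes (lam : R) (n : nat) : list (R * R) :=
  match n with
  | O => [(0, 0); (1, 0)]
  | S k => refine lam (nodes lam k)
  end.

Fixpoint interp (l : list (R * R)) (x : R) : R :=
  match l with
  | [] => 0
  | p :: rest =>
      match rest with
      | [] => snd p
      | q :: _ =>
          if Rle_dec x (fst q)
          then snd p + (snd q - snd p) / (fst q - fst p) * (x - fst p)
          else interp rest x
      end
  end.

Definition Fn (lam : R) (n : nat) (x : R) : R := interp (nodes lam n) x.

(* F^lambda = lim_n F^lambda_n (the limit exists for lambda in (1/6,5/6)) *)
Definition F (lam : R) (x : R) : R := real (Lim_seq (fun n => Fn lam n x)).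

Definition rpow (y a : R) : R :=
  if Req_EM_T y 0 then (if Req_EM_T a 0 then 1 else 0) else Rpower y a.

Definition holder_at (f : R -> R) (x0 alpha : R) : Prop :=
  exists (c : nat -> R) (C delta : R), 0 < C /\ 0 < delta /\
    forall x, 0 <= x <= 1 -> Rabs (x - x0) < delta ->
      Rabs (f x - sum_n (fun k => c k * (x - x0) ^ k) (Z.to_nat (Int_part alpha)))
        <= C * rpow (Rabs (x - x0)) alpha.

Definition holder_exp (f : R -> R) (x0 : R) : Rbar :=
  Lub_Rbar (fun alpha => 0 <= alpha /\ holder_at f x0 alpha).

Definition diamR (U : R -> Prop) : Rbar :=
  Lub_Rbar (fun r => exists x y, U x /\ U y /\ r = Rabs (x - y)).

Definition cpow (U : R -> Prop) (s : R) : R :=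
  if excluded_middle_informative (exists x, U x)
  then rpow (real (diamR U)) s else 0.

Definition Hdelta (s delta : R) (E : R -> Prop) : Rbar :=
  Glb_Rbar (fun v => exists U : nat -> R -> Prop,
    (forall i, Rbar_le (diamR (U i)) (Finite delta)) /\
    (forall x, E x -> exists i, U i x) /\
    Lim_seq (sum_n (fun i => cpow (U i) s)) = Finite v).

Definition Hmeas (s : R) (E : R -> Prop) : Rbar :=
  Rbar_lub (fun v => exists delta, 0 < delta /\ v = Hdelta s delta E).

Definition dimH (E : R -> Prop) : Rbar :=
  if excluded_middle_informative (exists x, E x)
  then Glb_Rbar (fun s => 0 <= s /\ Hmeas s E = Finite 0)
  else m_infty.

Definition spectrum (f : R -> R) (alpha : R) : Rbar :=
  dimH (fun x => 0 <= x <= 1 /\ holder_exp f x = Finite alpha).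

Definition the_real (P : R -> Prop) : R := epsilon (inhabits 0) P.

Definition gamma_eq (lam g : R) : Prop :=
  2 * Rpower 3 (- g) + (6 * lam + 1) * Rpower 6 (- g)
    + (6 * lam - 1) * Rpower 6 (- g) = 1.

(* gamma_lambda : the unique real >= 1 solving the equation *)
Definition gamma (lam : R) : R := the_real (fun g => 1 <= g /\ gamma_eq lam g).

Definition pw (lam : R) (i : nat) : R :=
  match i with
  | 0%nat => Rpower 3 (- gamma lam)
  | 1%nat => (6 * lam + 1) * Rpower 6 (- gamma lam)
  | 2%nat => (6 * lam - 1) * Rpower 6 (- gamma lam)
  | _ => Rpower 3 (- gamma lam)
  end.

Definition rr (i : nat) : R :=
  match i with
  | 0%nat => 1 / 3
  | 1%nat => 1 / 6
  | 2%nat => 1 / 6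
  | _ => 1 / 3
  end.

(* tau_mu(q): unique real t with sum_{i=0}^3 p_i^q r_i^{-t} = 1 *)
Definition tau (lam q : R) : R :=
  the_real (fun t => sum_n (fun i => Rpower (pw lam i) q * Rpower (rr i) (- t)) 3 = 1).

Definition tau_star (lam alpha : R) : Rbar :=
  Glb_Rbar (fun v => exists q, v = alpha * q - tau lam q).

Definition alpha_min (lam : R) : R := 1 - ln (6 * lam + 1) / ln 6.
Definition alpha_L (lam : R) : R :=
  1 - ln (36 * lam ^ 2 - 1) / (4 * ln 3 + 2 * ln 6).

Definition graph (lam : R) : R * R -> Prop :=
  fun p => alpha_min lam <= fst p <= 1 /\ Finite (snd p) = spectrum (F lam) (fst p).

Definition dist2 (p q : R * R) : R :=
  sqrt ((fst p - fst q) ^ 2 + (snd p - snd q) ^ 2).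

Definition dist_pt_set (p : R * R) (B : R * R -> Prop) : Rbar :=
  Glb_Rbar (fun r => exists q, B q /\ r = dist2 p q).

Definition excess (A B : R * R -> Prop) : Rbar :=
  Rbar_lub (fun v => exists p, A p /\ v = dist_pt_set p B).

Definition Rbar_maxi (x y : Rbar) : Rbar :=
  if Rbar_le_dec x y then y else x.

Definition hausdorff_dist (A B : R * R -> Prop) : Rbar :=
  Rbar_maxi (excess A B) (excess B A).

Definition nonempty_compact2 (A : R * R -> Prop) : Prop :=
  (exists p, A p) /\
  (exists M, forall p, A p -> dist2 p (0, 0) <= M) /\
  (forall p, (forall eps, 0 < eps -> exists q, A q /\ dist2 p q < eps) -> A p).

Definition admissible (lam : R) : Prop := sqrt 2 / 6 < lam < 5 / 6.

Definition graph_continuous_at (lam0 : R) : Prop :=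
  forall eps, 0 < eps -> exists delta, 0 < delta /\
    forall lam, admissible lam -> Rabs (lam - lam0) < delta ->
      Rbar_lt (hausdorff_dist (graph lam) (graph lam0)) (Finite eps).

(* Main.v *)
(* On an interval of length l and slope m the oscillation of F is comparable with
   l s, where s = sqrt (1 + m^2), so the Holder exponent at x is 1 - beta, where beta
   is the upper growth rate of log s against - log l along the intervals containing x.
   With k = 6 lambda the children multiply s essentially by 1, k + 1, k - 1, 1
   (the middle two being exchanged when m < 0) and l by 1/3, 1/6, 1/6, 1/3.

   Upper bound: for every q the sum of s^q l^T over all intervals converges as soon
   as the sum of gain^q ratio^T over the four children is less than 1.  Lower bound: a
   Bernoulli measure on letters with mean growth rate exactly beta is killed when
   log s - beta |log l| leaves a window [-B, B]; weighting it by the tent B - |.|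
   makes its mass almost conserved, so a cover of too small total size misses a
   surviving branch, and along such a branch the exponent is exactly 1 - beta.

   The two bounds meet by the first-order condition at the minimizing q; when no
   minimizer exists, the limit q -> +-infinity provides the measure.  Strict concavity
   and semicontinuity come from the same minimization.  At lambda = 1/3 the gain k - 1
   crosses 1: for beta = 0 the letter 2 is available at k = 2 but not for k > 2, which
   produces the jump. *)
From Stdlib Require Import Reals Lra Lia Arith List ClassicalEpsilon Classical.
From Coquelicot Require Import Coquelicot.
Require Import Defs.
Import ListNotations.
Open Scope R_scope.

(** * Cells *)

(** The gains are multiplicative only up to bounded errors, felt near slope 0, and each use of them
    has its own remedy. Negative moments replace the stretch by [floored_slope], for which the gains
    are true lower bounds. Positive moments carry the additive error along as a multiple of the
    moment of order 0, which converges only for exponents above 1; the condition [2 <= k * k], that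
    is lambda >= sqrt 2 / 6, gives [press k q 1 >= 1] for [q >= 0] and so forces [T >= 1]. In the
    lower bound the window keeps the product of the gains away from 0, so the errors add up to a
    factor linear in the generation, invisible to the exponent. No measure is built on a level set.
    A cover is turned into a superadditive function of cells, and a branch is selected along which
    the weighted tree beats it: this gives at once a point of the level set and the contradiction.
    The exponent gamma only shifts: [press k q T = 1] means [tau(q) = gamma * q - T], so both bounds
    are stated with [press]. *)

(* An interval of some generation together with the affine function on it. *)
Record cell := Cell { lft : R; len : R; val : R; slp : R }.

Definition rgt (c : cell) : R := lft c + len c.
Definition aff (c : cell) (x : R) : R := val c + slp c * (x - lft c).
Definition stretch (c : cell) : R := sqrt (1 + slp c ^ 2).
Definition inside (c : cell) (x : R) : Prop := lft c <= x <= rgt c.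
Definition root : cell := Cell 0 1 0 0.

(** The apex is raised by [lam * l * s = k / 6 * l * s] over a run of [l / 6], hence the middle
    slopes [m + k * s] and [m - k * s]. *)
Definition child (k : R) (i : nat) (c : cell) : cell :=
  let a := lft c in let l := len c in let y := val c in let m := slp c in
  let s := stretch c in
  match i with
  | 0%nat => Cell a (l / 3) y m
  | 1%nat => Cell (a + l / 3) (l / 6) (y + m * (l / 3)) (m + k * s)
  | 2%nat => Cell (a + l / 2) (l / 6) (y + m * (l / 2) + k / 6 * l * s) (m - k * s)
  | _ => Cell (a + 2 * l / 3) (l / 3) (y + m * (2 * l / 3)) m
  end.

Definition children (k : R) (c : cell) : list cell :=
  [child k 0 c; child k 1 c; child k 2 c; child k 3 c].

Fixpoint cells (k : R) (n : nat) : list cell :=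
  match n with
  | O => [root]
  | S n => flat_map (children k) (cells k n)
  end.

Lemma stretch_ge1 c : 1 <= stretch c.
Proof.
  unfold stretch. rewrite <- sqrt_1 at 1. apply sqrt_le_1_alt. nra.
Qed.

Lemma stretch_sq c : stretch c * stretch c = 1 + slp c ^ 2.
Proof. apply sqrt_sqrt. nra. Qed.

Lemma slp_le_stretch c : Rabs (slp c) <= stretch c.
Proof.
  generalize (stretch_ge1 c), (stretch_sq c); intros.
  apply Rabs_le; split; nra.
Qed.

Lemma stretch_le_slp c : stretch c <= 1 + Rabs (slp c).
Proof.
  generalize (stretch_ge1 c), (stretch_sq c), (Rabs_pos (slp c)); intros.
  assert (Rabs (slp c) * Rabs (slp c) = slp c ^ 2) by (rewrite <- Rabs_mult, Rabs_right; nra).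
  nra.
Qed.

Fixpoint nodes_of (cs : list cell) (p : R * R) : list (R * R) :=
  match cs with
  | [] => [p]
  | c :: cs => (lft c, val c) :: nodes_of cs p
  end.

(** Values are matched as well as abscissas: this is what lets [refine] recover the slope of a cell
    from two consecutive nodes. *)
Fixpoint adjacent (cs : list cell) (p : R * R) : Prop :=
  match cs with
  | [] => True
  | c :: cs => 0 < len c /\
      (rgt c, aff c (rgt c)) = hd p (map (fun c => (lft c, val c)) cs) /\ adjacent cs p
  end.

Lemma refine_nodes_of lam c cs p : adjacent (c :: cs) p ->
  refine lam (nodes_of (c :: cs) p) =
  nodes_of (flat_map (children (6 * lam)) (c :: cs)) p.
Proof.
  revert c; induction cs as [|d cs IH]; intros c (Hl & He & Ha).
  - simpl in He. subst p. simpl. unfold mid_nodes, aff, rgt; simpl.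
    replace (lft c + len c - lft c) with (len c) by ring.
    replace ((val c + slp c * len c - val c) / len c) with (slp c) by (field; lra).
    fold (stretch c).
    replace (6 * lam / 6 * len c * stretch c) with (lam * len c * stretch c) by field.
    reflexivity.
  - specialize (IH d Ha). simpl in IH. simpl in He.
    simpl. rewrite IH. unfold mid_nodes; simpl.
    injection He; intros Hy Hx. rewrite <- Hx, <- Hy. unfold aff, rgt.
    replace (lft c + len c - lft c) with (len c) by ring.
    replace ((val c + slp c * len c - val c) / len c) with (slp c) by (field; lra).
    fold (stretch c).
    replace (6 * lam / 6 * len c * stretch c) with (lam * len c * stretch c) by field.
    reflexivity.
Qed.

Lemma adjacent_children k cs p : adjacent cs p -> adjacent (flat_map (children k) cs) p.
Proof.
  induction cs as [|c cs IH]; [easy|]. intros (Hl & He & Ha).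
  assert (E : hd p (map (fun c => (lft c, val c)) (flat_map (children k) cs)) =
          hd p (map (fun c => (lft c, val c)) cs)) by (destruct cs; reflexivity).
  specialize (IH Ha).
  simpl. unfold rgt, aff in *; simpl in *.
  repeat split; try lra; try (f_equal; field).
  rewrite E, <- He. f_equal; field. assumption.
Qed.

Lemma nodes_cells lam n : nodes lam n = nodes_of (cells (6 * lam) n) (1, 0)
  /\ adjacent (cells (6 * lam) n) (1, 0) /\ cells (6 * lam) n <> [].
Proof.
  induction n as [|n (IH & Ha & Hn)].
  - simpl. unfold rgt, aff; simpl. repeat split; try lra; try easy. f_equal; ring.
  - simpl. rewrite IH. destruct (cells (6 * lam) n) as [|c cs]; [easy|].
    split; [|split].
    + exact (refine_nodes_of lam c cs _ Ha).
    + exact (adjacent_children _ (c :: cs) _ Ha).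
    + easy.
Qed.

Lemma adjacent_head_le c0 cs p c : adjacent (c0 :: cs) p -> In c cs -> rgt c0 <= lft c.
Proof.
  revert c0; induction cs as [|d cs IH]; intros c0 (Hl & He & Ha) Hc; [easy|].
  simpl in He. injection He; intros _ Hx.
  destruct Hc as [<-|Hc]; [lra|]. specialize (IH d Ha Hc).
  destruct Ha as (Hd & _). unfold rgt in *; lra.
Qed.

Lemma interp_nodes_of cs p c x : adjacent cs p -> In c cs -> inside c x ->
  interp (nodes_of cs p) x = aff c x.
Proof.
  revert c x; induction cs as [|c0 cs IH]; intros c x Ha Hc Hx; [easy|].
  assert (Ha' := Ha). destruct Ha' as (Hl & He & Hcs).
  assert (E : forall y, y <= rgt c0 -> interp (nodes_of (c0 :: cs) p) y = aff c0 y).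
  { intros y Hy. simpl. destruct (nodes_of cs p) as [|q qs] eqn:Eq; [destruct cs; discriminate|].
    assert (q = (rgt c0, aff c0 (rgt c0))) as ->.
    { destruct cs; simpl in *; congruence. }
    simpl. destruct (Rle_dec y (rgt c0)) as [_|H]; [|lra].
    unfold aff, rgt in *. field. lra. }
  destruct Hc as [<-|Hc]; [apply E, Hx|].
  assert (L := adjacent_head_le _ _ _ _ Ha Hc).
  destruct (Rle_dec x (rgt c0)) as [Hx0|Hx0].
  (* At a common endpoint [interp] answers with the piece on the left, so the equality there is
     continuity with the next cell. *)
  - rewrite E by easy. assert (x = rgt c0) as -> by (destruct Hx; lra).
    rewrite <- (IH c) by easy.
    destruct cs as [|c1 cs]; [easy|].
    simpl in He. injection He; intros Hy Hxx.
    rewrite (IH c1); [|easy|now left|].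
    + unfold aff at 2. rewrite Hy, Hxx. ring.
    + destruct Hcs as (? & _). unfold inside, rgt in *. lra.
  - rewrite <- (IH c) by easy.
    simpl. destruct (nodes_of cs p) as [|q qs] eqn:Eq; [destruct cs; discriminate|].
    assert (q = (rgt c0, aff c0 (rgt c0))) as ->.
    { destruct cs; simpl in *; congruence. }
    simpl. destruct (Rle_dec x (rgt c0)); [lra|reflexivity].
Qed.

Lemma Fn_cell lam n c x : In c (cells (6 * lam) n) -> inside c x -> Fn lam n x = aff c x.
Proof.
  intros. destruct (nodes_cells lam n) as (E & Ha & _). unfold Fn. rewrite E.
  now apply interp_nodes_of.
Qed.

Lemma len_pos k n c : In c (cells k n) -> 0 < len c.
Proof.
  revert c; induction n; simpl; intros c H.
  - destruct H as [<-|[]]; simpl; lra.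
  - apply in_flat_map in H as (d & Hd & H). specialize (IHn d Hd).
    simpl in H. decompose [or] H; subst; simpl; try lra; easy.
Qed.

Lemma child_In k n c i : (i < 4)%nat -> In c (cells k n) -> In (child k i c) (cells k (S n)).
Proof.
  intros Hi H. simpl. apply in_flat_map. exists c; split; [easy|].
  destruct i as [|[|[|[|i]]]]; simpl; auto; lia.
Qed.

Lemma inside_child k i c x : 0 < len c -> inside (child k i c) x -> inside c x.
Proof.
  unfold inside, rgt; intros Hl. destruct i as [|[|[|i]]]; simpl; lra.
Qed.

Fixpoint follow (k : R) (w : nat -> nat) (n : nat) (c : cell) : cell :=
  match n with
  | O => c
  | S n => child k (w n) (follow k w n c)
  end.

Lemma follow_In k w n N c : (forall j, (w j < 4)%nat) -> In c (cells k N) ->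
  In (follow k w n c) (cells k (n + N)).
Proof. intros Hw H; induction n; [easy|]. apply (child_In k (n + N)); auto. Qed.

Definition select (x : R) (c : cell) : nat :=
  if Rle_dec x (lft c + len c / 3) then 0
  else if Rle_dec x (lft c + len c / 2) then 1
  else if Rle_dec x (lft c + 2 * len c / 3) then 2 else 3.

Lemma select_spec k c x : inside c x -> (select x c < 4)%nat /\ inside (child k (select x c) c) x.
Proof.
  unfold inside, rgt, select; intros H.
  repeat destruct Rle_dec; simpl; split; try lia; lra.
Qed.

Fixpoint zoom (k x : R) (n : nat) (c : cell) : cell :=
  match n with
  | O => c
  | S n => child k (select x (zoom k x n c)) (zoom k x n c)
  end.

Lemma branch_through k c x : inside c x ->
  exists w, (forall j, (w j < 4)%nat) /\ forall j, inside (follow k w j c) x.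
Proof.
  intros Hx. exists (fun j => select x (zoom k x j c)).
  assert (H : forall j, inside (zoom k x j c) x).
  { induction j; [easy|]. now apply select_spec. }
  split; [intros j; now apply (select_spec k)|].
  intros j. replace (follow _ _ j c) with (zoom k x j c); [easy|].
  induction j; simpl; congruence.
Qed.

(** * Estimates on F *)

Lemma four_cases (P : nat -> Prop) : P 0%nat -> P 1%nat -> P 2%nat -> P 3%nat ->
  forall i, (i < 4)%nat -> P i.
Proof. intros ? ? ? ? i Hi. destruct i as [|[|[|[|i]]]]; auto; lia. Qed.

Lemma rr_bounds i : 1 / 6 <= rr i <= 1 / 3.
Proof. destruct i as [|[|[|i]]]; simpl; lra. Qed.

Lemma child_len k i c : len (child k i c) = rr i * len c.
Proof. destruct i as [|[|[|i]]]; simpl; field. Qed.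

(** The triangle inequality for the vectors [(1, slp c)] and [(0, t * stretch c)], whose sum is
    [(1, slp d)]. *)
Lemma stretch_shift c d t : slp d = slp c + t * stretch c ->
  stretch d <= (Rabs t + 1) * stretch c.
Proof.
  intros E. generalize (stretch_ge1 c), (stretch_ge1 d), (stretch_sq c), (stretch_sq d),
    (slp_le_stretch c), (Rabs_pos t); intros H1 H2 H3 H4 H5 H6.
  rewrite E in H4.
  assert (Ht : Rabs t * Rabs t = t * t) by (rewrite <- Rabs_mult, Rabs_right; nra).
  assert (H7 : slp c * t <= stretch c * Rabs t).
  { eapply Rle_trans; [apply Rle_abs|]. rewrite Rabs_mult. apply Rmult_le_compat_r; easy. }
  assert (H8 : stretch d * stretch d <= ((Rabs t + 1) * stretch c) * ((Rabs t + 1) * stretch c)).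
  { rewrite H4.
    replace (1 + (slp c + t * stretch c) ^ 2)
      with ((1 + slp c ^ 2) + 2 * (slp c * t) * stretch c + (t * t) * (stretch c * stretch c)) by ring.
    rewrite <- H3, <- Ht. nra. }
  assert (0 < (Rabs t + 1) * stretch c) by nra.
  nra.
Qed.

Lemma child_stretch k i c : 0 <= k -> stretch (child k i c) <= (k + 1) * stretch c.
Proof.
  intros Hk. generalize (stretch_ge1 c); intros H.
  assert (E : stretch c <= (k + 1) * stretch c) by nra.
  destruct i as [|[|[|i]]]; try exact E.
  - assert (A := stretch_shift c (child k 1 c) k eq_refl). rewrite Rabs_right in A; lra.
  - assert (A := stretch_shift c (child k 2 c) (- k) ltac:(simpl; ring)).
    rewrite Rabs_Ropp, Rabs_right in A; lra.
Qed.

(** The steepest child gives the factor [(1 + k) / 6], which dominates the 1/3 of the outer children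
    when [1 <= k]. It is below 1 exactly when [k < 5], and this is why the construction converges
    for lambda < 5/6. *)
Lemma child_len_stretch k i c : 1 <= k -> 0 < len c ->
  len (child k i c) * stretch (child k i c) <= (1 + k) / 6 * (len c * stretch c).
Proof.
  intros Hk Hl. generalize (stretch_ge1 c); intros H.
  assert (0 < len c * stretch c) by (apply Rmult_lt_0_compat; lra).
  assert (0 <= (k - 1) * (len c * stretch c)) by (apply Rmult_le_pos; lra).
  assert (E : len c / 3 * stretch c <= (1 + k) / 6 * (len c * stretch c)) by lra.
  assert (E2 : forall i, stretch (child k i c) <= (k + 1) * stretch c)
    by (intros; apply child_stretch; lra).
  rewrite child_len. destruct i as [|[|[|i]]].
  - change (stretch (child k 0 c)) with (stretch c). unfold rr. lra.
  - specialize (E2 1%nat). apply (Rmult_le_compat_l (len c)) in E2; [|lra]. unfold rr. lra.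
  - specialize (E2 2%nat). apply (Rmult_le_compat_l (len c)) in E2; [|lra]. unfold rr. lra.
  - change (stretch (child k _ c)) with (stretch c). unfold rr. lra.
Qed.

Lemma child_aff k i c x : 0 <= k -> 0 < len c -> inside (child k i c) x ->
  Rabs (aff (child k i c) x - aff c x) <= k / 6 * (len c * stretch c).
Proof.
  intros Hk Hl. generalize (stretch_ge1 c); intros H.
  assert (0 <= k * stretch c) by nra.
  assert (0 <= k / 6 * (len c * stretch c)) by (apply Rmult_le_pos; nra).
  unfold inside, rgt, aff; destruct i as [|[|[|i]]]; simpl; intros Hx.
  - replace (_ - _) with 0 by ring. rewrite Rabs_R0. easy.
  - replace (_ - _) with (k * stretch c * (x - (lft c + len c / 3))) by field.
    rewrite Rabs_right; nra.
  - replace (_ - _) with (k * stretch c * (len c / 6 - (x - (lft c + len c / 2)))) by field.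
    rewrite Rabs_right; nra.
  - replace (_ - _) with 0 by field. rewrite Rabs_R0. easy.
Qed.

Lemma lim_Rabs_le (u : nat -> R) (l a C : R) N :
  is_lim_seq u l -> (forall j, Rabs (u (j + N)%nat - a) <= C) -> Rabs (l - a) <= C.
Proof.
  intros Hu H.
  apply (is_lim_seq_incr_n u N) in Hu.
  assert (L : is_lim_seq (fun j => Rabs (u (j + N)%nat - a)) (Rabs (l - a))).
  { apply (is_lim_seq_abs _ (Finite (l - a))).
    apply (is_lim_seq_minus' _ _ l a Hu (is_lim_seq_const a)). }
  exact (is_lim_seq_le _ _ _ _ H L (is_lim_seq_const C)).
Qed.

Section Graph.
Variable lam : R.
Hypothesis Hlam : 1 / 6 <= lam < 5 / 6.
Let k := 6 * lam.
(** The sum of all later corrections: [k / 6] times the geometric series of ratio [(1 + k) / 6]. *)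
Let K := k / (5 - k).

Let Hk : 1 <= k < 5.
Proof. unfold k; lra. Qed.

Let K_pos : 0 < K.
Proof. unfold K. apply Rdiv_lt_0_compat; lra. Qed.

Let K_eq : K * ((1 + k) / 6) + k / 6 = K.
Proof. unfold K. field. lra. Qed.

Lemma Fn_approx j N c x : In c (cells k N) -> inside c x ->
  Rabs (Fn lam (j + N) x - aff c x) <= K * (len c * stretch c).
Proof.
  revert N c; induction j as [|j IH]; intros N c Hc Hx.
  - simpl. rewrite (Fn_cell lam N c x Hc Hx), Rminus_diag, Rabs_R0.
    assert (L := len_pos _ _ _ Hc). assert (S := stretch_ge1 c).
    apply Rmult_le_pos; nra.
  - destruct (select_spec k c x Hx) as (Hi & Hin). set (i := select x c) in *.
    assert (L := len_pos _ _ _ Hc).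
    assert (A := IH (S N) _ (child_In k N c i Hi Hc) Hin).
    replace (S j + N)%nat with (j + S N)%nat by lia.
    assert (B := child_aff k i c x ltac:(lra) L Hin).
    assert (C := child_len_stretch k i c ltac:(lra) L).
    rewrite <- K_eq.
    replace (Fn lam (j + S N) x - aff c x) with
      ((Fn lam (j + S N) x - aff (child k i c) x) + (aff (child k i c) x - aff c x)) by ring.
    eapply Rle_trans; [apply Rabs_triang|].
    assert (K * (len (child k i c) * stretch (child k i c))
      <= K * ((1 + k) / 6 * (len c * stretch c))) by (apply Rmult_le_compat_l; lra).
    lra.
Qed.

Lemma root_In : In root (cells k 0).
Proof. now left. Qed.

Lemma cell_through x n : 0 <= x <= 1 -> exists c, In c (cells k n) /\ inside c x /\
  len c * stretch c <= ((1 + k) / 6) ^ n.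
Proof.
  intros Hx. induction n as [|n (c & Hc & Hi & Hb)].
  - exists root. split; [apply root_In|]. split.
    + unfold inside, rgt; simpl; lra.
    + unfold stretch; simpl. replace (1 + 0 * (0 * 1)) with 1 by ring. rewrite sqrt_1. lra.
  - destruct (select_spec k c x Hi) as (Hj & Hin).
    exists (child k (select x c) c). split; [now apply child_In|]. split; [easy|].
    assert (L := len_pos _ _ _ Hc).
    eapply Rle_trans; [apply child_len_stretch; lra|]. simpl.
    apply Rmult_le_compat_l; lra.
Qed.

Lemma F_lim x : 0 <= x <= 1 -> is_lim_seq (fun n => Fn lam n x) (F lam x).
Proof.
  intros Hx. apply Lim_seq_correct', ex_lim_seq_cauchy_corr.
  intros eps.
  assert (G : is_lim_seq (fun n => ((1 + k) / 6) ^ n) 0)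
    by (apply is_lim_seq_geom; rewrite Rabs_right; lra).
  apply is_lim_seq_spec in G.
  assert (He : 0 < eps / (2 * K)) by (apply Rdiv_lt_0_compat; [apply eps|lra]).
  destruct (G (mkposreal _ He)) as (N & HN). simpl in HN.
  destruct (cell_through x N Hx) as (c & Hc & Hi & Hb).
  assert (A : forall n, (N <= n)%nat -> Rabs (Fn lam n x - aff c x) < eps / 2).
  { intros n Hn. replace n with ((n - N) + N)%nat by lia.
    eapply Rle_lt_trans; [apply Fn_approx; easy|].
    specialize (HN N (le_n _)). rewrite Rminus_0_r in HN. apply Rabs_def2 in HN.
    replace (eps / 2) with (K * (eps / (2 * K))) by (field; lra).
    apply Rmult_lt_compat_l; lra. }
  exists N. intros n m Hn Hm.
  replace (Fn lam n x - Fn lam m x) with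
    ((Fn lam n x - aff c x) - (Fn lam m x - aff c x)) by ring.
  assert (A1 := A n Hn). assert (A2 := A m Hm).
  apply Rabs_def2 in A1; apply Rabs_def2 in A2. apply Rabs_def1; lra.
Qed.

Lemma inside_unit N c x : In c (cells k N) -> inside c x -> 0 <= x <= 1.
Proof.
  revert c; induction N; simpl; intros c H.
  - destruct H as [<-|[]]; unfold inside, rgt; simpl; lra.
  - apply in_flat_map in H as (d & Hd & H). intros Hx. apply (IHN d Hd).
    assert (L := len_pos _ _ _ Hd).
    destruct H as [<-|[<-|[<-|[<-|[]]]]]; eapply inside_child; eassumption.
Qed.

Lemma F_approx N c x : In c (cells k N) -> inside c x ->
  Rabs (F lam x - aff c x) <= K * (len c * stretch c).
Proof.
  intros Hc Hx. apply (lim_Rabs_le (fun n => Fn lam n x) _ _ _ N).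
  - apply F_lim. now apply (inside_unit N c).
  - intros j; now apply Fn_approx.
Qed.

(* The extreme children keep the endpoint and the slope, so only points at distance comparable to the length matter. *)
Lemma Fn_lipschitz_lft j N c x : In c (cells k N) -> inside c x ->
  Rabs (Fn lam (j + N) x - val c) <= (3 * K + 1) * stretch c * (x - lft c).
Proof.
  revert N c; induction j as [|j IH]; intros N c Hc Hx;
    assert (S1 := stretch_ge1 c); assert (M := slp_le_stretch c);
    assert (L := len_pos _ _ _ Hc); assert (Hx' := Hx); destruct Hx'.
  - simpl. rewrite (Fn_cell lam N c x Hc Hx). unfold aff.
    replace (val c + slp c * (x - lft c) - val c) with (slp c * (x - lft c)) by ring.
    rewrite Rabs_mult, (Rabs_right (x - lft c)) by lra.
    apply Rmult_le_compat_r; nra.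
  - destruct (Rle_dec x (lft c + len c / 3)) as [H3|H3].
    + assert (A := IH (S N) (child k 0 c) (child_In k N c 0 ltac:(lia) Hc)).
      change (stretch (child k 0 c)) with (stretch c) in A.
      unfold inside, rgt in A. simpl in A.
      replace (j + S N)%nat with (S j + N)%nat in A by lia.
      apply A. lra.
    + assert (A := Fn_approx (S j) N c x Hc Hx).
      replace (Fn lam (S j + N) x - val c) with
       ((Fn lam (S j + N) x - aff c x) + slp c * (x - lft c)) by (unfold aff; ring).
      eapply Rle_trans; [apply Rabs_triang|].
      rewrite Rabs_mult, (Rabs_right (x - lft c)) by lra.
      assert (K * stretch c * (len c) <= K * stretch c * (3 * (x - lft c)))
        by (apply Rmult_le_compat_l; nra).
      nra.
Qed.

Lemma Fn_lipschitz_rgt j N c x : In c (cells k N) -> inside c x ->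
  Rabs (Fn lam (j + N) x - aff c (rgt c)) <= (3 * K + 1) * stretch c * (rgt c - x).
Proof.
  revert N c; induction j as [|j IH]; intros N c Hc Hx;
    assert (S1 := stretch_ge1 c); assert (M := slp_le_stretch c);
    assert (L := len_pos _ _ _ Hc); assert (Hx' := Hx); destruct Hx'.
  - simpl. rewrite (Fn_cell lam N c x Hc Hx). unfold aff.
    replace (_ - _) with (- (slp c * (rgt c - x))) by ring.
    rewrite Rabs_Ropp, Rabs_mult, (Rabs_right (rgt c - x)) by lra.
    apply Rmult_le_compat_r; nra.
  - destruct (Rle_dec (lft c + 2 * len c / 3) x) as [H3|H3].
    + assert (A := IH (S N) (child k 3 c) (child_In k N c 3 ltac:(lia) Hc)).
      assert (Er : rgt (child k 3 c) = rgt c) by (unfold rgt; simpl; field).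
      assert (Ea : aff (child k 3 c) (rgt (child k 3 c)) = aff c (rgt c))
        by (rewrite Er; unfold aff; simpl; field).
      rewrite Ea in A. unfold inside in A. rewrite Er in A.
      replace (j + S N)%nat with (S j + N)%nat in A by lia.
      apply A. simpl. lra.
    + assert (A := Fn_approx (S j) N c x Hc Hx).
      replace (Fn lam (S j + N) x - aff c (rgt c)) with
       ((Fn lam (S j + N) x - aff c x) + - (slp c * (rgt c - x))) by (unfold aff; ring).
      eapply Rle_trans; [apply Rabs_triang|].
      rewrite Rabs_Ropp, Rabs_mult, (Rabs_right (rgt c - x)) by lra.
      assert (K * stretch c * (len c) <= K * stretch c * (3 * (rgt c - x)))
        by (apply Rmult_le_compat_l; unfold rgt in *; nra).
      nra.
Qed.

Lemma F_lipschitz_lft N c x : In c (cells k N) -> inside c x ->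
  Rabs (F lam x - val c) <= (3 * K + 1) * stretch c * (x - lft c).
Proof.
  intros Hc Hx. apply (lim_Rabs_le (fun n => Fn lam n x) _ _ _ N).
  - apply F_lim. now apply (inside_unit N c).
  - intros j; now apply Fn_lipschitz_lft.
Qed.

Lemma F_lipschitz_rgt N c x : In c (cells k N) -> inside c x ->
  Rabs (F lam x - aff c (rgt c)) <= (3 * K + 1) * stretch c * (rgt c - x).
Proof.
  intros Hc Hx. apply (lim_Rabs_le (fun n => Fn lam n x) _ _ _ N).
  - apply F_lim. now apply (inside_unit N c).
  - intros j; now apply Fn_lipschitz_rgt.
Qed.

Lemma F_lft N c : In c (cells k N) -> F lam (lft c) = val c.
Proof.
  intros Hc. assert (L := len_pos _ _ _ Hc).
  assert (A := F_lipschitz_lft N c (lft c) Hc ltac:(unfold inside, rgt; lra)).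
  rewrite Rminus_diag, Rmult_0_r in A.
  apply Rminus_diag_uniq, Rabs_eq_0, Rle_antisym; [easy|apply Rabs_pos].
Qed.

Lemma F_rgt N c : In c (cells k N) -> F lam (rgt c) = aff c (rgt c).
Proof.
  intros Hc. assert (L := len_pos _ _ _ Hc).
  assert (A := F_lipschitz_rgt N c (rgt c) Hc ltac:(unfold inside, rgt; lra)).
  rewrite Rminus_diag, Rmult_0_r in A.
  apply Rminus_diag_uniq, Rabs_eq_0, Rle_antisym; [easy|apply Rabs_pos].
Qed.

(** Adjacent children share an endpoint, where the one-sided Lipschitz bounds of both apply; other
    children are at distance at least [len c / 6], where the approximation by [aff c] is good
    enough. Only the stretch of the common parent enters. *)
Lemma F_increment_lt N c i j x y : In c (cells k N) -> (i < j)%nat -> (j < 4)%nat ->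
  inside (child k i c) x -> inside (child k j c) y ->
  Rabs (F lam x - F lam y) <= (12 * K + (3 * K + 1) * (k + 1)) * stretch c * Rabs (x - y).
Proof.
  intros Hc Hij Hj Hx Hy.
  assert (L := len_pos _ _ _ Hc). assert (S1 := stretch_ge1 c).
  assert (M := slp_le_stretch c).
  assert (G : 0 < 3 * K + 1) by lra.
  destruct (Nat.eq_dec j (S i)) as [->|Hne].
  - assert (E : rgt (child k i c) = lft (child k (S i) c)).
    { unfold rgt. destruct i as [|[|[|i]]]; simpl; try field; lia. }
    assert (Hi : In (child k i c) (cells k (S N))) by (apply child_In; [lia|easy]).
    assert (Hi' : In (child k (S i) c) (cells k (S N))) by (apply child_In; [lia|easy]).
    assert (A := F_lipschitz_rgt _ _ _ Hi Hx). rewrite <- (F_rgt _ _ Hi), E in A.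
    assert (B := F_lipschitz_lft _ _ _ Hi' Hy). rewrite <- (F_lft _ _ Hi') in B.
    destruct Hx as [_ Hx], Hy as [Hy _]. rewrite E in Hx.
    set (p := lft (child k (S i) c)) in *.
    assert (A' : stretch (child k i c) * (p - x) <= (k + 1) * stretch c * (p - x))
      by (apply Rmult_le_compat_r; [lra|apply child_stretch; lra]).
    assert (B' : stretch (child k (S i) c) * (y - p) <= (k + 1) * stretch c * (y - p))
      by (apply Rmult_le_compat_r; [lra|apply child_stretch; lra]).
    rewrite (Rabs_left1 (x - y)) by lra.
    replace (F lam x - F lam y) with ((F lam x - F lam p) + - (F lam y - F lam p)) by ring.
    eapply Rle_trans; [apply Rabs_triang|]. rewrite Rabs_Ropp.
    apply (Rmult_le_compat_l (3 * K + 1)) in A'; [|lra].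
    apply (Rmult_le_compat_l (3 * K + 1)) in B'; [|lra].
    assert (0 <= 12 * K * stretch c * (y - x)) by (apply Rmult_le_pos; nra).
    lra.
  - assert (D : x + len c / 6 <= y).
    { revert Hx Hy. unfold inside, rgt.
      destruct i as [|[|[|i]]]; destruct j as [|[|[|[|j]]]]; try lia; simpl; lra. }
    assert (A := F_approx _ _ _ Hc (inside_child _ _ _ _ L Hx)).
    assert (B := F_approx _ _ _ Hc (inside_child _ _ _ _ L Hy)).
    rewrite (Rabs_left1 (x - y)) by lra.
    replace (F lam x - F lam y) with
      ((F lam x - aff c x) + (- (F lam y - aff c y) + slp c * (x - y))) by (unfold aff; ring).
    eapply Rle_trans; [apply Rabs_triang|].
    eapply Rle_trans; [apply Rplus_le_compat_l, Rabs_triang|].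
    rewrite Rabs_Ropp, Rabs_mult, (Rabs_left1 (x - y)) by lra.
    assert (A1 : K * stretch c * len c <= K * stretch c * (6 * (y - x)))
      by (apply Rmult_le_compat_l; nra).
    assert (A2 : Rabs (slp c) * - (x - y) <= stretch c * - (x - y))
      by (apply Rmult_le_compat_r; lra).
    assert (A3 : 1 <= (3 * K + 1) * (k + 1)) by nra.
    assert (A4 : 1 * (stretch c * (y - x)) <= (3 * K + 1) * (k + 1) * (stretch c * (y - x)))
      by (apply Rmult_le_compat_r; nra).
    lra.
Qed.

Lemma F_increment : exists C, 0 < C /\ forall N c i j x y, In c (cells k N) ->
  i <> j -> (i < 4)%nat -> (j < 4)%nat ->
  inside (child k i c) x -> inside (child k j c) y ->
  Rabs (F lam x - F lam y) <= C * stretch c * Rabs (x - y).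
Proof.
  exists (12 * K + (3 * K + 1) * (k + 1)). split; [nra|].
  intros N c i j x y Hc Hn Hi Hj Hx Hy.
  destruct (Nat.lt_ge_cases i j).
  - now apply (F_increment_lt N c i j).
  - rewrite Rabs_minus_sym, (Rabs_minus_sym x). apply (F_increment_lt N c j i); auto; lia.
Qed.

(** Endpoints and apex keep their values in all later generations, so the identity is exact. A
    second difference is used because it ignores the affine part of the polynomial in
    [holder_at]. *)
Lemma F_second_difference N c : In c (cells k N) ->
  F lam (lft c + len c / 2) - (F lam (lft c) + F lam (rgt c)) / 2 = k / 6 * len c * stretch c.
Proof.
  intros Hc. rewrite (F_lft N c Hc), (F_rgt N c Hc).
  assert (A := F_lft _ _ (child_In k N c 2 ltac:(lia) Hc)). simpl in A. rewrite A.
  unfold aff, rgt. field.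
Qed.

End Graph.

(** * Pointwise regularity along a branch *)

Lemma Rpower_pos x y : 0 < Rpower x y.
Proof. apply exp_pos. Qed.

Lemma ln_neg x : 0 < x <= 1 -> ln x <= 0.
Proof. intros. rewrite <- ln_1. destruct (Req_dec x 1); [subst; lra|]. left; apply ln_increasing; lra. Qed.

Lemma exp_le x y : x <= y -> exp x <= exp y.
Proof. intros [H| ->]; [left; now apply exp_increasing|lra]. Qed.

Lemma Rpower_antitone_exp x p q : 0 < x <= 1 -> p <= q -> Rpower x q <= Rpower x p.
Proof. intros Hx H. apply exp_le. generalize (ln_neg x Hx). nra. Qed.

Lemma Rpower_antitone_base x y p : 0 < x <= y -> p <= 0 -> Rpower y p <= Rpower x p.
Proof.
  intros Hx H. apply exp_le.
  assert (ln x <= ln y) by (destruct (Req_dec x y); [subst; lra|left; apply ln_increasing; lra]).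
  nra.
Qed.

Lemma Rpower_monotone_base x y p : 0 < x <= y -> 0 <= p -> Rpower x p <= Rpower y p.
Proof.
  intros Hx H. apply exp_le.
  assert (ln x <= ln y) by (destruct (Req_dec x y); [subst; lra|left; apply ln_increasing; lra]).
  nra.
Qed.

Lemma Rpower_ge1 x p : 0 < x <= 1 -> p <= 0 -> 1 <= Rpower x p.
Proof.
  intros. rewrite <- exp_0. apply exp_le. generalize (ln_neg x H). nra.
Qed.

Lemma rpow_le x y p : 0 <= x <= y -> 0 < y -> 0 < p -> rpow x p <= Rpower y p.
Proof.
  intros Hx Hy Hp. unfold rpow. destruct Req_EM_T.
  - destruct Req_EM_T; [lra|]. left; apply Rpower_pos.
  - apply Rpower_monotone_base; lra.
Qed.

Lemma sum_n_constant_poly (c : nat -> R) y n : (forall i, (0 < i)%nat -> c i = 0) ->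
  sum_n (fun i => c i * y ^ i) n = c 0%nat.
Proof.
  intros H. induction n.
  - rewrite sum_O. simpl. ring.
  - rewrite sum_Sn, IHn, (H (S n)) by lia. unfold plus; simpl. ring.
Qed.

(** The second difference of [u ^ S n] involves the first difference of [u ^ n], hence the joint
    induction. *)
Lemma pow_second_difference n : exists E, forall u v, Rabs u <= 1 -> Rabs v <= 1 ->
  Rabs (u ^ n - v ^ n) <= E * Rabs (u - v) /\
  Rabs ((u ^ n + v ^ n) / 2 - ((u + v) / 2) ^ n) <= E * Rabs (u - v) ^ 2.
Proof.
  induction n as [|n (E & IH)].
  - exists 0. intros. simpl. split.
    + rewrite Rminus_diag, Rabs_R0. lra.
    + replace ((1 + 1) / 2 - 1) with 0 by field. rewrite Rabs_R0. lra.
  - exists (E + 1 + E). intros u v Hu Hv. destruct (IH u v Hu Hv) as (A & B).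
    assert (D := Rabs_pos (u - v)).
    assert (Pu : Rabs (v ^ n) <= 1).
    { rewrite <- RPow_abs, <- (pow1 n). apply pow_incr. split; [apply Rabs_pos|easy]. }
    assert (Hm : Rabs ((u + v) / 2) <= 1) by (apply Rabs_le_between in Hu, Hv; apply Rabs_le; lra).
    assert (A0 : 0 <= E * Rabs (u - v)) by (eapply Rle_trans; [apply Rabs_pos|apply A]).
    assert (B0 : 0 <= E * Rabs (u - v) ^ 2) by (eapply Rle_trans; [apply Rabs_pos|apply B]).
    assert (D2 : 0 <= Rabs (u - v) ^ 2) by nra.
    split.
    + replace (u ^ S n - v ^ S n) with (u * (u ^ n - v ^ n) + v ^ n * (u - v)) by (simpl; ring).
      eapply Rle_trans; [apply Rabs_triang|]. rewrite !Rabs_mult.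
      assert (Rabs u * Rabs (u ^ n - v ^ n) <= 1 * Rabs (u ^ n - v ^ n))
        by (apply Rmult_le_compat_r; [apply Rabs_pos|easy]).
      assert (Rabs (v ^ n) * Rabs (u - v) <= 1 * Rabs (u - v))
        by (apply Rmult_le_compat_r; easy).
      lra.
    + replace ((u ^ S n + v ^ S n) / 2 - ((u + v) / 2) ^ S n) with
       ((u + v) / 2 * ((u ^ n + v ^ n) / 2 - ((u + v) / 2) ^ n)
         + (u - v) / 4 * (u ^ n - v ^ n)) by (simpl; field).
      eapply Rle_trans; [apply Rabs_triang|]. rewrite !Rabs_mult.
      assert (Rabs ((u + v) / 2) * Rabs ((u ^ n + v ^ n) / 2 - ((u + v) / 2) ^ n)
        <= 1 * Rabs ((u ^ n + v ^ n) / 2 - ((u + v) / 2) ^ n))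
        by (apply Rmult_le_compat_r; [apply Rabs_pos|easy]).
      assert (Rabs ((u - v) / 4) * Rabs (u ^ n - v ^ n) <=
              Rabs (u - v) * (E * Rabs (u - v))).
      { apply Rmult_le_compat; try apply Rabs_pos; [|easy].
        unfold Rdiv. rewrite Rabs_mult, (Rabs_right (/ 4)) by lra. lra. }
      nra.
Qed.

Lemma poly_second_difference (c : nat -> R) n : exists E, forall u v, Rabs u <= 1 -> Rabs v <= 1 ->
  Rabs ((sum_n (fun i => c i * u ^ i) n + sum_n (fun i => c i * v ^ i) n) / 2
     - sum_n (fun i => c i * ((u + v) / 2) ^ i) n) <= E * Rabs (u - v) ^ 2.
Proof.
  induction n as [|n (E & IH)].
  - exists 0. intros u v Hu Hv. rewrite !sum_O. simpl.
    replace ((c 0%nat * 1 + c 0%nat * 1) / 2 - c 0%nat * 1) with 0 by field.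
    rewrite Rabs_R0. lra.
  - destruct (pow_second_difference (S n)) as (E' & HE').
    exists (E + Rabs (c (S n)) * E'). intros u v Hu Hv.
    rewrite !sum_Sn. change plus with Rplus.
    specialize (IH u v Hu Hv). destruct (HE' u v Hu Hv) as [_ H].
    set (a := sum_n (fun i => c i * u ^ i) n) in *.
    set (b := sum_n (fun i => c i * v ^ i) n) in *.
    set (d := sum_n (fun i => c i * ((u + v) / 2) ^ i) n) in *.
    set (un := u ^ S n) in *. set (vn := v ^ S n) in *. set (mn := ((u + v) / 2) ^ S n) in *.
    clearbody a b d un vn mn. change R in a, b, d.
    replace ((a + c (S n) * un + (b + c (S n) * vn)) / 2 - (d + c (S n) * mn)) with
      (((a + b) / 2 - d) + c (S n) * ((un + vn) / 2 - mn)) by field.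
    eapply Rle_trans; [apply Rabs_triang|]. rewrite Rabs_mult.
    apply (Rmult_le_compat_l (Rabs (c (S n)))) in H; [|apply Rabs_pos].
    lra.
Qed.

Lemma pow3_small eps : 0 < eps -> exists N, forall n, (N <= n)%nat -> (1 / 3) ^ n < eps.
Proof.
  intros He.
  assert (G : is_lim_seq (fun n => (1 / 3) ^ n) 0)
    by (apply is_lim_seq_geom; rewrite Rabs_right; lra).
  apply is_lim_seq_spec in G. destruct (G (mkposreal _ He)) as (N & HN).
  exists N. intros n Hn. specialize (HN n Hn). simpl in HN.
  rewrite Rminus_0_r in HN. now apply Rabs_def2 in HN.
Qed.

Section Branch.
Variable lam : R.
Hypothesis Hlam : 1 / 6 <= lam < 5 / 6.
Let k := 6 * lam.
Let Hk : 1 <= k < 5.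
Proof. unfold k; lra. Qed.
Variable w : nat -> nat.
Hypothesis Hw : forall j, (w j < 4)%nat.
Let c (n : nat) : cell := follow k w n root.

Lemma branch_In n : In (c n) (cells k n).
Proof.
  replace (cells k n) with (cells k (n + 0)) by (f_equal; lia).
  apply follow_In; [easy|now left].
Qed.

Lemma branch_len_pos n : 0 < len (c n).
Proof. exact (len_pos _ _ _ (branch_In n)). Qed.

Lemma branch_len_le n : len (c n) <= (1 / 3) ^ n.
Proof.
  induction n; [simpl; lra|]. change (c (S n)) with (child k (w n) (c n)).
  rewrite child_len. generalize (rr_bounds (w n)), (branch_len_pos n). simpl. nra.
Qed.

Lemma branch_len_bounds n : 0 < len (c n) <= 1.
Proof.
  split; [apply branch_len_pos|]. eapply Rle_trans; [apply branch_len_le|].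
  apply Rle_trans with (1 ^ n); [apply pow_incr; lra|rewrite pow1; lra].
Qed.

Lemma branch_stretch_le n : stretch (c n) <= (k + 1) ^ n.
Proof.
  induction n.
  - unfold stretch; simpl. replace (1 + 0 * (0 * 1)) with 1 by ring. rewrite sqrt_1. lra.
  - change (c (S n)) with (child k (w n) (c n)).
    eapply Rle_trans; [apply child_stretch; lra|]. simpl. apply Rmult_le_compat_l; lra.
Qed.

Definition growth (b : R) : Prop :=
  exists K, 0 < K /\ forall n, stretch (c n) <= K * Rpower (len (c n)) (- b).

Lemma growth_le b b' : b <= b' -> growth b -> growth b'.
Proof.
  intros Hb (K & HK & H). exists K; split; [easy|]. intros n.
  eapply Rle_trans; [apply H|]. apply Rmult_le_compat_l; [lra|].
  apply Rpower_antitone_exp; [apply branch_len_bounds|lra].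
Qed.

Lemma growth_of_eventually b K N : 0 <= b -> 0 < K ->
  (forall n, (N <= n)%nat -> stretch (c n) <= K * Rpower (len (c n)) (- b)) -> growth b.
Proof.
  intros Hb HK H. exists (K + (k + 1) ^ N).
  assert (P : 0 < (k + 1) ^ N) by (apply pow_lt; lra).
  split; [lra|]. intros n.
  assert (G := Rpower_ge1 (len (c n)) (- b) (branch_len_bounds n) ltac:(lra)).
  destruct (Nat.le_gt_cases N n) as [Hn|Hn].
  - specialize (H n Hn). assert (0 <= (k + 1) ^ N * Rpower (len (c n)) (- b)) by nra. lra.
  - assert (A := branch_stretch_le n).
    assert (B : (k + 1) ^ n <= (k + 1) ^ N) by (apply Rle_pow; [lra|lia]).
    assert (0 <= (k + 1) ^ N * (Rpower (len (c n)) (- b) - 1)) by (apply Rmult_le_pos; lra).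
    assert (0 <= K * Rpower (len (c n)) (- b)) by nra. lra.
Qed.

Variable x0 : R.
Hypothesis Hx0 : forall n, inside (c n) x0.

(** If [x] leaves the branch just after [c n], then [x] and [x0] lie in different children of [c n],
    so [F_increment] applies, and [Rabs (x - x0) <= len (c n)] converts the stretch into a power of
    the distance. Since the exponent is at most 1, the constant polynomial [F lam x0] is enough. *)
Lemma holder_of_growth b : 0 <= b < 1 -> growth b -> holder_at (F lam) x0 (1 - b).
Proof.
  intros Hb (K & HK & HG). destruct (F_increment lam Hlam) as (C & HC & HF).
  exists (fun i => match i with O => F lam x0 | _ => 0 end), (C * K), 1.
  split; [nra|]. split; [lra|]. intros x Hx _.
  rewrite sum_n_constant_poly by (intros [|i]; [lia|easy]).
  destruct (Req_dec x x0) as [->|Hne].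
  { rewrite !Rminus_diag, Rabs_R0. unfold rpow. destruct Req_EM_T; [|easy].
    destruct Req_EM_T; lra. }
  assert (Hd : 0 < Rabs (x - x0)) by (apply Rabs_pos_lt; lra).
  unfold rpow. destruct Req_EM_T as [|_]; [lra|].
  destruct (classic (exists n, ~ inside (c n) x)) as [Hout|Hin].
  2:{ destruct (pow3_small _ Hd) as (N & HN). specialize (HN N (le_n _)).
      assert (inside (c N) x) as Hi by (apply NNPP; intros ?; apply Hin; now exists N).
      assert (Hj := Hx0 N). assert (L := branch_len_le N).
      exfalso. unfold inside, rgt in *. revert HN. apply Rle_not_lt.
      apply Rabs_le; lra. }
  assert (Hstep : exists n, inside (c n) x /\ ~ inside (c (S n)) x).
  { destruct Hout as (m & Hn). induction m as [|m IH].
    - exfalso; apply Hn. unfold inside, rgt; simpl; lra.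
    - destruct (classic (inside (c m) x)); [now exists m|auto]. }
  destruct Hstep as (n & Hi & Ho).
  destruct (select_spec k (c n) x Hi) as (Hs & Hin).
  assert (Hn : select x (c n) <> w n).
  { intros E. apply Ho. change (c (S n)) with (child k (w n) (c n)). now rewrite <- E. }
  assert (A := HF n (c n) _ (w n) x x0 (branch_In n) Hn Hs (Hw n) Hin (Hx0 (S n))).
  eapply Rle_trans; [apply A|].
  assert (L : Rabs (x - x0) <= len (c n)).
  { assert (Hj := Hx0 n). unfold inside, rgt in *. apply Rabs_le; lra. }
  replace (1 - b) with (- b + 1) by ring. rewrite Rpower_plus, Rpower_1 by easy.
  rewrite <- Rmult_assoc. apply Rmult_le_compat_r; [lra|].
  rewrite Rmult_assoc. apply Rmult_le_compat_l; [lra|].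
  eapply Rle_trans; [apply HG|]. apply Rmult_le_compat_l; [lra|].
  apply Rpower_antitone_base; lra.
Qed.

(** Over a cell the second difference of [F] is of order [len * stretch], while that of a polynomial
    is of order [len ^ 2]; dividing by [len] leaves the two terms of the bound. *)
Lemma stretch_le_of_holder al : 0 < al -> holder_at (F lam) x0 al ->
  exists K N, 0 < K /\ forall n, (N <= n)%nat ->
    stretch (c n) <= K * Rpower (len (c n)) (al - 1) + K * len (c n).
Proof.
  intros Hal (p & C & delta & HC & Hdelta & H).
  destruct (poly_second_difference p (Z.to_nat (Int_part al))) as (E & HE).
  destruct (pow3_small delta Hdelta) as (N & HN).
  (* [6 / k] inverts the factor of [F_second_difference]; the errors at the two ends, halved, and at
     the midpoint add up to [2 * C], and the polynomial costs [Rabs E * len ^ 2]. *)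
  exists (6 / k * (2 * C + Rabs E)), N.
  assert (HE0 := Rabs_pos E).
  assert (Hk6 : 0 < 6 / k) by (apply Rdiv_lt_0_compat; lra).
  split; [nra|]. intros n Hn. specialize (HN n Hn).
  set (l := len (c n)). set (a := lft (c n)).
  assert (Ll := branch_len_le n). assert (Lb := branch_len_bounds n).
  fold l in Ll, Lb.
  assert (Hi := Hx0 n). unfold inside, rgt in Hi. fold l a in Hi.
  assert (Hpt : forall x, a <= x <= a + l -> 0 <= x <= 1 /\ Rabs (x - x0) <= l).
  { intros x Hx. split; [apply (inside_unit lam n (c n) x (branch_In n) Hx)|].
    apply Rabs_le; lra. }
  assert (Herr : forall x, a <= x <= a + l -> Rabs (F lam x -
     sum_n (fun i => p i * (x - x0) ^ i) (Z.to_nat (Int_part al))) <= C * Rpower l al).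
  { intros x Hx. destruct (Hpt x Hx) as [H1 H2].
    eapply Rle_trans; [apply H; [easy|lra]|].
    apply Rmult_le_compat_l; [lra|]. apply rpow_le; [|lra|easy].
    split; [apply Rabs_pos|easy]. }
  assert (D := F_second_difference lam Hlam n (c n) (branch_In n)).
  fold k l a in D. unfold rgt in D. fold l a in D.
  assert (A1 := Herr a ltac:(lra)). assert (A2 := Herr (a + l) ltac:(lra)).
  assert (A3 := Herr (a + l / 2) ltac:(lra)).
  assert (Q := HE (a - x0) (a + l - x0)).
  replace ((a - x0 + (a + l - x0)) / 2) with (a + l / 2 - x0) in Q by field.
  replace (a - x0 - (a + l - x0)) with (- l) in Q by ring.
  rewrite Rabs_Ropp, (Rabs_right l) in Q by lra.
  assert (Q' := Q ltac:(destruct (Hpt a); lra) ltac:(destruct (Hpt (a + l)); lra)). clear Q.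
  set (deg := Z.to_nat (Int_part al)) in *.
  set (p1 := sum_n (fun i => p i * (a - x0) ^ i) deg) in *.
  set (p2 := sum_n (fun i => p i * (a + l - x0) ^ i) deg) in *.
  set (p3 := sum_n (fun i => p i * (a + l / 2 - x0) ^ i) deg) in *.
  apply Rabs_le_between in A1, A2, A3, Q'.
  assert (E1 : E * l ^ 2 <= Rabs E * l ^ 2) by (apply Rmult_le_compat_r; [nra|apply Rle_abs]).
  assert (M : k / 6 * l * stretch (c n) <= l * (2 * C * Rpower l (al - 1) + Rabs E * l)).
  { rewrite <- D. replace al with ((al - 1) + 1) in A1, A2, A3 by ring.
    rewrite Rpower_plus, Rpower_1 in A1, A2, A3 by lra. lra. }
  assert (M' : k / 6 * stretch (c n) <= 2 * C * Rpower l (al - 1) + Rabs E * l)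
    by (apply (Rmult_le_reg_l l); lra).
  apply (Rmult_le_compat_l (6 / k)) in M'; [|lra].
  replace (6 / k * (k / 6 * stretch (c n))) with (stretch (c n)) in M' by (field; lra).
  assert (P := Rpower_pos l (al - 1)).
  assert (0 <= 6 / k * C * l) by (apply Rmult_le_pos; nra).
  assert (0 <= 6 / k * Rabs E * Rpower l (al - 1)) by (apply Rmult_le_pos; nra).
  lra.
Qed.

(** The stretch is at least 1. Hence the bound of [stretch_le_of_holder] cannot tend to 0, which
    excludes [al > 1]; for [al <= 1] its second term is absorbed by the first. *)
Lemma growth_of_holder al : 0 < al -> holder_at (F lam) x0 al -> al <= 1 /\ growth (1 - al).
Proof.
  intros Hal H. destruct (stretch_le_of_holder al Hal H) as (K & N & HK & HS).
  assert (Hle : al <= 1).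
  { apply Rnot_lt_le. intros Hgt.
    (* Both terms of the bound are at most [K * len ^ e]; once this is below 1/4 the stretch would
       be below 1. *)
    set (e := Rmin (al - 1) 1).
    assert (He : 0 < e) by (apply Rmin_pos; lra).
    assert (Hsm : 0 < Rpower (1 / (4 * K)) (/ e)) by apply Rpower_pos.
    destruct (pow3_small _ Hsm) as (N' & HN').
    set (n := Nat.max N N').
    specialize (HS n ltac:(lia)). specialize (HN' n ltac:(lia)).
    assert (L := branch_len_le n). assert (Lb := branch_len_bounds n).
    assert (A : Rpower (len (c n)) e < 1 / (4 * K)).
    { apply Rlt_le_trans with (Rpower (Rpower (1 / (4 * K)) (/ e)) e).
      - unfold Rpower at 1 2. apply exp_increasing, Rmult_lt_compat_l; [easy|].
        apply ln_increasing; lra.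
      - rewrite Rpower_mult, Rinv_l, Rpower_1; try lra.
        apply Rdiv_lt_0_compat; lra. }
    assert (B : Rpower (len (c n)) (al - 1) <= Rpower (len (c n)) e)
      by (apply Rpower_antitone_exp; [easy|apply Rmin_l]).
    assert (B' : len (c n) <= Rpower (len (c n)) e).
    { rewrite <- (Rpower_1 (len (c n))) at 1 by lra.
      apply Rpower_antitone_exp; [easy|apply Rmin_r]. }
    assert (S1 := stretch_ge1 (c n)).
    assert (K * Rpower (len (c n)) e < / 4).
    { apply Rlt_le_trans with (K * (1 / (4 * K))); [apply Rmult_lt_compat_l; lra|].
      right; field; lra. }
    nra. }
  split; [easy|].
  apply (growth_of_eventually _ (2 * K) N); [lra|lra|].
  intros n Hn. specialize (HS n Hn). replace (- (1 - al)) with (al - 1) by ring.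
  assert (Lb := branch_len_bounds n).
  assert (G := Rpower_ge1 (len (c n)) (al - 1) Lb ltac:(lra)).
  assert (K * len (c n) <= K * Rpower (len (c n)) (al - 1)) by (apply Rmult_le_compat_l; lra).
  lra.
Qed.

Lemma growth_max : growth (ln (k + 1) / ln 6).
Proof.
  exists 1. split; [lra|]. intros n. rewrite Rmult_1_l.
  assert (L6 : 0 < ln 6) by (rewrite <- ln_1; apply ln_increasing; lra).
  assert (Lk : 0 < ln (k + 1)) by (rewrite <- ln_1; apply ln_increasing; lra).
  set (b := ln (k + 1) / ln 6).
  assert (Hb : 0 < b) by (apply Rdiv_lt_0_compat; lra).
  assert (E6 : Rpower (1 / 6) (- b) = k + 1).
  { unfold Rpower. replace (1 / 6) with (/ 6) by field. rewrite ln_Rinv by lra.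
    replace (- b * - ln 6) with (ln (k + 1)) by (unfold b; field; lra). apply exp_ln; lra. }
  induction n.
  - change (c 0%nat) with root. unfold stretch; simpl.
    replace (1 + 0 * (0 * 1)) with 1 by ring. rewrite sqrt_1.
    apply Rpower_ge1; lra.
  - change (c (S n)) with (child k (w n) (c n)). rewrite child_len.
    rewrite <- Rpower_mult_distr; [|generalize (rr_bounds (w n)); lra|apply branch_len_pos].
    assert (Hs : stretch (child k (w n) (c n)) <= Rpower (rr (w n)) (- b) * stretch (c n)).
    { assert (A : 1 * stretch (c n) <= Rpower (rr (w n)) (- b) * stretch (c n)).
      { apply Rmult_le_compat_r; [generalize (stretch_ge1 (c n)); lra|].
        apply Rpower_ge1; [generalize (rr_bounds (w n)); lra|lra]. }
      assert (B := child_stretch k (w n) (c n) ltac:(lra)).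
      destruct (w n) as [|[|[|i]]]; unfold rr in *; try rewrite E6; try easy.
      - change (stretch (child k 0 (c n))) with (stretch (c n)). lra.
      - change (stretch (child k _ (c n))) with (stretch (c n)). lra. }
    eapply Rle_trans; [apply Hs|]. apply Rmult_le_compat_l; [left; apply Rpower_pos|easy].
Qed.

Lemma holder_exp_spec_growth beta eps : beta < 1 -> 0 < eps ->
  holder_exp (F lam) x0 = Finite (1 - beta) ->
  growth (beta + eps) /\ (0 <= beta - eps -> ~ growth (beta - eps)).
Proof.
  intros Hbeta He E.
  assert (L := Lub_Rbar_correct (fun al => 0 <= al /\ holder_at (F lam) x0 al)).
  fold (holder_exp (F lam) x0) in L. rewrite E in L. destruct L as [L1 L2].
  split.
  - apply NNPP. intros Hn.
    (* The truncation keeps [1 - beta - e] positive, so that [growth_of_holder] applies to every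
       exponent above it. *)
    set (e := Rmin eps ((1 - beta) / 2)).
    assert (He' : 0 < e) by (apply Rmin_pos; lra).
    assert (Hub : is_ub_Rbar (fun al => 0 <= al /\ holder_at (F lam) x0 al) (Finite (1 - beta - e))).
    { intros al (Hal & Hh). simpl. apply Rnot_lt_le. intros Hlt. apply Hn.
      assert (e <= (1 - beta) / 2) by apply Rmin_r.
      assert (e <= eps) by apply Rmin_l.
      destruct (growth_of_holder al ltac:(lra) Hh) as [_ G].
      apply (growth_le (1 - al)); [lra|easy]. }
    specialize (L2 _ Hub). simpl in L2. lra.
  - intros H0 G. apply holder_of_growth in G; [|lra].
    assert (L1' := L1 (1 - (beta - eps))). simpl in L1'.
    enough (1 - (beta - eps) <= 1 - beta) by lra. apply L1'. split; [lra|exact G].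
Qed.

Lemma holder_exp_range al : holder_exp (F lam) x0 = Finite al ->
  1 - ln (k + 1) / ln 6 <= al <= 1.
Proof.
  intros E.
  assert (L := Lub_Rbar_correct (fun al => 0 <= al /\ holder_at (F lam) x0 al)).
  fold (holder_exp (F lam) x0) in L. rewrite E in L. destruct L as [L1 L2].
  assert (L6 : 0 < ln 6) by (rewrite <- ln_1; apply ln_increasing; lra).
  assert (Lk : 0 < ln (k + 1)) by (rewrite <- ln_1; apply ln_increasing; lra).
  assert (Lk6 : ln (k + 1) < ln 6) by (apply ln_increasing; lra).
  assert (Hb : 0 < ln (k + 1) / ln 6) by (apply Rdiv_lt_0_compat; lra).
  assert (Hb1 : ln (k + 1) / ln 6 < 1) by (apply Rlt_div_l; lra).
  split.
  - assert (G := holder_of_growth (ln (k + 1) / ln 6) ltac:(lra) growth_max).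
    apply (L1 (1 - ln (k + 1) / ln 6)). split; [lra|exact G].
  - assert (Hub : is_ub_Rbar (fun al => 0 <= al /\ holder_at (F lam) x0 al) (Finite 1)).
    { intros al' (Hal & Hh). simpl. destruct (Req_dec al' 0); [lra|].
      apply (growth_of_holder al'); [lra|easy]. }
    exact (L2 _ Hub).
Qed.

(** The asymmetry of the two growth conditions is that of the branches selected for the lower bound:
    they are steep enough up to a constant, but not too steep only up to a factor linear in the
    generation. *)
Lemma holder_exp_of_growth beta cst : 0 <= beta < 1 -> 0 < cst ->
  (forall eps, 0 < eps -> growth (beta + eps)) ->
  (forall n, cst * Rpower (len (c n)) (- beta) <= stretch (c n)) ->
  holder_exp (F lam) x0 = Finite (1 - beta).
Proof.
  intros Hb Hc HG HL. apply is_lub_Rbar_unique. split.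
  - intros al (Hal & Hh). simpl. apply Rnot_lt_le. intros Hlt.
    destruct (growth_of_holder al ltac:(lra) Hh) as (_ & K & HK & G).
    set (e := beta - (1 - al)). assert (He : 0 < e) by (unfold e; lra).
    assert (Hsm : 0 < Rpower (cst / (2 * K)) (/ e)) by apply Rpower_pos.
    destruct (pow3_small _ Hsm) as (N & HN). specialize (HN N (le_n _)).
    assert (L := branch_len_le N). assert (Lb := branch_len_bounds N).
    assert (A : Rpower (len (c N)) e < cst / (2 * K)).
    { apply Rlt_le_trans with (Rpower (Rpower (cst / (2 * K)) (/ e)) e).
      - unfold Rpower at 1 2. apply exp_increasing, Rmult_lt_compat_l; [easy|].
        apply ln_increasing; lra.
      - rewrite Rpower_mult, Rinv_l, Rpower_1; try lra.
        apply Rdiv_lt_0_compat; lra. }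
    specialize (HL N). specialize (G N).
    replace (- (1 - al)) with (- beta + e) in G by (unfold e; ring).
    rewrite Rpower_plus in G.
    set (y := Rpower (len (c N)) (- beta)) in *. set (z := Rpower (len (c N)) e) in *.
    assert (Hy : 0 < y) by apply Rpower_pos.
    assert (K * z < cst).
    { apply Rlt_trans with (K * (cst / (2 * K))); [apply Rmult_lt_compat_l; lra|].
      replace (K * (cst / (2 * K))) with (cst / 2) by (field; lra). lra. }
    nra.
  - intros u Hu. destruct u as [u| |]; simpl; [|easy|].
    + apply Rnot_lt_le. intros Hlt.
      set (e := Rmin ((1 - beta - u) / 2) ((1 - beta) / 2)).
      assert (He : 0 < e) by (apply Rmin_pos; lra).
      assert (e <= (1 - beta - u) / 2) by apply Rmin_l.
      assert (e <= (1 - beta) / 2) by apply Rmin_r.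
      assert (G := holder_of_growth (beta + e) ltac:(lra) (HG e He)).
      assert (Hu' := Hu (1 - (beta + e))). simpl in Hu'.
      enough (1 - (beta + e) <= u) by lra. apply Hu'. split; [lra|exact G].
    + assert (G := holder_of_growth (beta + (1 - beta) / 2) ltac:(lra) (HG ((1 - beta) / 2) ltac:(lra))).
      apply (Hu (1 - (beta + (1 - beta) / 2))). split; [lra|exact G].
Qed.

End Branch.

(** * Growth of the slopes *)

(* The steep child is on the left or on the right according to the sign of the slope; [letter] undoes this reflection. *)
Definition letter (m : R) (i : nat) : nat :=
  match i with
  | 1%nat => if Rle_dec 0 m then 1 else 2
  | 2%nat => if Rle_dec 0 m then 2 else 1
  | _ => i
  end.

Definition gain (k : R) (j : nat) : R :=
  match j with 1%nat => k + 1 | 2%nat => k - 1 | _ => 1 end.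

(** [Rabs (slp c)] is multiplied by at least the gain at each step, but it may vanish, which
    negative powers do not tolerate. The floor 1/2 preserves this property because
    [(k + 1) * (1 / 2) <= k]. *)
Definition floored_slope (c : cell) : R := Rmax (Rabs (slp c)) (1 / 2).

(** The sum of [gain ^ q * ratio ^ T] over the four letters, in exponential form. A shift of [T] by
    [e >= 0] multiplies it by a factor between [6 ^ (- e)] and [3 ^ (- e)]. *)
Definition press (k q T : R) : R :=
  2 * exp (- T * ln 3) + exp (q * ln (k + 1) - T * ln 6) + exp (q * ln (k - 1) - T * ln 6).

Lemma gain_pos k j : 1 < k -> 0 < gain k j.
Proof. intros. destruct j as [|[|[|j]]]; simpl; lra. Qed.

Lemma rr_letter m i : rr (letter m i) = rr i.
Proof. destruct i as [|[|[|i]]]; simpl; try easy; destruct Rle_dec; easy. Qed.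

Lemma slope_child_cases k i c : 1 < k -> (i < 4)%nat ->
  (letter (slp c) i = 0%nat \/ letter (slp c) i = 3%nat) /\ slp (child k i c) = slp c
  \/ letter (slp c) i = 1%nat /\ Rabs (slp (child k i c)) = k * stretch c + Rabs (slp c)
  \/ letter (slp c) i = 2%nat /\ Rabs (slp (child k i c)) = k * stretch c - Rabs (slp c).
Proof.
  intros Hk Hi. assert (M := slp_le_stretch c). assert (S1 := stretch_ge1 c).
  assert (stretch c <= k * stretch c) by nra.
  destruct i as [|[|[|[|i]]]]; simpl; try lia; auto;
    destruct Rle_dec as [H0|H0]; right;
    [left|right|right|left]; split; auto;
    (destruct (Rle_dec 0 (slp c)); [rewrite (Rabs_right (slp c)) in * by lra|rewrite (Rabs_left1 (slp c)) in * by lra]);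
    try lra;
    first [rewrite Rabs_right by lra; lra | rewrite Rabs_left1 by lra; lra].
Qed.

Lemma floored_slope_child k i c : 1 < k -> (i < 4)%nat ->
  gain k (letter (slp c) i) * floored_slope c <= floored_slope (child k i c).
Proof.
  intros Hk Hi. assert (M := slp_le_stretch c). assert (S1 := stretch_ge1 c).
  assert (A0 := Rabs_pos (slp c)).
  unfold floored_slope.
  destruct (slope_child_cases k i c Hk Hi) as [[[-> | ->] ->]|[[-> ->]|[-> ->]]]; simpl gain; try lra.
  - eapply Rle_trans; [|apply Rmax_l]. unfold Rmax at 1; destruct Rle_dec; nra.
  - eapply Rle_trans; [|apply Rmax_l]. unfold Rmax at 1; destruct Rle_dec; nra.
Qed.

(** The constant 2 comes from the letter 2, where [stretch <= 1 + Rabs slp] is used for the child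
    and for the parent. *)
Lemma stretch_child_gain k i c : 1 < k -> (i < 4)%nat ->
  stretch (child k i c) <= gain k (letter (slp c) i) * stretch c + 2.
Proof.
  intros Hk Hi. assert (M := slp_le_stretch c). assert (S1 := stretch_ge1 c).
  assert (L := stretch_le_slp c). assert (L' := stretch_le_slp (child k i c)).
  destruct (slope_child_cases k i c Hk Hi) as [[[-> | ->] E]|[[-> E]|[-> E]]]; simpl gain.
  - unfold stretch. rewrite E. fold (stretch c). lra.
  - unfold stretch. rewrite E. fold (stretch c). lra.
  - rewrite E in L'. lra.
  - rewrite E in L'. lra.
Qed.

Lemma floored_slope_le_stretch c : floored_slope c <= stretch c.
Proof.
  apply Rmax_lub; [apply slp_le_stretch|]. generalize (stretch_ge1 c); lra.
Qed.

Lemma floored_slope_pos c : 0 < floored_slope c.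
Proof. apply Rlt_le_trans with (1 / 2); [lra|apply Rmax_r]. Qed.

Lemma letter_sum m (h : nat -> R) :
  h (letter m 0) + h (letter m 1) + h (letter m 2) + h (letter m 3) = h 0%nat + h 1%nat + h 2%nat + h 3%nat.
Proof. simpl. destruct Rle_dec; ring. Qed.

Lemma ln3_pos : 0 < ln 3.
Proof. rewrite <- ln_1. apply ln_increasing; lra. Qed.

Lemma ln6_gt : ln 3 < ln 6.
Proof. apply ln_increasing; lra. Qed.

Lemma ln_third : ln (1 / 3) = - ln 3.
Proof. replace (1 / 3) with (/ 3) by field. apply ln_Rinv; lra. Qed.

Lemma ln_sixth : ln (1 / 6) = - ln 6.
Proof. replace (1 / 6) with (/ 6) by field. apply ln_Rinv; lra. Qed.

Lemma press_sum k q T :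
  press k q T = Rpower (gain k 0) q * Rpower (rr 0) T + Rpower (gain k 1) q * Rpower (rr 1) T
    + Rpower (gain k 2) q * Rpower (rr 2) T + Rpower (gain k 3) q * Rpower (rr 3) T.
Proof.
  unfold press, Rpower; simpl. rewrite ln_third, ln_sixth, ln_1, Rmult_0_r, exp_0.
  rewrite <- !exp_plus.
  replace (T * - ln 3) with (- T * ln 3) by ring.
  replace (q * ln (k + 1) + T * - ln 6) with (q * ln (k + 1) - T * ln 6) by ring.
  replace (q * ln (k - 1) + T * - ln 6) with (q * ln (k - 1) - T * ln 6) by ring.
  ring.
Qed.

Lemma press_pos k q T : 0 < press k q T.
Proof.
  unfold press. generalize (exp_pos (- T * ln 3)), (exp_pos (q * ln (k + 1) - T * ln 6)),
    (exp_pos (q * ln (k - 1) - T * ln 6)). lra.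
Qed.

Lemma press_shift_le k q T e : 0 <= e -> press k q (T + e) <= exp (- e * ln 3) * press k q T.
Proof.
  intros He. generalize ln3_pos, ln6_gt; intros. unfold press.
  replace (- (T + e) * ln 3) with (- e * ln 3 + - T * ln 3) by ring.
  replace (q * ln (k + 1) - (T + e) * ln 6) with (- e * ln 6 + (q * ln (k + 1) - T * ln 6)) by ring.
  replace (q * ln (k - 1) - (T + e) * ln 6) with (- e * ln 6 + (q * ln (k - 1) - T * ln 6)) by ring.
  rewrite !exp_plus.
  assert (A : exp (- e * ln 6) <= exp (- e * ln 3)) by (apply exp_le; nra).
  generalize (exp_pos (q * ln (k + 1) - T * ln 6)), (exp_pos (q * ln (k - 1) - T * ln 6)).
  intros. nra.
Qed.

Lemma press_shift_ge k q T e : 0 <= e -> exp (- e * ln 6) * press k q T <= press k q (T + e).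
Proof.
  intros He. generalize ln3_pos, ln6_gt; intros. unfold press.
  replace (- (T + e) * ln 3) with (- e * ln 3 + - T * ln 3) by ring.
  replace (q * ln (k + 1) - (T + e) * ln 6) with (- e * ln 6 + (q * ln (k + 1) - T * ln 6)) by ring.
  replace (q * ln (k - 1) - (T + e) * ln 6) with (- e * ln 6 + (q * ln (k - 1) - T * ln 6)) by ring.
  rewrite !exp_plus.
  assert (A : exp (- e * ln 6) <= exp (- e * ln 3)) by (apply exp_le; nra).
  generalize (exp_pos (- T * ln 3)). intros. nra.
Qed.

Lemma exp_ln_mult n x : 0 < x -> exp (INR n * ln x) = x ^ n.
Proof. intros. apply (Rpower_pow n x H). Qed.

Lemma press_0_1 k : press k 0 1 = 1.
Proof.
  unfold press. rewrite !Rmult_0_l.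
  replace (- (1) * ln 3) with (- ln 3) by ring. replace (0 - 1 * ln 6) with (- ln 6) by ring.
  rewrite !exp_Ropp, !exp_ln by lra. field.
Qed.

(** [2 <= k * k] says that the product of the gains [k + 1] and [k - 1] is at least 1. The
    inequality of arithmetic and geometric means then gives [press k q 1 >= 2 / 3 + 2 / 6 = 1]. *)
Lemma press_T_ge1 k q T : 1 < k -> 2 <= k * k -> 0 <= q -> press k q T <= 1 -> 1 <= T.
Proof.
  intros Hk Hk2 Hq H. apply Rnot_lt_le. intros HT.
  assert (A := press_shift_le k q T (1 - T) ltac:(lra)).
  replace (T + (1 - T)) with 1 in A by ring.
  assert (B : exp (- (1 - T) * ln 3) < 1).
  { apply Rlt_le_trans with (exp 0); [|rewrite exp_0; lra].
    apply exp_increasing. generalize ln3_pos. nra. }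
  assert (C := press_pos k q T).
  assert (D : 1 <= press k q 1).
  { unfold press.
    replace (- (1) * ln 3) with (- ln 3) by ring.
    replace (q * ln (k + 1) - 1 * ln 6) with (q * ln (k + 1) + - ln 6) by ring.
    replace (q * ln (k - 1) - 1 * ln 6) with (q * ln (k - 1) + - ln 6) by ring.
    rewrite !exp_plus, !exp_Ropp, !exp_ln by lra.
    assert (E : 1 <= exp (q * ln (k + 1)) * exp (q * ln (k - 1))).
    { rewrite <- exp_plus, <- Rmult_plus_distr_l, <- ln_mult by lra.
      apply Rle_trans with (exp 0); [rewrite exp_0; lra|].
      apply exp_le. apply Rmult_le_pos; [easy|].
      apply Rle_trans with (ln 1); [rewrite ln_1; lra|].
      destruct (Req_dec ((k + 1) * (k - 1)) 1) as [E|]; [rewrite E; lra|].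
      left. apply ln_increasing; nra. }
    assert (X := exp_pos (q * ln (k + 1))). assert (Y := exp_pos (q * ln (k - 1))).
    set (x := exp (q * ln (k + 1))) in *. set (y := exp (q * ln (k - 1))) in *.
    assert (4 <= (x + y) * (x + y)) by (generalize (Rle_0_sqr (x - y)); unfold Rsqr; nra).
    assert (2 <= x + y) by nra.
    lra. }
  nra.
Qed.

(** * Enumeration of all cells and summation over the tree *)

Fixpoint tree_fuel (k : R) (f n : nat) : cell :=
  match f, n with
  | S f, S m => child k (m mod 4) (tree_fuel k f (m / 4))
  | _, _ => root
  end.

(* Breadth-first enumeration of all cells: the children of number n have numbers 4n+1, ..., 4n+4. *)
Definition tree (k : R) (n : nat) : cell := tree_fuel k n n.

Lemma tree_fuel_enough k f g n : (n <= f)%nat -> (n <= g)%nat -> tree_fuel k f n = tree_fuel k g n.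
Proof.
  revert g n; induction f as [|f IH]; intros g n Hf Hg.
  - replace n with 0%nat by lia. now destruct g.
  - destruct n as [|m]; [now destruct g|]. destruct g as [|g]; [lia|].
    change (child k (m mod 4) (tree_fuel k f (m / 4)) = child k (m mod 4) (tree_fuel k g (m / 4))).
    f_equal. assert (m / 4 <= m)%nat by (apply Nat.Div0.div_le_upper_bound; lia).
    apply IH; lia.
Qed.

Lemma tree_child k n i : (i < 4)%nat -> tree k (4 * n + 1 + i) = child k i (tree k n).
Proof.
  intros Hi. replace (4 * n + 1 + i)%nat with (S (i + n * 4)) by lia. unfold tree.
  set (m := (i + n * 4)%nat).
  change (child k (m mod 4) (tree_fuel k m (m / 4)) = child k i (tree_fuel k n n)). unfold m.
  rewrite Nat.Div0.mod_add, Nat.mod_small by lia.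
  rewrite Nat.div_add, Nat.div_small by lia. f_equal. apply tree_fuel_enough; lia.
Qed.

Lemma tree_root k : tree k 0 = root.
Proof. reflexivity. Qed.

Lemma tree_parent n : (n = 0 \/ exists m i, i < 4 /\ n = 4 * m + 1 + i)%nat.
Proof.
  destruct n as [|n]; [now left|]. right. exists (n / 4)%nat, (n mod 4)%nat.
  split; [apply Nat.mod_upper_bound; lia|]. generalize (Nat.div_mod_eq n 4). lia.
Qed.

Lemma tree_len k n : 0 < len (tree k n) <= 1.
Proof.
  induction n as [n IH] using (well_founded_induction lt_wf).
  destruct (tree_parent n) as [->|(m & i & Hi & ->)].
  - rewrite tree_root. simpl. lra.
  - rewrite tree_child, child_len by easy. specialize (IH m ltac:(lia)).
    generalize (rr_bounds i). nra.
Qed.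

Lemma tree_len_small k delta : 0 < delta -> exists N, forall n, (N <= n)%nat -> len (tree k n) <= delta.
Proof.
  intros Hd. destruct (pow3_small delta Hd) as (j & Hj). specialize (Hj j (le_n _)).
  assert (H : forall j, exists N, forall n, (N <= n)%nat -> len (tree k n) <= (1 / 3) ^ j).
  { clear. induction j as [|j (N & IH)].
    - exists 0%nat. intros. simpl. apply tree_len.
    - exists (4 * N + 1)%nat. intros n Hn.
      destruct (tree_parent n) as [->|(m & i & Hi & ->)]; [lia|].
      rewrite tree_child, child_len by easy. specialize (IH m ltac:(lia)).
      generalize (rr_bounds i), (tree_len k m). simpl. nra. }
  destruct (H j) as (N & HN). exists N. intros n Hn. specialize (HN n Hn). lra.
Qed.

Fixpoint tree_index (w : nat -> nat) (n : nat) : nat :=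
  match n with O => O | S n => 4 * tree_index w n + 1 + w n end%nat.

Lemma tree_follow k w n : (forall j, (w j < 4)%nat) -> tree k (tree_index w n) = follow k w n root.
Proof. intros Hw. induction n; [easy|]. change (tree k (4 * tree_index w n + 1 + w n) = child k (w n) (follow k w n root)). rewrite tree_child by easy. now rewrite IHn. Qed.

Lemma tree_index_ge w n : (n <= tree_index w n)%nat.
Proof. induction n; simpl; lia. Qed.

(** The numbers 1 to [4 * n + 4] are exactly those of the children of 0 to [n], so the sum up to
    [4 * n + 4] is at most [f 0] plus [rho] times the sum up to [n]. *)
Lemma tree_summable (f : nat -> R) rho : 0 <= rho < 1 -> (forall n, 0 <= f n) ->
  (forall n, f (4 * n + 1 + 0)%nat + f (4 * n + 1 + 1)%nat + f (4 * n + 1 + 2)%nat + f (4 * n + 1 + 3)%nat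
     <= rho * f n) ->
  forall n, sum_n f n <= f 0%nat / (1 - rho).
Proof.
  intros Hr Hf H n.
  assert (A : forall n, sum_n f (4 * n + 4) <= f 0%nat + rho * sum_n f n).
  { clear n; induction n as [|n IH].
    - specialize (H 0%nat). simpl in H. simpl. rewrite !sum_Sn, !sum_O. unfold plus; simpl. lra.
    - specialize (H (S n)). replace (4 * S n + 4)%nat with (S (S (S (S (4 * n + 4))))) by lia.
      rewrite !sum_Sn. change plus with Rplus.
      replace (4 * S n + 1 + 0)%nat with (S (4 * n + 4)) in H by lia.
      replace (4 * S n + 1 + 1)%nat with (S (S (4 * n + 4))) in H by lia.
      replace (4 * S n + 1 + 2)%nat with (S (S (S (4 * n + 4)))) in H by lia.
      replace (4 * S n + 1 + 3)%nat with (S (S (S (S (4 * n + 4))))) in H by lia.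
      lra. }
  assert (B : forall m, sum_n f n <= sum_n f (m + n)).
  { induction m; [simpl; lra|]. simpl. rewrite sum_Sn. unfold plus; simpl.
    specialize (Hf (S (m + n))). lra. }
  specialize (A n). specialize (B (3 * n + 4)%nat).
  replace (3 * n + 4 + n)%nat with (4 * n + 4)%nat in B by lia.
  apply Rle_div_r; lra.
Qed.

(** * Upper bound for the dimension *)

Lemma rpow_nonneg y a : 0 <= rpow y a.
Proof.
  unfold rpow. destruct Req_EM_T; [destruct Req_EM_T; lra|left; apply Rpower_pos].
Qed.

Lemma cpow_nonneg U s : 0 <= cpow U s.
Proof. unfold cpow. destruct excluded_middle_informative; [apply rpow_nonneg|lra]. Qed.

Lemma sum_n_nonneg (u : nat -> R) n : (forall i, 0 <= u i) -> 0 <= sum_n u n.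
Proof.
  intros H. induction n; [rewrite sum_O; apply H|].
  rewrite sum_Sn. change plus with Rplus. specialize (H (S n)). lra.
Qed.

Lemma sum_n_incr (u : nat -> R) n m : (forall i, 0 <= u i) -> (n <= m)%nat -> sum_n u n <= sum_n u m.
Proof.
  intros H Hm. induction Hm; [lra|].
  rewrite sum_Sn. change plus with Rplus. specialize (H (S m)). lra.
Qed.

Lemma sum_n_le (u v : nat -> R) n : (forall i, u i <= v i) -> sum_n u n <= sum_n v n.
Proof.
  intros H. induction n; [rewrite !sum_O; apply H|].
  rewrite !sum_Sn. change plus with Rplus. specialize (H (S n)). lra.
Qed.

Lemma bounded_sum_lim (u : nat -> R) M : (forall i, 0 <= u i) -> (forall n, sum_n u n <= M) ->
  exists v, is_lim_seq (sum_n u) (Finite v) /\ 0 <= v <= M.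
Proof.
  intros Hu HM.
  assert (E : ex_finite_lim_seq (sum_n u)).
  { apply (ex_finite_lim_seq_incr _ M); [|easy]. intros n.
    apply sum_n_incr; [easy|lia]. }
  destruct E as (v & Hv). exists v. split; [easy|]. split.
  - exact (is_lim_seq_le (fun _ => 0) _ _ _ (fun n => sum_n_nonneg u n Hu) (is_lim_seq_const 0) Hv).
  - exact (is_lim_seq_le _ (fun _ => M) _ _ HM Hv (is_lim_seq_const M)).
Qed.

Lemma bounded_sum_tail (f : nat -> R) M eps : (forall i, 0 <= f i) -> (forall n, sum_n f n <= M) ->
  0 < eps -> exists N, forall n, sum_n (fun i => if (i <=? N)%nat then 0 else f i) n <= eps.
Proof.
  intros Hf HM He. destruct (bounded_sum_lim f M Hf HM) as (v & Hv & _).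
  assert (Hub : forall n, sum_n f n <= v).
  { intros n. apply is_lim_seq_incr_compare; [easy|].
    intros m. apply sum_n_incr; [easy|lia]. }
  apply is_lim_seq_spec in Hv. destruct (Hv (mkposreal _ He)) as (N & HN).
  exists N. set (g := fun i => if (i <=? N)%nat then 0 else f i).
  assert (Hg : forall i, 0 <= g i) by (intros i; unfold g; destruct Nat.leb; [lra|easy]).
  assert (A : forall m, sum_n g (m + N) + sum_n f N = sum_n f (m + N)).
  { induction m.
    - simpl. enough (forall p, (p <= N)%nat -> sum_n g p = 0) as -> by (lia || lra).
      induction p; intros Hp.
      + rewrite sum_O. unfold g. destruct (Nat.leb_spec 0 N); [easy|lia].
      + rewrite sum_Sn, IHp by lia. unfold g. destruct (Nat.leb_spec (S p) N); [|lia].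
        unfold plus; simpl; ring.
    - simpl. rewrite !sum_Sn. change plus with Rplus. rewrite <- IHm.
      unfold g at 2. destruct (Nat.leb_spec (S (m + N)) N); [lia|]. ring. }
  intros n. eapply Rle_trans; [apply (sum_n_incr g n (n + N)); [easy|lia]|].
  specialize (A n). specialize (HN N (le_n _)). simpl in HN. apply Rabs_def2 in HN.
  specialize (Hub (n + N)%nat). lra.
Qed.

Lemma diam_le U r : (forall x y, U x -> U y -> Rabs (x - y) <= r) -> Rbar_le (diamR U) (Finite r).
Proof.
  intros H. destruct (Lub_Rbar_correct (fun r => exists x y, U x /\ U y /\ r = Rabs (x - y))) as [_ L].
  apply L. intros t (x & y & Hx & Hy & ->). now apply H.
Qed.

Lemma diam_nonneg U x : U x -> Rbar_le (Finite 0) (diamR U).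
Proof.
  intros H. destruct (Lub_Rbar_correct (fun r => exists x y, U x /\ U y /\ r = Rabs (x - y))) as [L _].
  apply (L 0). exists x, x. repeat split; auto. now rewrite Rminus_diag, Rabs_R0.
Qed.

Lemma cpow_le U s r : 0 < s -> 0 < r -> (forall x y, U x -> U y -> Rabs (x - y) <= r) ->
  cpow U s <= Rpower r s.
Proof.
  intros Hs Hr H. unfold cpow. destruct excluded_middle_informative as [(x & Hx)|].
  - assert (A := diam_le U r H). assert (B := diam_nonneg U x Hx).
    destruct (diamR U) as [d| |]; simpl in *; try easy. apply rpow_le; lra.
  - left; apply Rpower_pos.
Qed.

Lemma Lim_sum_nonneg (u : nat -> R) v : (forall i, 0 <= u i) -> Lim_seq (sum_n u) = Finite v -> 0 <= v.
Proof.
  intros H E. assert (L := Lim_seq_le_loc (fun _ => 0) (sum_n u)).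
  rewrite Lim_seq_const, E in L. apply L. exists 0%nat. intros; now apply sum_n_nonneg.
Qed.

Lemma Hmeas_zero s E : (forall delta eps, 0 < delta -> 0 < eps ->
    exists U : nat -> R -> Prop, (forall i, Rbar_le (diamR (U i)) (Finite delta)) /\
    (forall x, E x -> exists i, U i x) /\
    exists v, Lim_seq (sum_n (fun i => cpow (U i) s)) = Finite v /\ v <= eps) ->
  Hmeas s E = Finite 0.
Proof.
  intros H.
  assert (Hd : forall delta, 0 < delta -> Hdelta s delta E = Finite 0).
  { intros delta Hdelta. apply is_glb_Rbar_unique. split.
    - intros v (U & _ & _ & Hv). apply (Lim_sum_nonneg (fun i => cpow (U i) s)); [|easy].
      intros; apply cpow_nonneg.
    - intros b Hb. destruct b as [b| |]; [| |easy].
      + apply Rnot_lt_le. intros Hlt.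
        destruct (H delta (b / 2) Hdelta ltac:(lra)) as (U & H1 & H2 & v & Hv & Hle).
        assert (Hb' := Hb v (ex_intro _ U (conj H1 (conj H2 Hv)))). simpl in Hb'. lra.
      + destruct (H delta 1 Hdelta ltac:(lra)) as (U & H1 & H2 & v & Hv & Hle).
        destruct (Hb v (ex_intro _ U (conj H1 (conj H2 Hv)))). }
  apply Rbar_is_lub_unique. split.
  - intros v (delta & Hdelta & ->). rewrite Hd by easy. simpl; lra.
  - intros b Hb. rewrite <- (Hd 1 ltac:(lra)). apply Hb. exists 1; split; [lra|easy].
Qed.

(** The Borel-Cantelli covering: points of [E] lie in cells satisfying [Q] of arbitrarily large
    number, so the tails of a convergent series bound the cost of covers by arbitrarily small
    cells. *)
Lemma Hmeas_zero_of_tree k s E (Q : nat -> Prop) (f : nat -> R) M : 0 < s ->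
  (forall n, 0 <= f n) -> (forall n, sum_n f n <= M) ->
  (forall n, Q n -> Rpower (len (tree k n)) s <= f n) ->
  (forall x N, E x -> exists n, (N <= n)%nat /\ Q n /\ inside (tree k n) x) ->
  Hmeas s E = Finite 0.
Proof.
  intros Hs Hf HM HQ HE. apply Hmeas_zero. intros delta eps Hd He.
  destruct (bounded_sum_tail f M eps Hf HM He) as (N1 & HN1).
  destruct (tree_len_small k delta Hd) as (N2 & HN2).
  set (N := (N1 + N2)%nat).
  (* Discarded indices give the empty set, for which [cpow] is 0. *)
  exists (fun i x => (N < i)%nat /\ Q i /\ inside (tree k i) x).
  assert (Hdist : forall i x y, inside (tree k i) x -> inside (tree k i) y ->
    Rabs (x - y) <= len (tree k i)).
  { unfold inside, rgt. intros i x y Hx Hy. apply Rabs_le; lra. }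
  split; [|split].
  - intros i. apply diam_le. intros x y (H1 & _ & Hx) (_ & _ & Hy).
    apply Rle_trans with (len (tree k i)); [now apply Hdist|]. apply HN2. lia.
  - intros x Hx. destruct (HE x (S N) Hx) as (n & Hn & Hq & Hi). exists n. split; [lia|now split].
  - destruct (bounded_sum_lim (fun i => cpow (fun x => (N < i)%nat /\ Q i /\ inside (tree k i) x) s) eps)
      as (v & Hv & Hv').
    + intros; apply cpow_nonneg.
    + intros n. eapply Rle_trans; [|apply (HN1 n)]. apply sum_n_le. intros i.
      destruct (classic ((N < i)%nat /\ Q i)) as [(H1 & H2)|Hno].
      * destruct (Nat.leb_spec i N1); [lia|].
        eapply Rle_trans; [|now apply HQ]. apply cpow_le; [easy|apply tree_len|].
        intros x y (_ & _ & Hx) (_ & _ & Hy). now apply Hdist.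
      * unfold cpow. destruct excluded_middle_informative as [(x & Hx1 & Hx2 & _)|]; [tauto|].
        destruct Nat.leb; [lra|apply Hf].
    + exists v. split; [|lra]. now apply is_lim_seq_unique.
Qed.

(** For large [s] the summand 2 costs a factor close to 1; the remaining range of [s] is bounded and
    goes into [C]. *)
Lemma affine_power_bound q zeta g : 0 <= q -> 0 < zeta -> 0 < g -> exists C, 0 <= C /\
  forall s, 1 <= s -> Rpower (g * s + 2) q <= (1 + zeta) * (Rpower g q * Rpower s q) + C.
Proof.
  intros Hq Hz Hg.
  (* The factor allowed before taking powers: [t ^ q <= 1 + zeta]. The denominator [q + 1] also
     covers [q = 0]. *)
  set (t := exp (ln (1 + zeta) / (q + 1))).
  assert (Ht : 1 < t).
  { unfold t. apply Rle_lt_trans with (exp 0); [rewrite exp_0; lra|].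
    apply exp_increasing. apply Rdiv_lt_0_compat; [|lra].
    rewrite <- ln_1. apply ln_increasing; lra. }
  assert (Htq : Rpower t q <= 1 + zeta).
  { unfold Rpower, t. rewrite ln_exp. rewrite <- (exp_ln (1 + zeta)) at 2 by lra.
    apply exp_le.
    assert (0 < ln (1 + zeta)) by (rewrite <- ln_1; apply ln_increasing; lra).
    replace (q * (ln (1 + zeta) / (q + 1))) with (ln (1 + zeta) * (q / (q + 1))) by (field; lra).
    assert (q / (q + 1) <= 1) by (apply Rle_div_l; lra). nra. }
  (* The point where [g * s + 2 = t * (g * s)]. *)
  set (s0 := 2 / (g * (t - 1))).
  assert (Hs0 : 0 < s0) by (apply Rdiv_lt_0_compat; nra).
  exists (Rpower (g * s0 + 2) q). split; [left; apply Rpower_pos|].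
  intros s Hs.
  assert (P1 := Rpower_pos g q). assert (P2 := Rpower_pos s q).
  assert (P3 : 0 < Rpower g q * Rpower s q) by nra.
  destruct (Rle_dec s s0) as [Hle|Hgt].
  - assert (Rpower (g * s + 2) q <= Rpower (g * s0 + 2) q) by (apply Rpower_monotone_base; nra).
    nra.
  - assert (A : g * s + 2 <= t * (g * s)).
    { assert (g * (t - 1) * s0 = 2) by (unfold s0; field; lra).
      assert (g * (t - 1) * s0 <= g * (t - 1) * s) by (apply Rmult_le_compat_l; nra). lra. }
    assert (B : Rpower (g * s + 2) q <= Rpower (t * (g * s)) q) by (apply Rpower_monotone_base; nra).
    rewrite <- !Rpower_mult_distr in B by nra.
    assert (C := Rpower_pos (g * s0 + 2) q). nra.
Qed.

Lemma exp_shift_lt1 e : 0 < e -> exp (- e * ln 3) < 1.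
Proof.
  intros. rewrite <- exp_0. apply exp_increasing. generalize ln3_pos. nra.
Qed.

Lemma sum_children_weights k q T m :
  Rpower (gain k (letter m 0)) q * Rpower (rr 0) T + Rpower (gain k (letter m 1)) q * Rpower (rr 1) T
  + Rpower (gain k (letter m 2)) q * Rpower (rr 2) T + Rpower (gain k (letter m 3)) q * Rpower (rr 3) T
  = press k q T.
Proof.
  rewrite <- (rr_letter m 0), <- (rr_letter m 1), <- (rr_letter m 2), <- (rr_letter m 3), press_sum.
  exact (letter_sum m (fun j => Rpower (gain k j) q * Rpower (rr j) T)).
Qed.

Section Upper.
Variable k : R.
Hypothesis Hk : 1 < k.
Variables q T eta : R.
Hypothesis Heta : 0 < eta.
Hypothesis Hpress : press k q T <= 1.

(** For [q <= 0] lower bounds on slopes become upper bounds on powers, and [floored_slope] satisfies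
    them without error. *)
Lemma summable_neg : q <= 0 -> exists (f : nat -> R) M,
  (forall n, sum_n f n <= M) /\
  (forall n, Rpower (stretch (tree k n)) q * Rpower (len (tree k n)) (T + eta) <= f n).
Proof.
  intros Hq.
  set (f := fun n => Rpower (floored_slope (tree k n)) q * Rpower (len (tree k n)) (T + eta)).
  assert (Hf : forall n, 0 <= f n)
    by (intros; apply Rmult_le_pos; left; apply Rpower_pos).
  exists f, (f 0%nat / (1 - exp (- eta * ln 3))). split.
  - apply tree_summable; [|easy|].
    + generalize (exp_shift_lt1 eta Heta), (exp_pos (- eta * ln 3)). lra.
    + intros n. set (c := tree k n).
      assert (L : 0 < len c) by apply tree_len.
      assert (B : forall i, (i < 4)%nat -> f (4 * n + 1 + i)%nat <=
        f n * (Rpower (gain k (letter (slp c) i)) q * Rpower (rr i) (T + eta))).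
      { intros i Hi. unfold f. rewrite tree_child by easy. fold c.
        rewrite child_len, <- Rpower_mult_distr by (try easy; generalize (rr_bounds i); lra).
        assert (G := gain_pos k (letter (slp c) i) Hk).
        assert (Fp := floored_slope_pos c).
        assert (A : Rpower (floored_slope (child k i c)) q <=
           Rpower (gain k (letter (slp c) i)) q * Rpower (floored_slope c) q).
        { rewrite Rpower_mult_distr by easy. apply Rpower_antitone_base; [|easy].
          split; [nra|]. now apply floored_slope_child. }
        generalize (Rpower_pos (rr i) (T + eta)), (Rpower_pos (len c) (T + eta)). intros P1 P2.
        assert (P3 := Rmult_lt_0_compat _ _ P1 P2).
        apply (Rmult_le_compat_r _ _ _ (Rlt_le _ _ P3)) in A. lra. }
      generalize (B 0%nat ltac:(lia)), (B 1%nat ltac:(lia)), (B 2%nat ltac:(lia)), (B 3%nat ltac:(lia)).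
      intros.
      eapply Rle_trans; [repeat apply Rplus_le_compat; eassumption|].
      rewrite <- !Rmult_plus_distr_l, sum_children_weights, Rmult_comm.
      apply Rmult_le_compat_r; [apply Hf|].
      eapply Rle_trans; [apply press_shift_le; lra|].
      generalize (exp_pos (- eta * ln 3)). nra.
  - intros n. apply Rmult_le_compat_r; [left; apply Rpower_pos|].
    apply Rpower_antitone_base; [|easy].
    split; [apply floored_slope_pos|apply floored_slope_le_stretch].
Qed.

(** The additive constant of [affine_power_bound] is carried by the moment of order 0, added with a
    coefficient [c0]; this moment contracts because [T >= 1], so that [T + eta] exceeds 1. *)
Lemma summable_pos : 2 <= k * k -> 0 <= q -> exists (f : nat -> R) M,
  (forall n, sum_n f n <= M) /\
  (forall n, Rpower (stretch (tree k n)) q * Rpower (len (tree k n)) (T + eta) <= f n).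
Proof.
  intros Hkk Hq.
  assert (HT : 1 <= T) by (apply (press_T_ge1 k q); easy).
  set (r0 := exp (- eta * ln 3)).
  assert (Hr0 : 0 < r0 < 1) by (split; [apply exp_pos|now apply exp_shift_lt1]).
  (* The contraction [r0] leaves room up to [rho]. The identities [(1 + zeta) * r0 = rho] and
     [(C + c0) * r0 = rho * c0] spend it on the multiplicative and on the additive error. *)
  set (rho := (1 + r0) / 2).
  set (zeta := (1 - r0) / 2 / r0).
  assert (Hz : 0 < zeta) by (apply Rdiv_lt_0_compat; lra).
  assert (Hzr : (1 + zeta) * r0 = rho) by (unfold zeta, rho; field; lra).
  assert (HC : exists C, 0 <= C /\ forall j s, 1 <= s ->
    Rpower (gain k j * s + 2) q <= (1 + zeta) * (Rpower (gain k j) q * Rpower s q) + C).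
  { destruct (affine_power_bound q zeta 1 Hq Hz ltac:(lra)) as (C0 & HC0 & H0).
    destruct (affine_power_bound q zeta (k + 1) Hq Hz ltac:(lra)) as (C1 & HC1 & H1).
    destruct (affine_power_bound q zeta (k - 1) Hq Hz ltac:(lra)) as (C2 & HC2 & H2).
    exists (C0 + C1 + C2). split; [lra|]. intros j s Hs.
    specialize (H0 s Hs). specialize (H1 s Hs). specialize (H2 s Hs).
    destruct j as [|[|[|j]]]; unfold gain; lra. }
  destruct HC as (C & HC0 & HC).
  set (c0 := C * r0 / (rho - r0)).
  assert (Hrr : 0 < rho - r0) by (unfold rho; lra).
  assert (Hc0 : 0 <= c0) by (apply Rdiv_le_0_compat; nra).
  assert (Hc0' : (C + c0) * r0 = rho * c0) by (unfold c0; field; lra).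
  set (f := fun n => (Rpower (stretch (tree k n)) q + c0) * Rpower (len (tree k n)) (T + eta)).
  assert (Hf : forall n, 0 <= f n).
  { intros n. generalize (Rpower_pos (stretch (tree k n)) q), (Rpower_pos (len (tree k n)) (T + eta)).
    unfold f. intros. apply Rmult_le_pos; lra. }
  exists f, (f 0%nat / (1 - rho)). split.
  - apply tree_summable; [unfold rho; lra|easy|].
    intros n. set (c := tree k n).
    assert (L : 0 < len c) by apply tree_len.
    set (l := Rpower (len c) (T + eta)). set (sq := Rpower (stretch c) q).
    assert (B : forall i, (i < 4)%nat -> f (4 * n + 1 + i)%nat <=
      (1 + zeta) * sq * l * (Rpower (gain k (letter (slp c) i)) q * Rpower (rr i) (T + eta))
       + (C + c0) * l * (Rpower (gain k (letter (slp c) i)) 0 * Rpower (rr i) (T + eta))).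
    { intros i Hi. unfold f. rewrite tree_child by easy. fold c.
      rewrite child_len, <- Rpower_mult_distr by (try easy; generalize (rr_bounds i); lra).
      fold l.
      assert (G := gain_pos k (letter (slp c) i) Hk).
      rewrite (Rpower_O (gain _ _)) by easy.
      assert (S1 := stretch_ge1 (child k i c)).
      assert (A : Rpower (stretch (child k i c)) q <= Rpower (gain k (letter (slp c) i) * stretch c + 2) q).
      { apply Rpower_monotone_base; [|easy]. split; [lra|]. now apply stretch_child_gain. }
      assert (A' := HC (letter (slp c) i) (stretch c) (stretch_ge1 c)). fold sq in A'.
      generalize (Rpower_pos (rr i) (T + eta)), (Rpower_pos (len c) (T + eta)). fold l. intros P1 P2.
      assert (P3 := Rmult_lt_0_compat _ _ P1 P2).
      assert (A2 : Rpower (stretch (child k i c)) q + c0 <=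
        (1 + zeta) * (Rpower (gain k (letter (slp c) i)) q * sq) + (C + c0)) by lra.
      apply (Rmult_le_compat_r _ _ _ (Rlt_le _ _ P3)) in A2. lra. }
    generalize (B 0%nat ltac:(lia)), (B 1%nat ltac:(lia)), (B 2%nat ltac:(lia)), (B 3%nat ltac:(lia)).
    intros.
    apply Rle_trans with ((1 + zeta) * sq * l * press k q (T + eta) + (C + c0) * l * press k 0 (T + eta)).
    { rewrite <- (sum_children_weights k q (T + eta) (slp c)),
        <- (sum_children_weights k 0 (T + eta) (slp c)). lra. }
    assert (Q1 : press k q (T + eta) <= r0).
    { eapply Rle_trans; [apply press_shift_le; lra|]. fold r0. nra. }
    assert (Q2 : press k 0 (T + eta) <= r0).
    { replace (T + eta) with (1 + (T - 1 + eta)) by ring.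
      eapply Rle_trans; [apply press_shift_le; lra|]. rewrite press_0_1, Rmult_1_r.
      apply exp_le. generalize ln3_pos. nra. }
    assert (Hl : 0 < l) by apply Rpower_pos. assert (Hsq : 0 < sq) by apply Rpower_pos.
    assert (X1 : (1 + zeta) * sq * l * press k q (T + eta) <= (1 + zeta) * sq * l * r0).
    { apply Rmult_le_compat_l; [|easy]. repeat apply Rmult_le_pos; lra. }
    assert (X2 : (C + c0) * l * press k 0 (T + eta) <= (C + c0) * l * r0).
    { apply Rmult_le_compat_l; [|easy]. apply Rmult_le_pos; lra. }
    replace (rho * f n) with (rho * sq * l + rho * c0 * l) by (unfold f; fold c; fold l; fold sq; ring).
    rewrite <- Hc0', <- Hzr. lra.
  - intros n. unfold f.
    assert (P := Rpower_pos (len (tree k n)) (T + eta)). nra.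
Qed.

End Upper.

Lemma unit_branch k x : 0 <= x <= 1 -> exists w, (forall j, (w j < 4)%nat) /\
  forall n, inside (follow k w n root) x.
Proof. intros Hx. apply branch_through. unfold inside, rgt; simpl; lra. Qed.

Lemma growth_small_constant lam w b e : 1 / 6 <= lam < 5 / 6 -> (forall j, (w j < 4)%nat) ->
  0 < e -> growth lam w b -> exists N, forall n, (N <= n)%nat ->
    stretch (follow (6 * lam) w n root) <= Rpower (len (follow (6 * lam) w n root)) (- (b + e)).
Proof.
  intros Hlam Hw He (K & HK & HG).
  set (y := exp (- (/ e) * ln (K + 1))).
  destruct (pow3_small y (exp_pos _)) as (N & HN).
  exists N. intros n Hn. specialize (HN n Hn). specialize (HG n).
  assert (L := branch_len_le lam w Hw n). assert (Lp := branch_len_pos lam w Hw n).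
  simpl in L, Lp. set (c := follow (6 * lam) w n root) in *.
  eapply Rle_trans; [apply HG|].
  replace (- (b + e)) with (- e + - b) by ring. rewrite Rpower_plus.
  apply Rmult_le_compat_r; [left; apply Rpower_pos|].
  apply Rle_trans with (Rpower y (- e)); [|apply Rpower_antitone_base; lra].
  unfold Rpower, y. rewrite ln_exp.
  replace (- e * (- / e * ln (K + 1))) with (ln (K + 1)) by (field; lra).
  rewrite exp_ln; lra.
Qed.

(** For [q <= 0] the cover uses cells with stretch at most [len ^ (- (beta + eps))], met at all
    large generations. For [q > 0] it uses those with stretch at least [len ^ (- (beta - eps))],
    which are only met infinitely often since beta is an upper growth rate; a cover asks no more. *)
Lemma Hmeas_level_zero lam beta q T s : 1 / 6 < lam < 5 / 6 -> 2 <= (6 * lam) * (6 * lam) ->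
  beta < 1 -> press (6 * lam) q T <= 1 -> T - beta * q < s -> 0 < s ->
  Hmeas s (fun x => 0 <= x <= 1 /\ holder_exp (F lam) x = Finite (1 - beta)) = Finite 0.
Proof.
  intros Hlam Hkk Hbeta Hp Hs Hs0.
  set (k := 6 * lam) in *.
  set (eta := (s - (T - beta * q)) / 2).
  assert (Heta : 0 < eta) by (unfold eta; lra).
  assert (Haq := Rabs_pos q).
  (* The excess of [s] over [T - beta * q] is [2 * eta]: one half makes the moments summable, the
     other pays [Rabs q * eps]. *)
  set (eps := eta / (Rabs q + 1)).
  assert (Heps : 0 < eps) by (apply Rdiv_lt_0_compat; lra).
  assert (Hqe : Rabs q * eps <= eta).
  { assert (eps * (Rabs q + 1) = eta) by (unfold eps; field; lra). lra. }
  destruct (Rle_dec q 0) as [Hq|Hq].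
  - destruct (summable_neg k ltac:(unfold k; lra) q T eta Heta Hp Hq) as (f & M & HM & Hf).
    rewrite Rabs_left1 in Hqe by easy.
    apply (Hmeas_zero_of_tree k s _
      (fun n => stretch (tree k n) <= Rpower (len (tree k n)) (- (beta + eps))) f M); try easy.
    + intros n. eapply Rle_trans; [|apply Hf]. apply Rmult_le_pos; left; apply Rpower_pos.
    + intros n HQ. eapply Rle_trans; [|apply Hf].
      apply Rle_trans with (Rpower (len (tree k n)) (- (beta + eps) * q) * Rpower (len (tree k n)) (T + eta)).
      * rewrite <- Rpower_plus. apply Rpower_antitone_exp; [apply tree_len|].
        unfold eta in *. nra.
      * apply Rmult_le_compat_r; [left; apply Rpower_pos|].
        rewrite <- Rpower_mult. apply Rpower_antitone_base; [|easy].
        split; [generalize (stretch_ge1 (tree k n)); lra|easy].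
    + intros x N (Hx & Hh).
      destruct (unit_branch k x Hx) as (w & Hw & Hin).
      destruct (holder_exp_spec_growth lam ltac:(lra) w Hw x Hin beta (eps / 2) Hbeta ltac:(lra) Hh) as (G & _).
      destruct (growth_small_constant lam w _ (eps / 2) ltac:(lra) Hw ltac:(lra) G) as (N' & HN').
      exists (tree_index w (N + N')). rewrite tree_follow by easy.
      split; [generalize (tree_index_ge w (N + N')); lia|]. split; [|apply Hin].
      specialize (HN' (N + N')%nat ltac:(lia)). fold k in HN'.
      replace (beta + eps / 2 + eps / 2) with (beta + eps) in HN' by field. exact HN'.
  - destruct (summable_pos k ltac:(unfold k; lra) q T eta Heta Hp Hkk ltac:(lra)) as (f & M & HM & Hf).
    rewrite Rabs_right in Hqe by lra.
    apply (Hmeas_zero_of_tree k s _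
      (fun n => Rpower (len (tree k n)) (- (beta - eps)) <= stretch (tree k n)) f M); try easy.
    + intros n. eapply Rle_trans; [|apply Hf]. apply Rmult_le_pos; left; apply Rpower_pos.
    + intros n HQ. eapply Rle_trans; [|apply Hf].
      apply Rle_trans with (Rpower (len (tree k n)) (- (beta - eps) * q) * Rpower (len (tree k n)) (T + eta)).
      * rewrite <- Rpower_plus. apply Rpower_antitone_exp; [apply tree_len|].
        unfold eta in *. nra.
      * apply Rmult_le_compat_r; [left; apply Rpower_pos|].
        rewrite <- Rpower_mult. apply Rpower_monotone_base; [|lra].
        split; [apply Rpower_pos|easy].
    + intros x N (Hx & Hh).
      destruct (unit_branch k x Hx) as (w & Hw & Hin).
      destruct (holder_exp_spec_growth lam ltac:(lra) w Hw x Hin beta eps Hbeta ltac:(lra) Hh) as (_ & G).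
      assert (exists n, (N <= n)%nat /\ Rpower (len (follow k w n root)) (- (beta - eps))
          <= stretch (follow k w n root)) as (n & Hn & HQ).
      (* If [beta - eps < 0] the condition holds at every generation, because the stretch is at
         least 1 and the length at most 1. *)
      { destruct (Rle_dec 0 (beta - eps)) as [H0|H0].
        - apply NNPP. intros Hno. apply (G H0).
          apply (growth_of_eventually lam ltac:(lra) w Hw _ 1 N H0 ltac:(lra)).
          intros n Hn. rewrite Rmult_1_l. apply Rnot_lt_le. intros Hlt. apply Hno.
          exists n. split; [easy|]. left. exact Hlt.
        - exists N. split; [easy|].
          eapply Rle_trans; [|apply stretch_ge1].
          assert (L := branch_len_bounds lam w Hw N). simpl in L. fold k in L.
          rewrite <- (Rpower_O (len (follow k w N root))) by easy.
          apply Rpower_antitone_exp; [easy|lra]. }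
      exists (tree_index w n). rewrite tree_follow by easy.
      split; [generalize (tree_index_ge w n); lia|]. split; [easy|apply Hin].
Qed.

Lemma level_range lam al x : 1 / 6 <= lam < 5 / 6 -> 0 <= x <= 1 ->
  holder_exp (F lam) x = Finite al -> alpha_min lam <= al <= 1.
Proof.
  intros Hlam Hx Hh. destruct (unit_branch (6 * lam) x Hx) as (w & Hw & Hin).
  exact (holder_exp_range lam Hlam w Hw x Hin al Hh).
Qed.

(** * Lower bound for the dimension *)

Lemma branch_limit_point lam w : 1 / 6 <= lam < 5 / 6 -> (forall j, (w j < 4)%nat) ->
  exists x, 0 <= x <= 1 /\ forall n, inside (follow (6 * lam) w n root) x.
Proof.
  intros Hlam Hw. set (k := 6 * lam). set (c := fun n => follow k w n root).
  assert (Hlen : forall n, 0 < len (c n)) by exact (branch_len_pos lam w Hw).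
  assert (Hstep : forall n, lft (c n) <= lft (c (S n)) /\ rgt (c (S n)) <= rgt (c n)).
  { intros n. change (c (S n)) with (child k (w n) (c n)). specialize (Hlen n).
    unfold rgt. destruct (w n) as [|[|[|i]]]; simpl; lra. }
  assert (Hr : forall n m, (n <= m)%nat -> lft (c m) <= rgt (c n)).
  { assert (A : forall n m, (n <= m)%nat -> rgt (c m) <= rgt (c n)).
    { intros n m H. induction H; [lra|]. destruct (Hstep m). lra. }
    intros n m H. specialize (A n m H). specialize (Hlen m). unfold rgt at 1 in A. lra. }
  destruct (ex_finite_lim_seq_incr (fun n => lft (c n)) 1) as (x & Hx).
  - intros n; apply Hstep.
  - intros n. specialize (Hr 0%nat n ltac:(lia)). unfold rgt in Hr. simpl in Hr. lra.
  - assert (Hin : forall n, inside (c n) x).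
    { intros n. split.
      - apply (is_lim_seq_incr_compare (fun n => lft (c n))); [easy|]. intros; apply Hstep.
      - apply (is_lim_seq_incr_n _ n) in Hx.
        refine (is_lim_seq_le _ (fun _ => rgt (c n)) _ _ _ Hx (is_lim_seq_const _)).
        intros m. apply Hr. lia. }
    exists x. split; [|exact Hin]. specialize (Hin 0%nat). unfold inside, rgt in Hin. simpl in Hin. lra.
Qed.

(* Summed over a cover, the functions g compete with the mass carried by the tree. *)
Lemma capture U s t : 0 <= s <= 1 -> 0 < t <= 1 -> Rbar_le (diamR U) (Finite 1) ->
  exists (g : R -> R) r, 0 < r <= 1 /\ (forall x y, x <= y -> g x <= g y) /\
    (forall x, 0 <= g x <= 24 * (cpow U s + t)) /\
    forall x a l, U x -> r / 6 <= l <= r -> a <= x <= a + l -> Rpower l s <= g (a + l) - g a.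
Proof.
  intros Hs Ht Hd. assert (Hc := cpow_nonneg U s).
  destruct (classic (exists x, U x)) as [(z & Hz)|Hno].
  2:{ exists (fun _ => 0), 1. split; [lra|]. split; [intros; lra|]. split; [intros; lra|].
      intros x a l Hx. exfalso. apply Hno. now exists x. }
  (* An effective radius: the diameter if it is positive. A single point receives a small radius
     paid by [t], except that for [s = 0] it already costs 1 and radius 1 is free. *)
  assert (Hr : exists r, 0 < r <= 1 /\ (forall x, U x -> Rabs (x - z) <= r) /\ Rpower r s <= cpow U s + t).
  { assert (B := diam_nonneg U z Hz).
    assert (Hub : forall x, U x -> Rbar_le (Finite (Rabs (x - z))) (diamR U)).
    { intros x Hx. destruct (Lub_Rbar_correct (fun r => exists x y, U x /\ U y /\ r = Rabs (x - y))) as [L _].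
      apply L. now exists x, z. }
    unfold cpow. destruct excluded_middle_informative as [_|Hn]; [|exfalso; apply Hn; now exists z].
    destruct (diamR U) as [d| |]; simpl in *; try easy.
    destruct (Req_dec d 0) as [->|Hd0].
    - destruct (Req_dec s 0) as [->|Hs0].
      + exists 1. split; [lra|]. split.
        * intros x Hx. specialize (Hub x Hx). lra.
        * rewrite Rpower_O by lra. unfold rpow. destruct (Req_EM_T 0 0); [lra|easy].
      + exists (Rpower t (/ s)).
        assert (0 < / s) by (apply Rinv_0_lt_compat; lra).
        split; [split; [apply Rpower_pos|]|split].
        * rewrite <- (Rpower_O t) by lra. apply Rpower_antitone_exp; lra.
        * intros x Hx. specialize (Hub x Hx). assert (P := Rpower_pos t (/ s)). lra.
        * rewrite Rpower_mult, Rinv_l, Rpower_1 by lra.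
          assert (P := rpow_nonneg 0 s). lra.
    - exists d. split; [lra|]. split; [exact Hub|].
      unfold rpow. destruct (Req_EM_T d 0); [easy|]. lra. }
  destruct Hr as (r & Hr & Hdist & Hrs).
  (* A ramp of slope 1 from [z - 2 * r] to [z + 2 * r], a range containing every interval of length
     at most [r] that meets [U]. *)
  set (h := fun y => Rmax 0 (Rmin (y - (z - 2 * r)) (4 * r))).
  assert (Hh : forall x y, x <= y -> h x <= h y).
  { intros x y H. unfold h, Rmax, Rmin. repeat destruct Rle_dec; lra. }
  assert (Hh2 : forall x, 0 <= h x <= 4 * r).
  { intros x. unfold h, Rmax, Rmin. repeat destruct Rle_dec; lra. }
  (* For [l >= r / 6] and [0 <= s <= 1], [l ^ (s - 1)] is at most [6 * r ^ (s - 1)]. The total rise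
     is then [4 * r * w = 24 * r ^ s]. *)
  set (w := 6 * Rpower r (s - 1)).
  assert (Hw : 0 < w) by (unfold w; generalize (Rpower_pos r (s - 1)); lra).
  assert (Hwr : w * r = 6 * Rpower r s).
  { unfold w. rewrite Rmult_assoc. rewrite <- (Rpower_1 r) at 2 by lra.
    rewrite <- Rpower_plus. do 2 f_equal. ring. }
  exists (fun y => w * h y), r. split; [easy|]. split; [|split].
  - intros x y H. apply Rmult_le_compat_l; [lra|auto].
  - intros x. specialize (Hh2 x). split; [nra|].
    apply Rle_trans with (w * (4 * r)); [apply Rmult_le_compat_l; lra|lra].
  - intros x a l Hx Hl Ha. specialize (Hdist x Hx). apply Rabs_le_between in Hdist.
    replace (w * h (a + l) - w * h a) with (w * l).
    2:{ rewrite <- Rmult_minus_distr_l. f_equal. unfold h, Rmax, Rmin. repeat destruct Rle_dec; lra. }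
    replace s with ((s - 1) + 1) at 1 by ring. rewrite Rpower_plus, Rpower_1 by lra.
    apply Rmult_le_compat_r; [lra|].
    apply Rle_trans with (Rpower (r * (1 / 6)) (s - 1)); [apply Rpower_antitone_base; lra|].
    rewrite <- Rpower_mult_distr by lra. unfold w. rewrite Rmult_comm.
    apply Rmult_le_compat_r; [left; apply Rpower_pos|].
    apply Rle_trans with (Rpower (1 / 6) (- (1))); [apply Rpower_antitone_exp; lra|].
    rewrite Rpower_Ropp, Rpower_1 by lra. lra.
Qed.

(** The increment of log s - beta |log l| when the letter [j] is read and the slope is multiplied
    exactly by its gain. *)
Definition drift (k beta : R) (j : nat) : R := ln (gain k j) + beta * ln (rr j).

(* A Bernoulli measure on letters, dominated by the weights [gain^q r^(D + q beta)]
   and under which the growth rate of the slope is exactly beta. *)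
Definition certificate (k beta D q : R) (p : nat -> R) : Prop :=
  (forall j, 0 <= p j <= exp (q * drift k beta j) * Rpower (rr j) D) /\
  p 0%nat + p 1%nat + p 2%nat + p 3%nat = 1 /\
  p 0%nat * drift k beta 0 + p 1%nat * drift k beta 1 + p 2%nat * drift k beta 2
    + p 3%nat * drift k beta 3 = 0.

Section Lower.
Variables lam beta D q s : R.
Variable p : nat -> R.
Hypothesis Hlam : 1 / 6 < lam < 5 / 6.
Let k := 6 * lam.
Hypothesis Hbeta : 0 <= beta < 1.
Hypothesis Hcert : certificate k beta D q p.
Hypothesis Hs : s < D.

Let a (j : nat) : R := drift k beta j.
(** Lowering the exponent from [D] to [s] frees at least a factor [1 / z] at each step, since all
    ratios are at most 1/3; it compensates for the loss at the kink of the tent. *)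
Let z : R := exp (- (D - s) * ln 3).
Let A : R := Rabs (a 0) + Rabs (a 1) + Rabs (a 2) + Rabs (a 3).
(** Wide enough that a step of size [A] starting within [A] of the centre costs at most the fraction
    [1 - z] of the tent. *)
Let B : R := A + A / (1 - z) + 1.
Let tent (x : R) : R := Rmax 0 (B - Rabs x).

Let Hz : 0 < z < 1.
Proof. split; [apply exp_pos|apply exp_shift_lt1; lra]. Qed.

Let HA : forall j, (j < 4)%nat -> Rabs (a j) <= A.
Proof.
  generalize (Rabs_pos (a 0)), (Rabs_pos (a 1)), (Rabs_pos (a 2)), (Rabs_pos (a 3)). intros.
  unfold A. destruct j as [|[|[|[|j]]]]; try lra; lia.
Qed.

Let HA0 : 0 <= A.
Proof. eapply Rle_trans; [apply Rabs_pos|apply (HA 0); lia]. Qed.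

Let HB : A <= (1 - z) * (B - A) /\ 0 < B /\ A < B.
Proof.
  assert (0 <= A / (1 - z)) by (apply Rdiv_le_0_compat; lra).
  unfold B. split; [|lra].
  replace ((1 - z) * (A + A / (1 - z) + 1 - A)) with (A + (1 - z)) by (field; lra). lra.
Qed.

Let tent_ge x : B - Rabs x <= tent x.
Proof. apply Rmax_r. Qed.

Let tent_nonneg x : 0 <= tent x.
Proof. apply Rmax_l. Qed.

(* The drifts have mean zero, so only the kink of the tent at 0 costs something. *)
Lemma tent_sum x : z * tent x <= p 0%nat * tent (x + a 0) + p 1%nat * tent (x + a 1)
   + p 2%nat * tent (x + a 2) + p 3%nat * tent (x + a 3).
Proof.
  destruct Hcert as (Hp & Hsum & Hmean). fold (a 0) (a 1) (a 2) (a 3) in Hmean.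
  assert (P0 := proj1 (Hp 0%nat)). assert (P1 := proj1 (Hp 1%nat)).
  assert (P2 := proj1 (Hp 2%nat)). assert (P3 := proj1 (Hp 3%nat)).
  destruct HB as (HB1 & HB2 & HB3).
  (* As [p] sums to 1 and the drifts have mean zero, an affine minorant of the tent in the drift
     contributes just its constant term. *)
  assert (comb : forall u v, (forall j, (j < 4)%nat -> u + v * a j <= tent (x + a j)) ->
    u <= p 0%nat * tent (x + a 0) + p 1%nat * tent (x + a 1)
       + p 2%nat * tent (x + a 2) + p 3%nat * tent (x + a 3)).
  { intros u v H.
    assert (H0 := H 0%nat ltac:(lia)). assert (H1 := H 1%nat ltac:(lia)).
    assert (H2 := H 2%nat ltac:(lia)). assert (H3 := H 3%nat ltac:(lia)).
    apply (Rmult_le_compat_l _ _ _ P0) in H0. apply (Rmult_le_compat_l _ _ _ P1) in H1.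
    apply (Rmult_le_compat_l _ _ _ P2) in H2. apply (Rmult_le_compat_l _ _ _ P3) in H3.
    replace u with (u * (p 0%nat + p 1%nat + p 2%nat + p 3%nat) + v *
     (p 0%nat * a 0%nat + p 1%nat * a 1%nat + p 2%nat * a 2%nat + p 3%nat * a 3%nat))
      by (rewrite Hsum, Hmean; ring).
    lra. }
  destruct (Rle_dec B (Rabs x)) as [HxB|HxB].
  - replace (z * tent x) with 0.
    + apply (comb 0 0). intros. rewrite Rmult_0_l, Rplus_0_r. apply tent_nonneg.
    + unfold tent. rewrite Rmax_left by lra. ring.
  - assert (E : tent x = B - Rabs x) by (unfold tent; rewrite Rmax_right; lra).
    rewrite E.
    (* At distance at least [A] from 0 no step crosses the kink, and one side of the tent is an
       affine minorant. Closer to 0 the constant [B - Rabs x - A] is used, which is at least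
       [z * (B - Rabs x)] by the choice of [B]. *)
    destruct (Rle_dec A (Rabs x)) as [HxA|HxA].
    + apply Rle_trans with (B - Rabs x); [nra|].
      destruct (Rle_dec 0 x) as [Hx|Hx].
      * rewrite (Rabs_right x) in * by lra.
        apply (comb _ (-1)). intros j Hj. eapply Rle_trans; [|apply tent_ge].
        assert (Hj' := HA j Hj). apply Rabs_le_between in Hj'. rewrite Rabs_right; lra.
      * rewrite (Rabs_left x) in * by lra.
        apply (comb _ 1). intros j Hj. eapply Rle_trans; [|apply tent_ge].
        assert (Hj' := HA j Hj). apply Rabs_le_between in Hj'. rewrite Rabs_left1; lra.
    + assert (0 <= Rabs x) by apply Rabs_pos.
      apply Rle_trans with (B - Rabs x - A); [nra|].
      apply (comb _ 0). intros j Hj. eapply Rle_trans; [|apply tent_ge].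
      assert (Hj' := HA j Hj). assert (T := Rabs_triang x (a j)). lra.
Qed.

(** A cell with the state of the walk that leads to it: [ndrift] is its position and [nweight] the
    product of the [p j / z]. The division by [z] makes up for the factor in [tent_sum]. *)
Record node := Node { ncell : cell; ndrift : R; nweight : R }.

Definition start : node := Node root 0 1.
Definition step (i : nat) (nd : node) : node :=
  let j := letter (slp (ncell nd)) i in
  Node (child k i (ncell nd)) (ndrift nd + a j) (nweight nd * (p j / z)).
Definition mass (nd : node) : R := nweight nd * tent (ndrift nd).

Lemma mass_step nd : 0 <= nweight nd ->
  mass nd <= mass (step 0 nd) + mass (step 1 nd) + mass (step 2 nd) + mass (step 3 nd).
Proof.
  intros Hn. unfold mass, step. cbn [nweight ndrift].
  set (m := slp (ncell nd)). set (x := ndrift nd). set (W := nweight nd) in *.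
  assert (T := tent_sum x).
  assert (E := letter_sum m (fun j => p j * tent (x + a j))). cbv beta in E.
  rewrite <- E in T.
  apply (Rmult_le_compat_l (W / z)) in T; [|apply Rdiv_le_0_compat; lra].
  replace (W / z * (z * tent x)) with (W * tent x) in T by (field; lra).
  unfold Rdiv in *. lra.
Qed.

Section Selection.
Variable mu : cell -> R.
Hypothesis Hmu : forall c, 0 < len c ->
  0 <= mu c /\ mu (child k 0 c) + mu (child k 1 c) + mu (child k 2 c) + mu (child k 3 c) <= mu c.

Let good (nd : node) : Prop := 0 < len (ncell nd) /\ 0 <= nweight nd /\ mu (ncell nd) < mass nd.

(** From a cell to its children the total of [mu] does not increase and that of [mass] does not
    decrease, so [mu < mass] survives on some child. *)
Lemma good_step nd : good nd -> exists i, (i < 4)%nat /\ good (step i nd).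
Proof.
  intros (Hl & Hn & Hm). destruct (Hmu _ Hl) as [_ Hsum].
  assert (M := mass_step nd Hn).
  assert (G : forall i, 0 < len (ncell (step i nd)) /\ 0 <= nweight (step i nd)).
  { intros i. unfold step; cbn [ncell nweight]. rewrite child_len.
    destruct Hcert as (Hp & _).
    split; [generalize (rr_bounds i); nra|].
    apply Rmult_le_pos; [easy|]. apply Rdiv_le_0_compat; [apply Hp|lra]. }
  apply NNPP. intros Hno.
  assert (N : forall i, (i < 4)%nat -> mass (step i nd) <= mu (child k i (ncell nd))).
  { intros i Hi. apply Rnot_lt_le. intros Hlt. apply Hno. exists i. split; [easy|].
    destruct (G i). repeat split; easy. }
  generalize (N 0%nat ltac:(lia)), (N 1%nat ltac:(lia)), (N 2%nat ltac:(lia)), (N 3%nat ltac:(lia)). lra.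
Qed.

Let pick (nd : node) : nat := epsilon (inhabits 0%nat) (fun i => (i < 4)%nat /\ (good nd -> good (step i nd))).

Fixpoint track (n : nat) : node :=
  match n with O => start | S n => step (pick (track n)) (track n) end.

Lemma pick_spec nd : (pick nd < 4)%nat /\ (good nd -> good (step (pick nd) nd)).
Proof.
  unfold pick. apply epsilon_spec. destruct (classic (good nd)) as [G|G].
  - destruct (good_step nd G) as (i & Hi & H). exists i. now split.
  - exists 0%nat. split; [lia|tauto].
Qed.

Hypothesis Hroot : mu root < B.

Lemma track_good n : good (track n).
Proof.
  induction n; [|now apply pick_spec].
  unfold good, mass, tent. simpl. rewrite Rabs_R0, Rminus_0_r, Rmax_right by lra.
  split; [lra|]. split; lra.
Qed.

Lemma track_drift n : Rabs (ndrift (track n)) < B.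
Proof.
  destruct (track_good n) as (Hl & Hn & Hm). destruct (Hmu _ Hl) as [H0 _].
  apply Rnot_le_lt. intros H. unfold mass, tent in Hm. rewrite Rmax_left in Hm by lra. lra.
Qed.

Let w (n : nat) : nat := pick (track n).

Lemma track_cell n : ncell (track n) = follow k w n root.
Proof. induction n; [reflexivity|]. simpl. unfold step; cbn [ncell]. now rewrite IHn. Qed.

Let Hw : forall j, (w j < 4)%nat.
Proof. intros j. apply pick_spec. Qed.

Lemma gain_ratio j x l : 1 < k -> 0 < l ->
  exp (x + a j) * Rpower (rr j * l) (- beta) = gain k j * (exp x * Rpower l (- beta)).
Proof.
  intros Hk Hl. assert (Hr := rr_bounds j).
  rewrite <- Rpower_mult_distr by lra. unfold a, drift. rewrite !exp_plus, exp_ln by now apply gain_pos.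
  assert (E : exp (beta * ln (rr j)) * Rpower (rr j) (- beta) = 1).
  { unfold Rpower. rewrite <- exp_plus, <- exp_0. f_equal. ring. }
  transitivity (exp x * gain k j * Rpower l (- beta) * (exp (beta * ln (rr j)) * Rpower (rr j) (- beta))); [ring|].
  rewrite E. ring.
Qed.

(** [u] is the product of the gains met so far. The lower bound is the error-free one for
    [floored_slope]; each additive error in the upper bound is at most [2 * exp B * u], whence the
    linear factor. *)
Lemma track_slope n : let c := ncell (track n) in let u := exp (ndrift (track n)) * Rpower (len c) (- beta) in
  1 / 2 * u <= floored_slope c /\ stretch c <= (1 + 2 * exp B * INR n) * u.
Proof.
  assert (Hk : 1 < k) by (unfold k; lra).
  induction n as [|n IH].
  - unfold floored_slope, stretch. simpl. replace (1 + 0 * (0 * 1)) with 1 by ring.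
    rewrite sqrt_1, exp_0. unfold Rpower. rewrite ln_1, Rmult_0_r, exp_0.
    split; [rewrite Rabs_R0; eapply Rle_trans; [|apply Rmax_r]; lra|lra].
  - cbv zeta in *. destruct IH as (IH1 & IH2).
    assert (Hd := track_drift (S n)). destruct (track_good (S n)) as (HlS & _).
    change (track (S n)) with (step (w n) (track n)) in *.
    set (nd := track n) in *. unfold step in *. cbn [ncell ndrift] in *.
    set (c := ncell nd) in *. set (j := letter (slp c) (w n)) in *.
    assert (Hl : 0 < len c) by apply (track_good n).
    rewrite child_len in *. rewrite <- (rr_letter (slp c) (w n)) in *. fold j in HlS |- *.
    assert (HR := gain_ratio j (ndrift nd) (len c) Hk Hl).
    set (u' := exp (ndrift nd + a j) * Rpower (rr j * len c) (- beta)) in *.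
    set (u := exp (ndrift nd) * Rpower (len c) (- beta)) in *.
    assert (Gp := gain_pos k j Hk).
    assert (F1 := floored_slope_child k (w n) c Hk (Hw n)). fold j in F1.
    assert (F2 := stretch_child_gain k (w n) c Hk (Hw n)). fold j in F2.
    split.
    + rewrite HR. nra.
    (* The error 2 is compared with [u']: the drift exceeds [- B], and [0 <= beta] makes the
       negative power of the length at least 1. *)
    + assert (Hu1 : 1 <= exp B * u').
      { unfold u'. rewrite <- Rmult_assoc, <- exp_plus.
        assert (1 <= exp (B + (ndrift nd + a j))).
        { apply Rle_trans with (exp 0); [rewrite exp_0; lra|].
          apply exp_le. apply Rabs_def2 in Hd. lra. }
        assert (1 <= Rpower (rr j * len c) (- beta)); [|nra].
        apply Rpower_ge1; [|lra]. split; [easy|].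
        assert (L := branch_len_bounds lam w Hw n). cbv zeta beta in L. fold k in L.
        rewrite <- track_cell in L. fold nd c in L. generalize (rr_bounds j). nra. }
      rewrite S_INR.
      assert (F3 : gain k j * stretch c <= (1 + 2 * exp B * INR n) * u').
      { rewrite HR. apply (Rmult_le_compat_l (gain k j)) in IH2; lra. }
      lra.
Qed.

Lemma track_exponent x : (forall n, inside (ncell (track n)) x) ->
  holder_exp (F lam) x = Finite (1 - beta).
Proof.
  intros Hx.
  assert (Hx' : forall n, inside (follow k w n root) x) by (intros n; rewrite <- track_cell; auto).
  apply (holder_exp_of_growth lam ltac:(lra) w Hw x Hx' beta (1 / 2 * exp (- B)) Hbeta).
  - generalize (exp_pos (- B)). lra.
  - intros eps He.
    assert (L3 := ln3_pos). assert (EB := exp_pos B).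
    exists (exp B * (1 + 2 * exp B / (eps * ln 3))).
    assert (X : 0 < 2 * exp B / (eps * ln 3)) by (apply Rdiv_lt_0_compat; nra).
    split; [nra|].
    intros n. fold k. rewrite <- track_cell.
    destruct (track_slope n) as [_ T]. cbv zeta in T.
    assert (Hd := track_drift n). apply Rabs_def2 in Hd.
    assert (Lb := branch_len_bounds lam w Hw n). assert (Ll := branch_len_le lam w Hw n).
    cbv zeta beta in Lb, Ll. fold k in Lb, Ll. rewrite <- track_cell in Lb, Ll.
    set (l := len (ncell (track n))) in *.
    replace (- (beta + eps)) with (- beta + - eps) by ring. rewrite Rpower_plus.
    set (lb := Rpower l (- beta)) in *. assert (Hlb : 0 < lb) by apply Rpower_pos.
    assert (Hn := pos_INR n).
    (* Lengths are at most [3 ^ (- n)], so even a small negative power of them outgrows the linear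
       factor of [track_slope]. *)
    assert (H1 : 1 + INR n * (eps * ln 3) <= Rpower l (- eps)).
    { apply Rle_trans with (exp (INR n * (eps * ln 3))); [apply exp_ineq1_le|].
      apply exp_le.
      assert (ln l <= - INR n * ln 3).
      { apply Rle_trans with (ln ((1 / 3) ^ n)).
        - destruct (Req_dec l ((1 / 3) ^ n)) as [->|]; [lra|].
          left; apply ln_increasing; lra.
        - rewrite ln_pow, ln_third by lra. lra. }
      nra. }
    assert (H2 : 1 + 2 * exp B * INR n <= (1 + 2 * exp B / (eps * ln 3)) * (1 + INR n * (eps * ln 3))).
    { set (y := 2 * exp B / (eps * ln 3)) in *.
      assert (2 * exp B * INR n = y * (INR n * (eps * ln 3))) by (unfold y; field; lra).
      assert (0 <= INR n * (eps * ln 3)) by (apply Rmult_le_pos; nra). lra. }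
    assert (H3 : exp (ndrift (track n)) * lb <= exp B * lb)
      by (apply Rmult_le_compat_r; [lra|apply exp_le; lra]).
    assert (0 <= 2 * exp B * INR n) by nra.
    eapply Rle_trans; [apply T|].
    apply Rle_trans with ((1 + 2 * exp B * INR n) * (exp B * lb)); [apply Rmult_le_compat_l; lra|].
    assert (H4 : 1 + 2 * exp B * INR n <= (1 + 2 * exp B / (eps * ln 3)) * Rpower l (- eps)).
    { eapply Rle_trans; [apply H2|]. apply Rmult_le_compat_l; lra. }
    apply (Rmult_le_compat_r (exp B * lb)) in H4; [lra|nra].
  - intros n. fold k. rewrite <- track_cell.
    destruct (track_slope n) as [T _]. cbv zeta in T.
    assert (Hd := track_drift n). apply Rabs_def2 in Hd.
    eapply Rle_trans; [|apply floored_slope_le_stretch].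
    eapply Rle_trans; [|apply T].
    assert (P := Rpower_pos (len (ncell (track n))) (- beta)).
    assert (exp (- B) <= exp (ndrift (track n))) by (apply exp_le; lra). nra.
Qed.

(** The domination in [certificate] bounds the product of the [p j] by [exp (q * drift) * len ^ D],
    and the divisions by [z] are paid by passing from [D] to [s]. *)
Lemma track_weight n : nweight (track n) <= exp (q * ndrift (track n)) * Rpower (len (ncell (track n))) s.
Proof.
  assert (Hk : 1 < k) by (unfold k; lra).
  induction n as [|n IH].
  - simpl. unfold Rpower. rewrite ln_1, !Rmult_0_r, exp_0. lra.
  - destruct (track_good n) as (Hl & Hn & _).
    change (track (S n)) with (step (w n) (track n)) in *.
    set (nd := track n) in *. unfold step in *. cbn [ncell ndrift nweight] in *.
    set (c := ncell nd) in *. rewrite child_len. set (j := letter (slp c) (w n)) in *.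
    rewrite <- (rr_letter (slp c) (w n)). fold j.
    assert (Hr := rr_bounds j).
    rewrite <- Rpower_mult_distr by lra.
    rewrite Rmult_plus_distr_l, exp_plus.
    destruct Hcert as (Hp & _). destruct (Hp j) as (Hp0 & Hp1). fold (a j) in Hp1.
    assert (Hpz : p j / z <= exp (q * a j) * Rpower (rr j) s).
    { apply Rle_div_l; [lra|]. eapply Rle_trans; [apply Hp1|]. rewrite Rmult_assoc.
      apply Rmult_le_compat_l; [left; apply exp_pos|].
      replace D with (s + (D - s)) at 1 by ring. rewrite Rpower_plus.
      apply Rmult_le_compat_l; [left; apply Rpower_pos|].
      unfold z, Rpower. apply exp_le.
      assert (ln (rr j) <= - ln 3).
      { rewrite <- ln_third. destruct (Req_dec (rr j) (1 / 3)) as [->|]; [lra|].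
        left; apply ln_increasing; lra. }
      nra. }
    apply Rle_trans with ((exp (q * ndrift nd) * Rpower (len c) s) * (exp (q * a j) * Rpower (rr j) s));
      [|right; ring].
    apply Rmult_le_compat; try easy. apply Rdiv_le_0_compat; lra.
Qed.

Lemma track_mass n : mass (track n) <= B * exp (Rabs q * B) * Rpower (len (ncell (track n))) s.
Proof.
  assert (W := track_weight n). destruct (track_good n) as (_ & Hn & _).
  assert (Hd := track_drift n).
  assert (T : tent (ndrift (track n)) <= B).
  { unfold tent. apply Rmax_lub; [lra|]. generalize (Rabs_pos (ndrift (track n))). lra. }
  assert (E : exp (q * ndrift (track n)) <= exp (Rabs q * B)).
  { apply exp_le. eapply Rle_trans; [apply Rle_abs|]. rewrite Rabs_mult.
    apply Rmult_le_compat_l; [apply Rabs_pos|lra]. }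
  unfold mass. rewrite (Rmult_comm B), Rmult_assoc, (Rmult_comm B), <- Rmult_assoc.
  apply Rmult_le_compat; try easy.
  eapply Rle_trans; [apply W|]. apply Rmult_le_compat_r; [left; apply Rpower_pos|easy].
Qed.

(** This takes the place of a mass distribution principle: instead of one measure on the level set,
    a branch is built against each competitor [mu]. *)
Lemma selection : exists x w, 0 <= x <= 1 /\ holder_exp (F lam) x = Finite (1 - beta) /\
  (forall j, (w j < 4)%nat) /\
  forall n, inside (follow k w n root) x /\
   mu (follow k w n root) < B * exp (Rabs q * B) * Rpower (len (follow k w n root)) s.
Proof.
  destruct (branch_limit_point lam w ltac:(lra) Hw) as (x & Hx & Hin). fold k in Hin.
  exists x, w. split; [easy|]. split; [|split; [apply Hw|]].
  - apply track_exponent. intros n. now rewrite track_cell.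
  - intros n. split; [easy|]. rewrite <- track_cell.
    destruct (track_good n) as (_ & _ & G). eapply Rlt_le_trans; [apply G|apply track_mass].
Qed.

End Selection.

Lemma level_nonempty : exists x, 0 <= x <= 1 /\ holder_exp (F lam) x = Finite (1 - beta).
Proof.
  destruct (selection (fun _ => 0)) as (x & w & Hx & Hh & _).
  - intros; lra.
  - lra.
  - now exists x.
Qed.

(** Too cheap a cover yields a competitor that is beaten along a whole branch; but the set
    containing the limit point of the branch makes the competitor large at the generation of
    matching size. *)
Lemma cover_lower_bound (U : nat -> R -> Prop) v : 0 <= s <= 1 ->
  (forall i, Rbar_le (diamR (U i)) (Finite 1)) ->
  (forall x, 0 <= x <= 1 /\ holder_exp (F lam) x = Finite (1 - beta) -> exists i, U i x) ->
  Lim_seq (sum_n (fun i => cpow (U i) s)) = Finite v -> exp (- (Rabs q * B)) / 24 <= v.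
Proof.
  intros Hs01 Hd Hcov Hv. apply Rnot_lt_le. intros Hlt.
  (* 24 is the constant of [capture] and the exponential is the loss in [track_mass]; with them the
     competitor starts below the mass [B] of the root. *)
  set (c1 := exp (- (Rabs q * B)) / 24) in *.
  assert (Hv0 := Lim_sum_nonneg _ _ (fun i => cpow_nonneg (U i) s) Hv).
  assert (Hex : is_lim_seq (sum_n (fun i => cpow (U i) s)) (Finite v)).
  { rewrite <- Hv. apply Lim_seq_correct. apply ex_lim_seq_incr. intros n.
    rewrite sum_Sn. change plus with Rplus. generalize (cpow_nonneg (U (S n)) s). lra. }
  assert (Hsv : forall n, sum_n (fun i => cpow (U i) s) n <= v).
  { apply is_lim_seq_incr_compare; [easy|]. intros n.
    rewrite sum_Sn. change plus with Rplus. generalize (cpow_nonneg (U (S n)) s). lra. }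
  set (eta := Rmin 1 ((c1 - v) / 4)).
  assert (Heta : 0 < eta <= 1) by (unfold eta; split; [apply Rmin_pos; lra|apply Rmin_l]).
  assert (Heta2 : eta <= (c1 - v) / 4) by apply Rmin_r.
  (* The enlargements cost at most [2 * eta] in total, half of the gap [c1 - v]. *)
  set (t := fun i => eta * (1 / 2) ^ i).
  assert (Ht : forall i, 0 < t i <= 1).
  { intros i. unfold t.
    assert (0 < (1 / 2) ^ i) by (apply pow_lt; lra).
    assert ((1 / 2) ^ i <= 1) by (apply Rle_trans with (1 ^ i); [apply pow_incr; lra|rewrite pow1; lra]).
    nra. }
  assert (Hst : forall n, sum_n t n <= 2 * eta).
  { intros n. assert (E : sum_n t n = eta * (2 - (1 / 2) ^ n)).
    { induction n; [rewrite sum_O; unfold t; simpl; ring|].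
      rewrite sum_Sn, IHn. unfold plus, t; simpl. field. }
    rewrite E. assert (0 < (1 / 2) ^ n) by (apply pow_lt; lra). nra. }
  assert (Hcap : forall i, exists gr : (R -> R) * R, 0 < snd gr <= 1 /\
    (forall x y, x <= y -> fst gr x <= fst gr y) /\
    (forall x, 0 <= fst gr x <= 24 * (cpow (U i) s + t i)) /\
    forall x y l, U i x -> snd gr / 6 <= l <= snd gr -> y <= x <= y + l ->
      Rpower l s <= fst gr (y + l) - fst gr y).
  { intros i. destruct (capture (U i) s (t i) Hs01 (Ht i) (Hd i)) as (g & r & H).
    now exists (g, r). }
  set (gr := fun i => proj1_sig (constructive_indefinite_description _ (Hcap i))).
  assert (Hgr := fun i => proj2_sig (constructive_indefinite_description _ (Hcap i))).
  change (forall i, 0 < snd (gr i) <= 1 /\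
    (forall x y, x <= y -> fst (gr i) x <= fst (gr i) y) /\
    (forall x, 0 <= fst (gr i) x <= 24 * (cpow (U i) s + t i)) /\
    forall x y l, U i x -> snd (gr i) / 6 <= l <= snd (gr i) -> y <= x <= y + l ->
      Rpower l s <= fst (gr i) (y + l) - fst (gr i) y) in Hgr.
  assert (Hbound : forall x n, sum_n (fun i => fst (gr i) x) n <= 24 * (v + 2 * eta)).
  { intros x n. apply Rle_trans with (24 * (sum_n (fun i => cpow (U i) s) n + sum_n t n)).
    - induction n.
      + rewrite !sum_O. apply Hgr.
      + rewrite !sum_Sn. change plus with Rplus.
        destruct (Hgr (S n)) as (_ & _ & H & _). specialize (H x). lra.
    - specialize (Hsv n). specialize (Hst n). lra. }
  set (N := fun x => real (Lim_seq (sum_n (fun i => fst (gr i) x)))).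
  assert (HN : forall x, is_lim_seq (sum_n (fun i => fst (gr i) x)) (Finite (N x)) /\
     0 <= N x <= 24 * (v + 2 * eta)).
  { intros x. destruct (bounded_sum_lim (fun i => fst (gr i) x) (24 * (v + 2 * eta)))
      as (y & Hy & Hyb); [intros i; apply Hgr|apply Hbound|].
    unfold N. rewrite (is_lim_seq_unique _ _ Hy). simpl. now split. }
  assert (HNi : forall i x y, x <= y -> fst (gr i) y - fst (gr i) x <= N y - N x).
  { intros i x y Hxy. destruct (HN x) as [Lx _]. destruct (HN y) as [Ly _].
    assert (L := is_lim_seq_minus' _ _ _ _ Ly Lx).
    apply (is_lim_seq_incr_n _ i) in L.
    refine (is_lim_seq_le (fun _ => fst (gr i) y - fst (gr i) x) _ _ _ _ (is_lim_seq_const _) L).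
    assert (M : forall n, 0 <= sum_n (fun i => fst (gr i) y) n - sum_n (fun i => fst (gr i) x) n).
    { intros n. enough (sum_n (fun i => fst (gr i) x) n <= sum_n (fun i => fst (gr i) y) n) by lra.
      apply sum_n_le. intros j. now apply Hgr. }
    intros n. induction n.
    - simpl. destruct i.
      + rewrite !sum_O. lra.
      + rewrite !sum_Sn. change plus with Rplus. specialize (M i). lra.
    - simpl. rewrite !sum_Sn. change plus with Rplus.
      destruct (Hgr (S (n + i))) as (_ & H & _). specialize (H x y Hxy). lra. }
  set (C := B * exp (Rabs q * B)).
  assert (HC : 0 < C) by (apply Rmult_lt_0_compat; [lra|apply exp_pos]).
  assert (HNmono : forall x y, x <= y -> 0 <= N y - N x).
  { intros x y Hxy. eapply Rle_trans; [|apply (HNi 0%nat x y Hxy)].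
    destruct (Hgr 0%nat) as (_ & H & _). specialize (H x y Hxy). lra. }
  (* Increments of [N] telescope over the four children, so this competitor is additive. *)
  destruct (selection (fun c => C * (N (rgt c) - N (lft c)))) as (x & w & Hx & Hh & Hw & Hsel).
  - intros c Hl. split.
    + apply Rmult_le_pos; [lra|]. apply HNmono. unfold rgt; lra.
    + unfold rgt; simpl.
      replace (lft c + len c / 3 + len c / 6) with (lft c + len c / 2) by field.
      replace (lft c + len c / 2 + len c / 6) with (lft c + 2 * len c / 3) by field.
      replace (lft c + 2 * len c / 3 + len c / 3) with (lft c + len c) by field.
      right; ring.
  - unfold rgt; simpl.
    destruct (HN (0 + 1)) as [_ H1]. destruct (HN 0) as [_ H2].
    apply Rle_lt_trans with (C * (24 * (v + 2 * eta))); [apply Rmult_le_compat_l; lra|].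
    apply Rlt_le_trans with (C * (24 * c1)); [apply Rmult_lt_compat_l; lra|].
    unfold C, c1.
    replace (B * exp (Rabs q * B) * (24 * (exp (- (Rabs q * B)) / 24)))
      with (B * (exp (Rabs q * B) * exp (- (Rabs q * B)))) by field.
    rewrite <- exp_plus, Rplus_opp_r, exp_0. lra.
  - destruct (Hcov x (conj Hx Hh)) as (i & Hi).
    destruct (Hgr i) as (Hr & _ & _ & Hc). set (r := snd (gr i)) in *.
    (* Lengths start at 1 and shrink by at most a factor 6, so the first one not above [r] is at
       least [r / 6]. *)
    assert (Hn : exists n, r / 6 <= len (follow k w n root) <= r).
    { destruct (pow3_small r ltac:(lra)) as (n0 & Hn0). specialize (Hn0 n0 (le_n _)).
      assert (L0 := branch_len_le lam w Hw n0). cbv zeta beta in L0. fold k in L0.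
      assert (Hle : len (follow k w n0 root) <= r) by lra. clear L0 Hn0.
      induction n0 as [|n IH].
      - simpl in Hle. exists 0%nat. simpl. lra.
      - destruct (Rle_dec (len (follow k w n root)) r) as [H|H]; [auto|].
        exists (S n). split; [|easy]. simpl. rewrite child_len.
        generalize (rr_bounds (w n)). nra. }
    destruct Hn as (n & Hn). destruct (Hsel n) as (Hin & Hlt').
    set (c := follow k w n root) in *.
    specialize (Hc x (lft c) (len c) Hi Hn Hin). change (lft c + len c) with (rgt c) in Hc.
    specialize (HNi i (lft c) (rgt c) ltac:(unfold rgt; lra)).
    fold C in Hlt'. apply Rmult_lt_reg_l in Hlt'; lra.
Qed.

Lemma Hmeas_level_nonzero : 0 <= s <= 1 ->
  Hmeas s (fun x => 0 <= x <= 1 /\ holder_exp (F lam) x = Finite (1 - beta)) <> Finite 0.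
Proof.
  intros Hs01 E0.
  set (E := fun x => 0 <= x <= 1 /\ holder_exp (F lam) x = Finite (1 - beta)) in *.
  assert (H : Rbar_le (Finite (exp (- (Rabs q * B)) / 24)) (Hdelta s 1 E)).
  { destruct (Glb_Rbar_correct (fun v => exists U : nat -> R -> Prop,
      (forall i, Rbar_le (diamR (U i)) (Finite 1)) /\ (forall x, E x -> exists i, U i x) /\
      Lim_seq (sum_n (fun i => cpow (U i) s)) = Finite v)) as [_ G].
    apply G. intros v (U & H1 & H2 & H3). exact (cover_lower_bound U v Hs01 H1 H2 H3). }
  assert (H' : Rbar_le (Hdelta s 1 E) (Hmeas s E)).
  { unfold Hmeas.
    set (X := fun v => exists delta, 0 < delta /\ v = Hdelta s delta E).
    assert (L := proj1 (proj2_sig (Rbar_ex_lub X))). apply L.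
    exists 1. split; [lra|easy]. }
  rewrite E0 in H'. assert (H2 := Rbar_le_trans _ _ _ H H'). simpl in H2.
  generalize (exp_pos (- (Rabs q * B))). lra.
Qed.

End Lower.

(** * The variational formula *)

(* D is the infimum over q of T - beta q, where press k q T = 1. *)
Definition value (k beta D : R) : Prop :=
  (forall q, 1 <= press k q (D + q * beta)) /\
  (forall eps, 0 < eps -> exists q, press k q (D + eps + q * beta) <= 1).

Lemma press_lt k q T T' : T < T' -> press k q T' < press k q T.
Proof.
  intros H. assert (A := press_shift_le k q T (T' - T) ltac:(lra)).
  replace (T + (T' - T)) with T' in A by ring.
  assert (B := exp_shift_lt1 (T' - T) ltac:(lra)). assert (C := press_pos k q T). nra.
Qed.

Lemma press_le k q T T' : T <= T' -> press k q T' <= press k q T.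
Proof. intros [H | ->]; [left; now apply press_lt|lra]. Qed.

Lemma value_unique k beta D1 D2 : value k beta D1 -> value k beta D2 -> D1 = D2.
Proof.
  assert (H : forall D1 D2, value k beta D1 -> value k beta D2 -> D2 <= D1).
  { clear. intros D1 D2 (_ & H1) (H2 & _). apply Rnot_lt_le. intros Hlt.
    destruct (H1 ((D2 - D1) / 2) ltac:(lra)) as (q & Hq). specialize (H2 q).
    assert (A := press_lt k q (D1 + (D2 - D1) / 2 + q * beta) (D2 + q * beta) ltac:(lra)). lra. }
  intros H1 H2. apply Rle_antisym; auto.
Qed.

Lemma value_le1 k beta D : value k beta D -> D <= 1.
Proof.
  intros (H & _). specialize (H 0). rewrite Rmult_0_l, Rplus_0_r in H.
  apply Rnot_lt_le. intros Hlt. assert (A := press_lt k 0 1 D Hlt). rewrite press_0_1 in A. lra.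
Qed.

(** For [D < 0] one letter alone contributes more than 1: letter 1 if [q >= 0], by the upper bound
    on beta, and letter 0 if [q < 0], by [0 <= beta]. *)
Lemma press_gt1_of_neg k beta q D : 1 < k -> 0 <= beta <= ln (k + 1) / ln 6 -> D < 0 ->
  1 < press k q (D + q * beta).
Proof.
  intros Hk Hb HD. assert (L3 := ln3_pos). assert (L6 := ln6_gt).
  assert (Hb6 : beta * ln 6 <= ln (k + 1)) by (apply Rle_div_r; lra).
  unfold press.
  assert (A := exp_pos (- (D + q * beta) * ln 3)).
  assert (B := exp_pos (q * ln (k + 1) - (D + q * beta) * ln 6)).
  assert (C := exp_pos (q * ln (k - 1) - (D + q * beta) * ln 6)).
  destruct (Rle_dec 0 q) as [Hq|Hq].
  - assert (1 < exp (q * ln (k + 1) - (D + q * beta) * ln 6)); [|lra].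
    apply Rle_lt_trans with (exp 0); [rewrite exp_0; lra|]. apply exp_increasing. nra.
  - assert (1 < exp (- (D + q * beta) * ln 3)); [|lra].
    apply Rle_lt_trans with (exp 0); [rewrite exp_0; lra|]. apply exp_increasing.
    assert (q * beta <= 0) by nra. nra.
Qed.

Lemma value_nonneg k beta D : 1 < k -> 0 <= beta <= ln (k + 1) / ln 6 -> value k beta D -> 0 <= D.
Proof.
  intros Hk Hb (_ & H). apply Rnot_lt_le. intros Hlt.
  destruct (H (- D / 2) ltac:(lra)) as (q & Hq).
  assert (A := press_gt1_of_neg k beta q (D + - D / 2) Hk Hb ltac:(lra)). lra.
Qed.

Lemma value_exists k beta : 1 < k -> 0 <= beta <= ln (k + 1) / ln 6 -> exists D, value k beta D.
Proof.
  intros Hk Hb.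
  set (X := fun D => exists q, press k q (D + q * beta) <= 1).
  assert (X1 : X 1) by (exists 0; rewrite Rmult_0_l, Rplus_0_r, press_0_1; lra).
  assert (X0 : forall D, X D -> 0 <= D).
  { intros D (q & Hq). apply Rnot_lt_le. intros Hlt.
    assert (A := press_gt1_of_neg k beta q D Hk Hb Hlt). lra. }
  destruct (Glb_Rbar_correct X) as [G1 G2].
  destruct (Glb_Rbar X) as [D| |].
  2:{ now specialize (G1 1 X1). }
  2:{ exfalso. specialize (G2 (Finite 0)). apply G2. intros y Hy. simpl. auto. }
  exists D. split.
  - intros q. apply Rnot_lt_le. intros Hlt.
    assert (P := press_pos k q (D + q * beta)). set (P0 := press k q (D + q * beta)) in *.
    assert (L6 : 0 < ln 6) by (generalize ln3_pos, ln6_gt; lra).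
    (* Lowering [D] by [e] multiplies [press] by at most [6 ^ e = / P0], so it stays at most 1 and
       contradicts the infimum. *)
    set (e := - ln P0 / ln 6).
    assert (Hln : ln P0 < 0) by (rewrite <- ln_1; apply ln_increasing; lra).
    assert (He : 0 < e) by (apply Rdiv_lt_0_compat; lra).
    assert (A := press_shift_ge k q (D - e + q * beta) e ltac:(lra)).
    replace (D - e + q * beta + e) with (D + q * beta) in A by ring. fold P0 in A.
    assert (E : exp (- e * ln 6) = P0).
    { replace (- e * ln 6) with (ln P0) by (unfold e; field; lra). now apply exp_ln. }
    rewrite E in A.
    assert (HX : X (D - e)) by (exists q; nra).
    specialize (G1 _ HX). simpl in G1. lra.
  - intros eps He. apply NNPP. intros Hno.
    assert (Hlb : is_lb_Rbar X (Finite (D + eps))).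
    { intros y (q & Hq). simpl. apply Rnot_lt_le. intros Hlt. apply Hno. exists q.
      eapply Rle_trans; [|apply Hq]. apply press_le. lra. }
    specialize (G2 _ Hlb). simpl in G2. lra.
Qed.

Definition weight (k beta q D : R) (j : nat) : R := exp (q * drift k beta j) * Rpower (rr j) D.

Lemma weight_pos k beta q D j : 0 < weight k beta q D j.
Proof. apply Rmult_lt_0_compat; apply exp_pos. Qed.

Lemma weight_sum k beta q D :
  weight k beta q D 0 + weight k beta q D 1 + weight k beta q D 2 + weight k beta q D 3
  = press k q (D + q * beta).
Proof.
  assert (E : forall j, weight k beta q D j = Rpower (gain k j) q * Rpower (rr j) (D + q * beta)).
  { intros j. unfold weight, Rpower, drift. rewrite <- !exp_plus. f_equal. ring. }
  now rewrite press_sum, !E.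
Qed.

Lemma weight_shift k beta q t D j :
  weight k beta (q + t) D j = weight k beta q D j * exp (t * drift k beta j).
Proof. unfold weight. rewrite Rmult_plus_distr_r, exp_plus. ring. Qed.

Lemma first_order (w0 w1 w2 w3 a0 a1 a2 a3 : R) :
  (forall t, w0 + w1 + w2 + w3 <= w0 * exp (t * a0) + w1 * exp (t * a1) + w2 * exp (t * a2) + w3 * exp (t * a3)) ->
  w0 * a0 + w1 * a1 + w2 * a2 + w3 * a3 = 0.
Proof.
  intros H.
  set (f := fun t => w0 * exp (t * a0) + w1 * exp (t * a1) + w2 * exp (t * a2) + w3 * exp (t * a3)).
  assert (Hd : is_derive f 0 (w0 * a0 + w1 * a1 + w2 * a2 + w3 * a3)).
  { unfold f. auto_derive; [easy|]. rewrite !Rmult_0_l, exp_0. ring. }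
  apply is_derive_Reals in Hd.
  assert (pr : derivable_pt f 0) by (eexists; apply Hd).
  rewrite <- (derive_pt_eq_0 f 0 _ pr Hd).
  apply (deriv_minimum f (-1) 1); try lra.
  intros x _ _. unfold f. rewrite !Rmult_0_l, exp_0, !Rmult_1_r. apply H.
Qed.

(** With [D] fixed, [press k q (D + q * beta)] is minimal at this [q], and its derivative there is
    the mean drift under the weights. *)
Lemma value_certificate_min k beta D q : value k beta D -> press k q (D + q * beta) = 1 ->
  certificate k beta D q (weight k beta q D).
Proof.
  intros (H & _) E. split; [|split].
  - intros j. split; [left; apply weight_pos|apply Rle_refl].
  - now rewrite weight_sum.
  - apply first_order. intros t. rewrite <- !weight_shift, !weight_sum, E. apply H.
Qed.

Lemma press_continuous k b D : forall q, continuity_pt (fun q => press k q (D + q * b)) q.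
Proof.
  intros q. apply continuity_pt_filterlim, (ex_derive_continuous (fun q => press k q (D + q * b))).
  unfold press. auto_derive. easy.
Qed.

Lemma press_ge_weight k beta q D j : (j < 4)%nat ->
  exp (q * drift k beta j) * Rpower (rr j) D <= press k q (D + q * beta).
Proof.
  intros Hj. rewrite <- weight_sum. fold (weight k beta q D j).
  generalize (weight_pos k beta q D 0), (weight_pos k beta q D 1), (weight_pos k beta q D 2), (weight_pos k beta q D 3).
  intros. revert j Hj. apply four_cases; lra.
Qed.

(** A letter of positive drift dominates for large [q], one of negative drift for large [- q]. The
    threshold [2 * ln 6] beats [ratio ^ D], which is at least [6 ^ (- 2)] for [D <= 2]. *)
Lemma press_coercive k beta c i j q D : 0 < c -> (i < 4)%nat -> (j < 4)%nat ->
  c <= drift k beta i -> drift k beta j <= - c -> D <= 2 -> 2 * ln 6 / c < Rabs q ->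
  1 < press k q (D + q * beta).
Proof.
  intros Hc Hi Hj Hdi Hdj HD Hq.
  assert (L6 : 0 < ln 6) by (generalize ln3_pos, ln6_gt; lra).
  apply Rlt_div_l in Hq; [|lra].
  assert (Hr : forall j, exp (- 2 * ln 6) <= Rpower (rr j) D).
  { intros l. unfold Rpower. apply exp_le. destruct (rr_bounds l) as [R1 R2].
    assert (ln (rr l) <= 0) by (apply ln_neg; lra).
    assert (- ln 6 <= ln (rr l)).
    { rewrite <- ln_sixth. destruct (Req_dec (rr l) (1 / 6)) as [->|]; [lra|].
      left; apply ln_increasing; lra. }
    nra. }
  assert (Hbig : forall l, (l < 4)%nat -> 2 * ln 6 < q * drift k beta l -> 1 < press k q (D + q * beta)).
  { intros l Hl Hgt. eapply Rlt_le_trans; [|apply (press_ge_weight k beta q D l Hl)].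
    apply Rlt_le_trans with (exp (q * drift k beta l) * exp (- 2 * ln 6)).
    - rewrite <- exp_plus. rewrite <- exp_0 at 1. apply exp_increasing. lra.
    - apply Rmult_le_compat_l; [left; apply exp_pos|apply Hr]. }
  destruct (Rle_dec 0 q) as [H0|H0].
  - rewrite Rabs_right in Hq by lra. apply (Hbig i Hi). nra.
  - rewrite Rabs_left in Hq by lra. apply (Hbig j Hj). nra.
Qed.

Lemma value_attained k beta D i j : value k beta D -> (i < 4)%nat -> (j < 4)%nat ->
  0 < drift k beta i -> drift k beta j < 0 -> exists q, press k q (D + q * beta) = 1.
Proof.
  intros HV Hi Hj Hdi Hdj.
  set (c := Rmin (drift k beta i) (- drift k beta j)).
  assert (Hc : 0 < c) by (apply Rmin_pos; lra).
  assert (C1 : c <= drift k beta i) by apply Rmin_l.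
  assert (C2 : c <= - drift k beta j) by apply Rmin_r.
  assert (L6 : 0 < ln 6) by (generalize ln3_pos, ln6_gt; lra).
  set (M := 2 * ln 6 / c).
  assert (HM : 0 < M) by (apply Rdiv_lt_0_compat; lra).
  destruct (continuity_ab_min (fun q => press k q (D + q * beta)) (- M) M ltac:(lra))
    as (q & Hq & Hqr).
  { intros; apply press_continuous. }
  exists q. destruct (proj1 HV q) as [Hgt|]; [|easy]. exfalso.
  set (P := press k q (D + q * beta)) in *.
  assert (HlnP : 0 < ln P) by (rewrite <- ln_1; apply ln_increasing; lra).
  (* Small enough that [6 ^ (- e) * P > 1] on [[- M, M]], and at most 1/2 so that [press_coercive]
     covers [D + e] outside. *)
  set (e := Rmin (1 / 2) (ln P / (2 * ln 6))).
  assert (He : 0 < e) by (apply Rmin_pos; [lra|apply Rdiv_lt_0_compat; lra]).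
  assert (He1 : e <= 1 / 2) by apply Rmin_l.
  assert (He2 : e * ln 6 <= ln P / 2).
  { assert (e <= ln P / (2 * ln 6)) as X by apply Rmin_r.
    apply (Rmult_le_compat_r (ln 6)) in X; [|lra].
    replace (ln P / (2 * ln 6) * ln 6) with (ln P / 2) in X by (field; lra). easy. }
  destruct (proj2 HV e He) as (q' & Hq').
  assert (HD := value_le1 _ _ _ HV).
  destruct (Rlt_dec M (Rabs q')) as [Hbig|Hsmall].
  - assert (X := press_coercive k beta c i j q' (D + e) Hc Hi Hj C1 ltac:(lra) ltac:(lra) Hbig). lra.
  - assert (Hin : - M <= q' <= M) by (apply Rabs_le_between; lra).
    assert (X := press_shift_ge k q' (D + q' * beta) e ltac:(lra)).
    replace (D + q' * beta + e) with (D + e + q' * beta) in X by ring.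
    specialize (Hq q' Hin). cbv beta in Hq. fold P in Hq.
    assert (1 < exp (- e * ln 6) * P).
    { rewrite <- (exp_ln P) at 1 by lra. rewrite <- exp_plus, <- exp_0. apply exp_increasing. lra. }
    assert (exp (- e * ln 6) * P <= exp (- e * ln 6) * press k q' (D + q' * beta))
      by (apply Rmult_le_compat_l; [left; apply exp_pos|easy]).
    lra.
Qed.

Definition neutral (x : R) : R := if Req_EM_T x 0 then 1 else 0.

Lemma exp_geom_lim a : a <= 0 -> is_lim_seq (fun n => exp (INR n * a)) (neutral a).
Proof.
  intros Ha. apply is_lim_seq_ext with (fun n => exp a ^ n).
  { intros n. rewrite <- exp_ln_mult by apply exp_pos. now rewrite ln_exp. }
  unfold neutral. destruct Req_EM_T as [->|Hne].
  - rewrite exp_0. apply is_lim_seq_ext with (fun _ => 1); [intros; now rewrite pow1|apply is_lim_seq_const].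
  - apply is_lim_seq_geom. rewrite Rabs_right by (left; apply exp_pos).
    rewrite <- exp_0. apply exp_increasing. lra.
Qed.

(* When all drifts have the same sign the infimum is approached as q tends to infinity, and only the neutral letters survive. *)
Lemma value_certificate_degenerate k beta D sg : value k beta D -> Rabs sg = 1 ->
  (forall j, (j < 4)%nat -> sg * drift k beta j <= 0) -> exists p, certificate k beta D 0 p.
Proof.
  intros (HV & _) Hsg Hneg.
  set (w := fun j => Rpower (rr j) D * neutral (drift k beta j)).
  assert (Hn : forall j, neutral (sg * drift k beta j) = neutral (drift k beta j)).
  { intros j. unfold neutral. destruct Req_EM_T as [E|E], Req_EM_T as [E'|E']; try easy.
    - apply Rmult_integral in E as [->|E]; [rewrite Rabs_R0 in Hsg; lra|easy].
    - rewrite E', Rmult_0_r in E. easy. }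
  assert (Hlim : forall j, (j < 4)%nat ->
    is_lim_seq (fun n => weight k beta (INR n * sg) D j) (w j)).
  { intros j Hj. unfold weight, w. rewrite Rmult_comm.
    apply is_lim_seq_ext with (fun n => exp (INR n * (sg * drift k beta j)) * Rpower (rr j) D).
    { intros n. do 2 f_equal. ring. }
    apply (is_lim_seq_mult' _ _ (neutral (drift k beta j)) (Rpower (rr j) D)).
    - rewrite <- Hn. apply exp_geom_lim. auto.
    - apply is_lim_seq_const. }
  set (W := w 0%nat + w 1%nat + w 2%nat + w 3%nat).
  assert (HW : 1 <= W).
  { assert (L : is_lim_seq (fun n => press k (INR n * sg) (D + INR n * sg * beta)) W).
    { apply is_lim_seq_ext with (fun n => weight k beta (INR n * sg) D 0 + weight k beta (INR n * sg) D 1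
        + weight k beta (INR n * sg) D 2 + weight k beta (INR n * sg) D 3).
      - intros n. apply weight_sum.
      - unfold W. repeat apply is_lim_seq_plus'; apply Hlim; lia. }
    refine (is_lim_seq_le (fun _ => 1) _ _ _ _ (is_lim_seq_const 1) L). intros n. apply HV. }
  assert (Hw : forall j, 0 <= w j <= Rpower (rr j) D).
  { intros j. assert (P := Rpower_pos (rr j) D). unfold w, neutral. destruct Req_EM_T; lra. }
  (* Dividing by [W >= 1] keeps the domination, now with [q = 0]; only letters of drift 0 carry
     weight, so the mean drift vanishes. *)
  exists (fun j => w j / W). split; [|split].
  - intros j. rewrite Rmult_0_l, exp_0, Rmult_1_l. destruct (Hw j). split.
    + apply Rdiv_le_0_compat; lra.
    + apply Rle_div_l; [lra|]. assert (P := Rpower_pos (rr j) D). nra.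
  - unfold W in *. field. lra.
  - assert (Z : forall j, w j / W * drift k beta j = 0).
    { intros j. unfold w, neutral. destruct Req_EM_T as [E|E]; [rewrite E; ring|].
      unfold Rdiv; ring. }
    rewrite !Z. ring.
Qed.

Lemma value_certificate k beta D : value k beta D -> exists q p, certificate k beta D q p.
Proof.
  intros HV.
  destruct (classic (exists i, (i < 4)%nat /\ 0 < drift k beta i)) as [(i & Hi & Hdi)|Hi].
  - destruct (classic (exists j, (j < 4)%nat /\ drift k beta j < 0)) as [(j & Hj & Hdj)|Hj].
    + destruct (value_attained k beta D i j HV Hi Hj Hdi Hdj) as (q & Hq).
      exists q, (weight k beta q D). now apply value_certificate_min.
    + exists 0. apply (value_certificate_degenerate k beta D (-1) HV).
      * rewrite Rabs_left; lra.
      * intros j Hj'. apply Rnot_lt_le. intros Hlt. apply Hj. exists j. split; [easy|lra].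
  - exists 0. apply (value_certificate_degenerate k beta D 1 HV).
    * rewrite Rabs_right; lra.
    * intros j Hj'. apply Rnot_lt_le. intros Hlt. apply Hi. exists j. split; [easy|lra].
Qed.

Lemma beta_max_lt1 k : 1 < k < 5 -> 0 < ln (k + 1) / ln 6 < 1.
Proof.
  intros Hk. assert (L6 : 0 < ln 6) by (generalize ln3_pos, ln6_gt; lra).
  assert (0 < ln (k + 1)) by (rewrite <- ln_1; apply ln_increasing; lra).
  assert (ln (k + 1) < ln 6) by (apply ln_increasing; lra).
  split; [apply Rdiv_lt_0_compat; lra|apply Rlt_div_l; lra].
Qed.

Lemma admissible_bounds lam : admissible lam -> 1 / 6 < lam < 5 / 6 /\ 2 <= 6 * lam * (6 * lam).
Proof.
  intros (H1 & H2). assert (S := sqrt_sqrt 2 ltac:(lra)). assert (S0 := sqrt_pos 2).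
  assert (1 < sqrt 2) by nra. split; [lra|]. nra.
Qed.

Lemma spectrum_value lam beta D : admissible lam -> 0 <= beta <= ln (6 * lam + 1) / ln 6 ->
  value (6 * lam) beta D -> spectrum (F lam) (1 - beta) = Finite D.
Proof.
  intros Hadm Hb HV. destruct (admissible_bounds lam Hadm) as (Hlam & Hkk).
  assert (Hb1 := beta_max_lt1 (6 * lam) ltac:(lra)).
  assert (HD1 := value_le1 _ _ _ HV).
  assert (HD0 := value_nonneg (6 * lam) beta D ltac:(lra) Hb HV).
  destruct (value_certificate _ _ _ HV) as (q & p & Hc).
  unfold spectrum, dimH. destruct excluded_middle_informative as [_|Hno].
  2:{ exfalso. apply Hno.
      exact (level_nonempty lam beta D q (D - 1) p Hlam ltac:(lra) Hc ltac:(lra)). }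
  apply is_glb_Rbar_unique. split.
  - intros s (Hs & HH). simpl. apply Rnot_lt_le. intros Hlt.
    exact (Hmeas_level_nonzero lam beta D q s p Hlam ltac:(lra) Hc Hlt ltac:(lra) HH).
  - intros b Hb'.
    assert (HS : forall s, D < s -> Rbar_le b (Finite s)).
    { intros s Hs. apply Hb'. split; [lra|].
      destruct (proj2 HV ((s - D) / 2) ltac:(lra)) as (q' & Hq').
      apply (Hmeas_level_zero lam beta q' (D + (s - D) / 2 + q' * beta)); try easy; lra. }
    destruct b as [b| |]; [|now specialize (HS (D + 1) ltac:(lra))|easy].
    simpl. apply Rnot_lt_le. intros Hlt. specialize (HS ((D + b) / 2) ltac:(lra)). simpl in HS. lra.
Qed.

Lemma spectrum_empty lam al : admissible lam -> ~ (alpha_min lam <= al <= 1) ->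
  spectrum (F lam) al = m_infty.
Proof.
  intros Hadm H. destruct (admissible_bounds lam Hadm) as (Hlam & _).
  unfold spectrum, dimH. destruct excluded_middle_informative as [(x & Hx & Hh)|]; [|easy].
  exfalso. apply H. apply (level_range lam al x); [lra|easy|easy].
Qed.

(** * The Legendre transform of tau *)

Lemma press_root k q : exists T, press k q T = 1.
Proof.
  assert (L3 := ln3_pos).
  set (P := press k q 0). assert (HP : 0 < P) by apply press_pos.
  (* [3 ^ (- T) = / P], so the shift by [T] carries [press] across 1 whichever side [P] is on. *)
  set (T := ln P / ln 3).
  assert (HT : T * ln 3 = ln P) by (unfold T; field; lra).
  assert (E : exp (- T * ln 3) = / P).
  { replace (- T * ln 3) with (- ln P) by lra. rewrite exp_Ropp, exp_ln; easy. }
  assert (H : Rmin (press k q 0) (press k q T) <= 1 <= Rmax (press k q 0) (press k q T)).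
  { fold P. destruct (Rle_dec 1 P) as [H1|H1].
    - assert (0 <= T).
      { apply Rdiv_le_0_compat; [|lra]. destruct H1 as [H1|<-]; [|rewrite ln_1; lra].
        left. rewrite <- ln_1. apply ln_increasing; lra. }
      assert (A := press_shift_le k q 0 T H). rewrite Rplus_0_l, E in A. fold P in A.
      rewrite Rinv_l in A by lra. split.
      + eapply Rle_trans; [apply Rmin_r|easy].
      + eapply Rle_trans; [|apply Rmax_l]; lra.
    - assert (HlP : ln P < 0) by (rewrite <- ln_1; apply ln_increasing; lra).
      assert (T <= 0) by nra.
      assert (A := press_shift_le k q T (- T) ltac:(lra)). replace (T + - T) with 0 in A by ring.
      fold P in A. replace (- - T * ln 3) with (ln P) in A by lra. rewrite exp_ln in A by easy.
      split.
      + eapply Rle_trans; [apply Rmin_l|]; lra.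
      + eapply Rle_trans; [|apply Rmax_r]. apply (Rmult_le_reg_l P); lra. }
  destruct (IVT_gen (fun T => press k q T) 0 T 1) as (x & _ & Hx); [|exact H|now exists x].
  intros x. apply continuity_pt_filterlim, (ex_derive_continuous (fun T => press k q T)).
  unfold press. auto_derive. easy.
Qed.

(** Each probability is [gain * ratio ^ gamma], so gamma only translates the exponent of the
    ratio. *)
Lemma tau_press lam q t : 1 / 6 < lam ->
  sum_n (fun i => Rpower (pw lam i) q * Rpower (rr i) (- t)) 3 = press (6 * lam) q (gamma lam * q - t).
Proof.
  intros Hlam. set (g := gamma lam).
  assert (Hpw : forall i, (i < 4)%nat -> pw lam i = gain (6 * lam) i * Rpower (rr i) g).
  { assert (E3 : Rpower 3 (- g) = Rpower (1 / 3) g)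
      by (unfold Rpower; rewrite ln_third; f_equal; ring).
    assert (E6 : Rpower 6 (- g) = Rpower (1 / 6) g)
      by (unfold Rpower; rewrite ln_sixth; f_equal; ring).
    apply four_cases; simpl; fold g; rewrite ?E3, ?E6; ring. }
  assert (Ht : forall i, (i < 4)%nat -> Rpower (pw lam i) q * Rpower (rr i) (- t) =
     Rpower (gain (6 * lam) i) q * Rpower (rr i) (g * q - t)).
  { intros i Hi. rewrite Hpw by easy.
    rewrite <- Rpower_mult_distr by (try apply gain_pos; try apply Rpower_pos; lra).
    rewrite Rpower_mult, Rmult_assoc, <- Rpower_plus. reflexivity. }
  rewrite press_sum, !sum_Sn, sum_O. change plus with Rplus.
  rewrite !Ht by lia. reflexivity.
Qed.

Lemma tau_root lam q T : 1 / 6 < lam -> press (6 * lam) q T = 1 -> tau lam q = gamma lam * q - T.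
Proof.
  intros Hlam HT. unfold tau, the_real.
  set (X := fun t => sum_n (fun i => Rpower (pw lam i) q * Rpower (rr i) (- t)) 3 = 1).
  assert (HX : X (epsilon (inhabits 0) X)).
  { apply epsilon_spec. exists (gamma lam * q - T). unfold X. rewrite tau_press by easy.
    replace (gamma lam * q - (gamma lam * q - T)) with T by ring. easy. }
  set (t := epsilon (inhabits 0) X) in *. unfold X in HX. rewrite tau_press in HX by easy.
  destruct (Rtotal_order (gamma lam * q - t) T) as [H|[H|H]]; [|lra|].
  - apply (press_lt (6 * lam) q) in H. lra.
  - apply (press_lt (6 * lam) q) in H. lra.
Qed.

(** With [tau(q) = gamma * q - T] the quantity under the infimum, [(gamma - beta) * q - tau(q)], is
    [T - beta * q]. *)
Lemma tau_star_value lam beta D : 1 / 6 < lam -> value (6 * lam) beta D ->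
  tau_star lam (1 - beta + gamma lam - 1) = Finite D.
Proof.
  intros Hlam (H1 & H2). apply is_glb_Rbar_unique. split.
  - intros v (q & ->). destruct (press_root (6 * lam) q) as (T & HT).
    rewrite (tau_root lam q T Hlam HT). simpl. apply Rnot_lt_le. intros Hlt.
    specialize (H1 q). assert (A := press_lt (6 * lam) q T (D + q * beta) ltac:(lra)). lra.
  - intros b Hb.
    assert (HS : forall eps, 0 < eps -> Rbar_le b (Finite (D + eps))).
    { intros eps He. destruct (H2 eps He) as (q & Hq).
      destruct (press_root (6 * lam) q) as (T & HT).
      eapply Rbar_le_trans; [apply Hb; exists q; reflexivity|].
      rewrite (tau_root lam q T Hlam HT). simpl. apply Rnot_lt_le. intros Hlt.
      assert (A := press_lt (6 * lam) q (D + eps + q * beta) T ltac:(lra)). lra. }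
    destruct b as [b| |]; [|now specialize (HS 1 ltac:(lra))|easy].
    simpl. apply Rnot_lt_le. intros Hlt. specialize (HS ((b - D) / 2) ltac:(lra)). simpl in HS. lra.
Qed.

(** * Dependence on the parameters *)

Definition beta_max (k : R) : R := ln (k + 1) / ln 6.

Lemma ln6_pos : 0 < ln 6.
Proof. generalize ln3_pos, ln6_gt; lra. Qed.

Lemma drift_0 k beta : drift k beta 0 = - (beta * ln 3).
Proof. unfold drift; simpl. rewrite ln_1, ln_third. ring. Qed.

Lemma drift_1 k beta : drift k beta 1 = ln (k + 1) - beta * ln 6.
Proof. unfold drift; simpl. rewrite ln_sixth. ring. Qed.

Lemma drift_2 k beta : drift k beta 2 = ln (k - 1) - beta * ln 6.
Proof. unfold drift; simpl. rewrite ln_sixth. ring. Qed.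

Lemma drift_3 k beta : drift k beta 3 = - (beta * ln 3).
Proof. unfold drift; simpl. rewrite ln_1, ln_third. ring. Qed.

Lemma press_ge1_le k q D T : press k q T = 1 -> 1 <= press k q D -> D <= T.
Proof.
  intros H1 H2. apply Rnot_lt_le. intros Hlt. assert (A := press_lt k q T D Hlt). lra.
Qed.

(** A minimizer [q] exists at the intermediate beta and bounds both end values by the same line.
    Equality would make [q] minimizing at [b1] and [b2] with identical weights; but for fixed
    weights the mean drift is strictly decreasing in beta and cannot vanish twice. *)
Lemma value_strict_concave k b1 b2 t D1 D2 D : 1 < k -> 0 <= b1 <= beta_max k -> 0 <= b2 <= beta_max k ->
  b1 <> b2 -> 0 < t < 1 -> value k b1 D1 -> value k b2 D2 -> value k (t * b1 + (1 - t) * b2) D ->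
  t * D1 + (1 - t) * D2 < D.
Proof.
  intros Hk H1 H2 Hne Ht V1 V2 V.
  set (b := t * b1 + (1 - t) * b2) in *.
  assert (L3 := ln3_pos). assert (L6 := ln6_pos).
  assert (Hb : 0 < b < beta_max k).
  { unfold b. destruct (Rtotal_order b1 b2) as [X|[X|X]]; [|easy|]; split; nra. }
  assert (Hb6 : b * ln 6 < ln (k + 1)).
  { replace (ln (k + 1)) with (beta_max k * ln 6) by (unfold beta_max; field; lra).
    apply Rmult_lt_compat_r; lra. }
  destruct (value_attained k b D 1 0 V ltac:(lia) ltac:(lia)) as (q & Hq).
  { rewrite drift_1. lra. }
  { rewrite drift_0. nra. }
  assert (A1 := press_ge1_le _ _ _ _ Hq (proj1 V1 q)).
  assert (A2 := press_ge1_le _ _ _ _ Hq (proj1 V2 q)).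
  assert (Hle : t * D1 + (1 - t) * D2 <= D).
  { assert (t * (D1 + q * b1) + (1 - t) * (D2 + q * b2) <= D + q * b) by nra.
    unfold b in *. lra. }
  destruct Hle as [Hlt|Heq]; [easy|exfalso].
  assert (E1 : D1 + q * b1 = D + q * b) by (unfold b in *; nra).
  assert (E2 : D2 + q * b2 = D + q * b) by (unfold b in *; nra).
  assert (C1 := value_certificate_min k b1 D1 q V1 ltac:(now rewrite E1)).
  assert (C2 := value_certificate_min k b2 D2 q V2 ltac:(now rewrite E2)).
  destruct C1 as (_ & _ & M1). destruct C2 as (_ & _ & M2).
  assert (W : forall j, weight k b2 q D2 j = weight k b1 q D1 j).
  { intros j. unfold weight, drift, Rpower. rewrite <- !exp_plus. f_equal.
    replace D2 with (D1 + q * b1 - q * b2) by lra. ring. }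
  rewrite !W in M2. rewrite !drift_0, !drift_1, !drift_2, !drift_3 in *.
  generalize (weight_pos k b1 q D1 0), (weight_pos k b1 q D1 1), (weight_pos k b1 q D1 2), (weight_pos k b1 q D1 3).
  set (w0 := weight k b1 q D1 0) in *. set (w1 := weight k b1 q D1 1) in *.
  set (w2 := weight k b1 q D1 2) in *. set (w3 := weight k b1 q D1 3) in *.
  intros.
  assert (Z : (b1 - b2) * ((w0 + w3) * ln 3 + (w1 + w2) * ln 6) = 0) by lra.
  apply Rmult_integral in Z as [Z|Z]; [lra|].
  assert (0 < (w0 + w3) * ln 3) by (apply Rmult_lt_0_compat; lra).
  assert (0 < (w1 + w2) * ln 6) by (apply Rmult_lt_0_compat; lra).
  lra.
Qed.

(** This beta is the one at which Lebesgue measure, with weights 1/3, 1/6, 1/6, 1/3, has mean drift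
    zero. Then [q = 0] is optimal by [exp x >= 1 + x]. *)
Lemma value_peak k : 1 < k -> value k (ln (k ^ 2 - 1) / (4 * ln 3 + 2 * ln 6)) 1.
Proof.
  intros Hk. assert (L3 := ln3_pos). assert (L6 := ln6_pos).
  set (b := ln (k ^ 2 - 1) / (4 * ln 3 + 2 * ln 6)).
  assert (Hb : ln (k + 1) + ln (k - 1) = b * (4 * ln 3 + 2 * ln 6)).
  { rewrite <- ln_mult by lra. unfold b.
    replace ((k + 1) * (k - 1)) with (k ^ 2 - 1) by ring. field. lra. }
  split.
  - intros q. rewrite <- weight_sum. unfold weight. rewrite !Rpower_1 by (generalize (rr_bounds 0), (rr_bounds 1), (rr_bounds 2), (rr_bounds 3); lra).
    simpl rr.
    assert (X := fun j => exp_ineq1_le (q * drift k b j)).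
    generalize (X 0%nat), (X 1%nat), (X 2%nat), (X 3%nat).
    assert (Z : 2 * drift k b 0 + drift k b 1 + drift k b 2 + 2 * drift k b 3 = 0).
    { rewrite drift_0, drift_1, drift_2, drift_3. lra. }
    intros.
    assert (q * (2 * drift k b 0 + drift k b 1 + drift k b 2 + 2 * drift k b 3) = 0) by (rewrite Z; ring).
    lra.
  - intros eps He. exists 0. rewrite Rmult_0_l, Rplus_0_r.
    apply Rle_trans with (press k 0 1); [apply press_le; lra|rewrite press_0_1; lra].
Qed.

(** The lower bound [0 <= ln (k ^ 2 - 1)] is the condition [2 <= k * k] itself. *)
Lemma peak_range k : 1 < k -> 2 <= k * k ->
  0 <= ln (k ^ 2 - 1) / (4 * ln 3 + 2 * ln 6) <= beta_max k.
Proof.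
  intros Hk Hkk. assert (L3 := ln3_pos). assert (L6 := ln6_pos).
  assert (H0 : 0 <= ln (k ^ 2 - 1)).
  { destruct (Req_dec (k ^ 2 - 1) 1) as [->|]; [rewrite ln_1; lra|].
    left. rewrite <- ln_1 at 1. apply ln_increasing; nra. }
  assert (H1 : ln (k ^ 2 - 1) <= 2 * ln (k + 1)).
  { replace (k ^ 2 - 1) with ((k + 1) * (k - 1)) by ring. rewrite ln_mult by lra.
    assert (ln (k - 1) < ln (k + 1)) by (apply ln_increasing; lra). lra. }
  split; [apply Rdiv_le_0_compat; lra|].
  apply Rle_div_l; [lra|]. unfold beta_max.
  replace (ln (k + 1) / ln 6 * (4 * ln 3 + 2 * ln 6)) with
    (2 * ln (k + 1) + ln (k + 1) * (4 * ln 3 / ln 6)) by (field; lra).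
  assert (0 < 4 * ln 3 / ln 6) by (apply Rdiv_lt_0_compat; lra). nra.
Qed.

(** At the extreme beta every letter but 1 has negative drift, so mean zero puts all the mass on
    letter 1, where it is at most [6 ^ (- D)]. *)
Lemma value_beta_max k : 1 < k -> value k (beta_max k) 0.
Proof.
  intros Hk. assert (L6 := ln6_pos).
  assert (Hb : 0 < beta_max k).
  { apply Rdiv_lt_0_compat; [|easy]. rewrite <- ln_1. apply ln_increasing; lra. }
  destruct (value_exists k (beta_max k) Hk ltac:(unfold beta_max in *; lra)) as (D & HD).
  assert (H0 := value_nonneg k (beta_max k) D Hk ltac:(unfold beta_max in *; lra) HD).
  enough (D <= 0) by (replace 0 with D by lra; easy).
  destruct (value_certificate _ _ _ HD) as (q & p & Hp & Hs & Hm).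
  rewrite drift_0, drift_1, drift_2, drift_3 in Hm.
  assert (E : beta_max k * ln 6 = ln (k + 1)) by (unfold beta_max; field; lra).
  rewrite E, Rminus_diag in Hm.
  assert (L3 := ln3_pos).
  assert (ln (k - 1) < ln (k + 1)) by (apply ln_increasing; lra).
  assert (P0 := proj1 (Hp 0%nat)). assert (P2 := proj1 (Hp 2%nat)). assert (P3 := proj1 (Hp 3%nat)).
  assert (HX : 0 < beta_max k * ln 3) by (apply Rmult_lt_0_compat; easy).
  set (X := beta_max k * ln 3) in *.
  set (Y := ln (k + 1) - ln (k - 1)). assert (HY : 0 < Y) by (unfold Y; lra).
  replace (ln (k - 1) - ln (k + 1)) with (- Y) in Hm by (unfold Y; ring).
  assert (0 <= p 0%nat * X) by (apply Rmult_le_pos; lra).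
  assert (0 <= p 2%nat * Y) by (apply Rmult_le_pos; lra).
  assert (0 <= p 3%nat * X) by (apply Rmult_le_pos; lra).
  assert (p 0%nat = 0) by (apply (Rmult_eq_reg_r X); lra).
  assert (p 2%nat = 0) by (apply (Rmult_eq_reg_r Y); lra).
  assert (p 3%nat = 0) by (apply (Rmult_eq_reg_r X); lra).
  assert (P1 := proj2 (Hp 1%nat)).
  rewrite drift_1, E, Rminus_diag, Rmult_0_r, exp_0, Rmult_1_l in P1. simpl rr in P1.
  apply Rnot_lt_le. intros Hlt.
  assert (Rpower (1 / 6) D < 1); [|lra].
  unfold Rpower. rewrite ln_sixth. rewrite <- exp_0. apply exp_increasing. nra.
Qed.

(** For beta = 0 and [k > 2] both middle letters have positive drift, so only the outer letters can
    carry mass: the value is the dimension of the middle-third Cantor set. *)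
Lemma value_zero_large k : 2 < k -> value k 0 (ln 2 / ln 3).
Proof.
  intros Hk. assert (L6 := ln6_pos). assert (L3 := ln3_pos).
  destruct (value_exists k 0 ltac:(lra)) as (D & HD).
  { split; [lra|]. apply Rdiv_le_0_compat; [|easy]. rewrite <- ln_1. left. apply ln_increasing; lra. }
  enough (D = ln 2 / ln 3) by (subst D; easy).
  apply Rle_antisym.
  - destruct (value_certificate _ _ _ HD) as (q & p & Hp & Hs & Hm).
    assert (Q0 := proj2 (Hp 0%nat)). assert (Q3 := proj2 (Hp 3%nat)).
    rewrite drift_0 in Q0. rewrite drift_3 in Q3. simpl rr in *.
    rewrite Rmult_0_l, Ropp_0, Rmult_0_r, exp_0, Rmult_1_l in Q0, Q3.
    rewrite drift_0, drift_1, drift_2, drift_3 in Hm.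
    assert (0 < ln (k - 1)) by (rewrite <- ln_1; apply ln_increasing; lra).
    assert (0 < ln (k + 1)) by (rewrite <- ln_1; apply ln_increasing; lra).
    assert (P1 := proj1 (Hp 1%nat)). assert (P2 := proj1 (Hp 2%nat)).
    assert (0 <= p 1%nat * ln (k + 1)) by (apply Rmult_le_pos; lra).
    assert (0 <= p 2%nat * ln (k - 1)) by (apply Rmult_le_pos; lra).
    assert (p 1%nat = 0) by (apply (Rmult_eq_reg_r (ln (k + 1))); lra).
    assert (p 2%nat = 0) by (apply (Rmult_eq_reg_r (ln (k - 1))); lra).
    unfold Rpower in Q0, Q3. rewrite ln_third in Q0, Q3.
    apply Rle_div_r; [lra|]. apply Rnot_lt_le. intros Hlt.
    assert (exp (D * - ln 3) < / 2); [|lra].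
    rewrite <- (exp_ln (/ 2)) by lra. apply exp_increasing. rewrite ln_Rinv by lra. lra.
  - apply Rnot_lt_le. intros Hlt.
    destruct (proj2 HD ((ln 2 / ln 3 - D) / 2) ltac:(lra)) as (q & Hq).
    set (T := D + (ln 2 / ln 3 - D) / 2 + q * 0) in *.
    assert (HT : T * ln 3 < ln 2) by (apply Rlt_div_r; [lra|unfold T; lra]).
    unfold press in Hq.
    generalize (exp_pos (q * ln (k + 1) - T * ln 6)), (exp_pos (q * ln (k - 1) - T * ln 6)). intros.
    assert (/ 2 < exp (- T * ln 3)); [|lra].
    rewrite <- (exp_ln (/ 2)) by lra. apply exp_increasing. rewrite ln_Rinv by lra. lra.
Qed.

(* At k = 2 the third letter is neutral as well, which raises the value by a definite amount. *)
Lemma value_zero_critical D : value 2 0 D -> ln 2 / ln 3 + 1 / 100 <= D.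
Proof.
  intros HD. apply Rnot_lt_le. intros Hlt. assert (L6 := ln6_pos). assert (L3 := ln3_pos).
  (* At this [T] the outer letters fall short of 1 by at most 1/50, while letter 2 alone contributes
     at least 1/36. *)
  set (T := ln 2 / ln 3 + 1 / 100) in *.
  destruct (proj2 HD (T - D) ltac:(lra)) as (q & Hq).
  replace (D + (T - D) + q * 0) with T in Hq by ring.
  unfold press in Hq. replace (2 - 1) with 1 in Hq by ring. rewrite ln_1, Rmult_0_r in Hq.
  generalize (exp_pos (q * ln (2 + 1) - T * ln 6)). intros.
  assert (A : exp (- T * ln 3) = / 2 * exp (- (1 / 100) * ln 3)).
  { replace (- T * ln 3) with (- ln 2 + - (1 / 100) * ln 3) by (unfold T; field; lra).
    rewrite exp_plus, exp_Ropp, exp_ln; lra. }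
  assert (B : 1 + - (1 / 100) * ln 3 <= exp (- (1 / 100) * ln 3)) by apply exp_ineq1_le.
  assert (L3' : ln 3 <= 2).
  { rewrite <- (ln_exp 2). destruct (exp_ineq1_le 2) as [X|X].
    - left. apply ln_increasing; lra.
    - right. f_equal. lra. }
  assert (L2 : ln 2 / ln 3 < 1).
  { apply Rlt_div_l; [lra|]. rewrite Rmult_1_l. apply ln_increasing; lra. }
  assert (C : / 36 <= exp (0 - T * ln 6)).
  { rewrite <- (exp_ln (/ 36)) by lra. apply exp_le. rewrite ln_Rinv by lra.
    replace 36 with (6 * 6) by ring. rewrite ln_mult by lra. unfold T. nra. }
  lra.
Qed.

Definition dval (k beta : R) : R := the_real (value k beta).

Lemma dval_spec k beta : 1 < k -> 0 <= beta <= beta_max k -> value k beta (dval k beta).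
Proof. intros Hk Hb. unfold dval, the_real. apply epsilon_spec. now apply value_exists. Qed.

Lemma dval_eq k beta D : value k beta D -> dval k beta = D.
Proof.
  intros H. apply (value_unique k beta); [|easy].
  unfold dval, the_real. apply epsilon_spec. now exists D.
Qed.

(* Rescales the range of beta, which moves with k, to [0, 1]. *)
Definition profile (k u : R) : R := dval k (u * beta_max k).

Lemma beta_max_pos k : 1 < k -> 0 < beta_max k.
Proof.
  intros. apply Rdiv_lt_0_compat; [|apply ln6_pos]. rewrite <- ln_1. apply ln_increasing; lra.
Qed.

Lemma profile_spec k u : 1 < k -> 0 <= u <= 1 -> value k (u * beta_max k) (profile k u).
Proof. intros Hk Hu. apply dval_spec; [easy|]. generalize (beta_max_pos k Hk). nra. Qed.

Lemma profile_bounds k u : 1 < k -> 0 <= u <= 1 -> 0 <= profile k u <= 1.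
Proof.
  intros Hk Hu. assert (V := profile_spec k u Hk Hu). split.
  - apply (value_nonneg k (u * beta_max k)); [easy| |easy].
    generalize (beta_max_pos k Hk). unfold beta_max. nra.
  - now apply (value_le1 k (u * beta_max k)).
Qed.

(** Concavity against the chord to the endpoint [u = 1], where the profile is 0. It provides lower
    semicontinuity at [u = 0] when no letter has negative drift. *)
Lemma profile_ge_linear k u : 1 < k -> 0 <= u <= 1 -> (1 - u) * profile k 0 <= profile k u.
Proof.
  intros Hk Hu. assert (B := profile_bounds k u Hk Hu).
  destruct (Req_dec u 0) as [->|H0]; [lra|].
  destruct (Req_dec u 1) as [->|H1]; [lra|].
  assert (V0 := profile_spec k 0 Hk ltac:(lra)). assert (V := profile_spec k u Hk Hu).
  assert (V1 := value_beta_max k Hk). assert (P := beta_max_pos k Hk).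
  rewrite Rmult_0_l in V0.
  replace (u * beta_max k) with ((1 - u) * 0 + (1 - (1 - u)) * beta_max k) in V by ring.
  assert (X := value_strict_concave k 0 (beta_max k) (1 - u) _ _ _ Hk ltac:(lra) ltac:(lra) ltac:(lra) ltac:(lra) V0 V1 V).
  lra.
Qed.

(** * Semicontinuity in the parameters *)

Definition drift_close (k b k0 b0 eta : R) : Prop :=
  forall j, (j < 4)%nat -> Rabs (drift k b j - drift k0 b0 j) <= eta.

Lemma press_drift k b k0 b0 q D eta : drift_close k b k0 b0 eta ->
  press k q (D + q * b) <= exp (Rabs q * eta) * press k0 q (D + q * b0).
Proof.
  intros H. rewrite <- !weight_sum.
  assert (A : forall j, (j < 4)%nat -> weight k b q D j <= exp (Rabs q * eta) * weight k0 b0 q D j).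
  { intros j Hj. unfold weight. rewrite <- Rmult_assoc.
    apply Rmult_le_compat_r; [left; apply Rpower_pos|]. rewrite <- exp_plus. apply exp_le.
    specialize (H j Hj). assert (X := Rle_abs (q * (drift k b j - drift k0 b0 j))).
    rewrite Rabs_mult in X.
    assert (Rabs q * Rabs (drift k b j - drift k0 b0 j) <= Rabs q * eta)
      by (apply Rmult_le_compat_l; [apply Rabs_pos|easy]).
    lra. }
  generalize (A 0%nat ltac:(lia)), (A 1%nat ltac:(lia)), (A 2%nat ltac:(lia)), (A 3%nat ltac:(lia)). lra.
Qed.

(** An infimum of functions continuous in the parameters is upper semicontinuous: one nearly optimal
    [q] is kept. *)
Lemma value_usc k0 b0 D0 eps : value k0 b0 D0 -> 0 < eps -> exists eta, 0 < eta /\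
  forall k b D, drift_close k b k0 b0 eta -> value k b D -> D <= D0 + eps.
Proof.
  intros V0 He. destruct (proj2 V0 (eps / 2) ltac:(lra)) as (q & Hq).
  assert (L3 := ln3_pos). assert (Q := Rabs_pos q).
  set (eta := (eps / 2 * ln 3) / (Rabs q + 1)).
  assert (Heta : 0 < eta) by (apply Rdiv_lt_0_compat; nra).
  assert (Hq' : Rabs q * eta <= eps / 2 * ln 3).
  { assert (eta * (Rabs q + 1) = eps / 2 * ln 3) by (unfold eta; field; lra). lra. }
  exists eta. split; [easy|]. intros k b D Hc V.
  assert (A := press_drift k b k0 b0 q (D0 + eps) eta Hc).
  assert (B := press_shift_le k0 q (D0 + eps / 2 + q * b0) (eps / 2) ltac:(lra)).
  replace (D0 + eps / 2 + q * b0 + eps / 2) with (D0 + eps + q * b0) in B by field.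
  assert (C : exp (Rabs q * eta) * exp (- (eps / 2) * ln 3) <= 1).
  { rewrite <- exp_plus, <- exp_0. apply exp_le. lra. }
  generalize (exp_pos (Rabs q * eta)), (exp_pos (- (eps / 2) * ln 3)). intros E1 E2.
  assert (F : press k q (D0 + eps + q * b) <= 1).
  { eapply Rle_trans; [apply A|].
    apply Rle_trans with (exp (Rabs q * eta) * exp (- (eps / 2) * ln 3)); [|easy].
    apply Rmult_le_compat_l; [lra|]. nra. }
  apply Rnot_lt_le. intros Hlt. assert (G := proj1 V q).
  assert (X := press_lt k q (D0 + eps + q * b) (D + q * b) ltac:(lra)). lra.
Qed.

(** Drifts of both signs persist under perturbation, so [press_coercive] confines the relevant [q]
    to a fixed interval where [press] varies uniformly. Otherwise they may escape to infinity, as at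
    [k = 2] and beta = 0. *)
Lemma value_lsc k0 b0 D0 eps i j : value k0 b0 D0 -> 0 < eps -> (i < 4)%nat -> (j < 4)%nat ->
  0 < drift k0 b0 i -> drift k0 b0 j < 0 -> exists eta, 0 < eta /\
  forall k b D, drift_close k b k0 b0 eta -> value k b D -> D0 - eps <= D.
Proof.
  intros V0 He Hi Hj Hdi Hdj.
  assert (L3 := ln3_pos). assert (L6 := ln6_pos). assert (HD0 := value_le1 _ _ _ V0).
  (* Half of the margin is kept for the perturbed drifts. *)
  set (c := Rmin (drift k0 b0 i) (- drift k0 b0 j) / 2).
  assert (Hc : 0 < c) by (unfold c; generalize (Rmin_pos (drift k0 b0 i) (- drift k0 b0 j)); lra).
  assert (C1 : 2 * c <= drift k0 b0 i).
  { unfold c. generalize (Rmin_l (drift k0 b0 i) (- drift k0 b0 j)); lra. }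
  assert (C2 : 2 * c <= - drift k0 b0 j).
  { unfold c. generalize (Rmin_r (drift k0 b0 i) (- drift k0 b0 j)); lra. }
  set (M := 2 * ln 6 / c). assert (HM : 0 < M) by (apply Rdiv_lt_0_compat; lra).
  set (eta := Rmin c (eps * ln 3 / M)).
  assert (Heta : 0 < eta) by (apply Rmin_pos; [easy|apply Rdiv_lt_0_compat; nra]).
  assert (E1 : eta <= c) by apply Rmin_l.
  assert (E2 : M * eta <= eps * ln 3).
  { assert (eta <= eps * ln 3 / M) as X by apply Rmin_r.
    apply (Rmult_le_compat_l M) in X; [|lra].
    replace (M * (eps * ln 3 / M)) with (eps * ln 3) in X by (field; lra). easy. }
  exists eta. split; [easy|]. intros k b D Hcl V.
  assert (Di := Hcl i Hi). assert (Dj := Hcl j Hj).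
  apply Rabs_le_between in Di, Dj.
  assert (G : forall q, 1 <= press k q (D0 - eps + q * b)).
  { intros q. destruct (Rlt_dec M (Rabs q)) as [Hb|Hs].
    - left. apply (press_coercive k b c i j q (D0 - eps)); try easy; lra.
    - assert (A := press_drift k0 b0 k b q (D0 - eps) eta).
      assert (A' := A ltac:(intros l Hl; rewrite Rabs_minus_sym; now apply Hcl)).
      assert (B := press_shift_le k0 q (D0 - eps + q * b0) eps ltac:(lra)).
      replace (D0 - eps + q * b0 + eps) with (D0 + q * b0) in B by ring.
      assert (Q := proj1 V0 q).
      assert (X : exp (- eps * ln 3) * exp (Rabs q * eta) <= 1).
      { rewrite <- exp_plus, <- exp_0. apply exp_le.
        assert (Rabs q * eta <= M * eta) by (apply Rmult_le_compat_r; lra). lra. }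
      apply (Rmult_le_compat_l (exp (- eps * ln 3))) in A'; [|left; apply exp_pos].
      assert (P := press_pos k q (D0 - eps + q * b)).
      nra. }
  apply Rnot_lt_le. intros Hlt.
  destruct (proj2 V ((D0 - eps - D) / 2) ltac:(lra)) as (q & Hq). specialize (G q).
  assert (X := press_lt k q (D + (D0 - eps - D) / 2 + q * b) (D0 - eps + q * b) ltac:(lra)). lra.
Qed.

Lemma ln_continuous x eps : 0 < x -> 0 < eps -> exists d, 0 < d /\
  forall y, Rabs (y - x) < d -> Rabs (ln y - ln x) < eps.
Proof.
  intros Hx He.
  assert (C : continuity_pt ln x).
  { apply continuity_pt_filterlim, (ex_derive_continuous ln). auto_derive. easy. }
  destruct (C eps He) as (d & Hd & H). exists d. split; [easy|].
  intros y Hy. destruct (Req_dec y x) as [->|Hne]; [rewrite Rminus_diag, Rabs_R0; easy|].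
  apply H. split; [|easy]. split; [easy|]. lra.
Qed.

Lemma drift_close_near k0 u0 eta : 1 < k0 < 5 -> 0 <= u0 <= 1 -> 0 < eta -> exists d, 0 < d /\
  forall k u, 1 < k < 5 -> 0 <= u <= 1 -> Rabs (k - k0) < d -> Rabs (u - u0) < d ->
    Rabs (beta_max k - beta_max k0) < eta /\
    drift_close k (u * beta_max k) k0 (u0 * beta_max k0) eta.
Proof.
  intros Hk0 Hu0 He. assert (L3 := ln3_pos). assert (L6 := ln6_pos). assert (L36 := ln6_gt).
  set (e := Rmin (eta * ln 6 / 2) (eta / 4)).
  assert (He' : 0 < e) by (apply Rmin_pos; [|lra]; apply Rdiv_lt_0_compat; nra).
  assert (e1 : e <= eta * ln 6 / 2) by apply Rmin_l.
  assert (e2 : e <= eta / 4) by apply Rmin_r.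
  destruct (ln_continuous (k0 + 1) e ltac:(lra) He') as (d1 & Hd1 & H1).
  destruct (ln_continuous (k0 - 1) e ltac:(lra) He') as (d2 & Hd2 & H2).
  set (d3 := eta / (4 * ln 6)).
  assert (Hd3 : 0 < d3) by (apply Rdiv_lt_0_compat; lra).
  exists (Rmin d1 (Rmin d2 d3)). split; [repeat apply Rmin_pos; easy|].
  intros k u Hk Hu Hkd Hud.
  assert (M1 : Rmin d1 (Rmin d2 d3) <= d1) by apply Rmin_l.
  assert (M2 : Rmin d1 (Rmin d2 d3) <= d2) by (eapply Rle_trans; [apply Rmin_r|apply Rmin_l]).
  assert (M3 : Rmin d1 (Rmin d2 d3) <= d3) by (eapply Rle_trans; [apply Rmin_r|apply Rmin_r]).
  specialize (H1 (k + 1)). replace (k + 1 - (k0 + 1)) with (k - k0) in H1 by ring.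
  specialize (H2 (k - 1)). replace (k - 1 - (k0 - 1)) with (k - k0) in H2 by ring.
  specialize (H1 ltac:(lra)). specialize (H2 ltac:(lra)).
  assert (B6 : forall k, beta_max k * ln 6 = ln (k + 1)) by (intros; unfold beta_max; field; lra).
  assert (Hb := beta_max_lt1 k Hk). fold (beta_max k) in Hb.
  assert (Hub : Rabs (u * beta_max k - u0 * beta_max k0) * ln 6 <= eta / 2).
  { replace (u * beta_max k - u0 * beta_max k0)
      with ((u - u0) * beta_max k + u0 * (beta_max k - beta_max k0)) by ring.
    rewrite <- (Rabs_right (ln 6)) at 1 by lra. rewrite <- Rabs_mult.
    replace (((u - u0) * beta_max k + u0 * (beta_max k - beta_max k0)) * ln 6) with
     ((u - u0) * (beta_max k * ln 6) + u0 * (ln (k + 1) - ln (k0 + 1))) by (rewrite <- !B6; ring).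
    eapply Rle_trans; [apply Rabs_triang|]. rewrite (Rabs_mult (u - u0)), (Rabs_mult u0), (Rabs_right u0) by lra.
    assert (X1 : Rabs (u - u0) * Rabs (beta_max k * ln 6) <= d3 * ln 6).
    { apply Rmult_le_compat; try apply Rabs_pos; [lra|]. rewrite Rabs_right; nra. }
    assert (X2 : d3 * ln 6 = eta / 4) by (unfold d3; field; lra).
    assert (X3 : u0 * Rabs (ln (k + 1) - ln (k0 + 1)) <= 1 * (eta / 4)).
    { apply Rmult_le_compat; try apply Rabs_pos; lra. }
    lra. }
  split.
  - replace (beta_max k - beta_max k0) with ((ln (k + 1) - ln (k0 + 1)) / ln 6)
      by (unfold beta_max; field; lra).
    unfold Rdiv. rewrite Rabs_mult, (Rabs_right (/ ln 6)) by (apply Rle_ge; left; now apply Rinv_0_lt_compat).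
    apply (Rmult_lt_reg_r (ln 6)); [lra|]. rewrite Rmult_assoc, Rinv_l by lra. nra.
  - set (b := u * beta_max k) in *. set (b0 := u0 * beta_max k0) in *.
    assert (Hb3 : Rabs (b - b0) * ln 3 <= eta / 2).
    { eapply Rle_trans; [|apply Hub]. apply Rmult_le_compat_l; [apply Rabs_pos|lra]. }
    assert (A3 : Rabs (- (b * ln 3) - - (b0 * ln 3)) <= eta).
    { replace (- (b * ln 3) - - (b0 * ln 3)) with (- ((b - b0) * ln 3)) by ring.
      rewrite Rabs_Ropp, Rabs_mult, (Rabs_right (ln 3)); lra. }
    assert (A6 : forall x y, Rabs (x - y) < e -> Rabs (x - b * ln 6 - (y - b0 * ln 6)) <= eta).
    { intros x y Hxy. replace (x - b * ln 6 - (y - b0 * ln 6)) with ((x - y) + - ((b - b0) * ln 6)) by ring.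
      eapply Rle_trans; [apply Rabs_triang|].
      rewrite Rabs_Ropp, Rabs_mult, (Rabs_right (ln 6)); lra. }
    unfold drift_close. apply four_cases.
    + now rewrite !drift_0.
    + rewrite !drift_1. now apply A6.
    + rewrite !drift_2. now apply A6.
    + now rewrite !drift_3.
Qed.

Lemma profile_upper k0 u0 eps : 1 < k0 < 5 -> 0 <= u0 <= 1 -> 0 < eps -> exists d, 0 < d /\
  forall k u, 1 < k < 5 -> 0 <= u <= 1 -> Rabs (k - k0) < d -> Rabs (u - u0) < d ->
    profile k u <= profile k0 u0 + eps.
Proof.
  intros Hk0 Hu0 He.
  destruct (value_usc k0 _ _ eps (profile_spec k0 u0 ltac:(lra) Hu0) He) as (eta & Heta & H).
  destruct (drift_close_near k0 u0 eta Hk0 Hu0 Heta) as (d & Hd & H').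
  exists d. split; [easy|]. intros k u Hk Hu Hkd Hud.
  apply (H k (u * beta_max k)); [now apply H'|]. apply profile_spec; [lra|easy].
Qed.

(** Letter 1 has positive drift for [u0 < 1], and a letter of negative drift is found when [u0 > 0]
    (letter 0) or [k0 < 2] (letter 2). At [u0 = 1] the profile is 0. For [u0 = 0] and [k0 >= 2] the
    value at 0 is locally constant in [k], save at [k0 = 2], and the chord bound extends it to small
    [u]. *)
Lemma profile_lower k0 u0 eps : 1 < k0 < 5 -> 0 <= u0 <= 1 -> 0 < eps -> exists d, 0 < d /\
  forall k u, 1 < k < 5 -> 0 <= u <= 1 -> Rabs (k - k0) < d -> Rabs (u - u0) < d ->
    k = k0 \/ k0 <> 2 -> profile k0 u0 - eps <= profile k u.
Proof.
  intros Hk0 Hu0 He. assert (L3 := ln3_pos). assert (L6 := ln6_pos).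
  assert (Hb0 := beta_max_pos k0 ltac:(lra)).
  assert (V0 := profile_spec k0 u0 ltac:(lra) Hu0).
  assert (B6 : beta_max k0 * ln 6 = ln (k0 + 1)) by (unfold beta_max; field; lra).
  assert (Hlk : 0 < ln (k0 + 1)) by (rewrite <- ln_1; apply ln_increasing; lra).
  assert (Hcoer : forall j, (j < 4)%nat -> u0 < 1 -> drift k0 (u0 * beta_max k0) j < 0 ->
    exists d, 0 < d /\ forall k u, 1 < k < 5 -> 0 <= u <= 1 -> Rabs (k - k0) < d -> Rabs (u - u0) < d ->
    profile k0 u0 - eps <= profile k u).
  { intros j Hj Hu1 Hdj.
    destruct (value_lsc k0 _ _ eps 1 j V0 He ltac:(lia) Hj) as (eta & Heta & H); [|easy|].
    { rewrite drift_1, Rmult_assoc, B6. nra. }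
    destruct (drift_close_near k0 u0 eta Hk0 Hu0 Heta) as (d & Hd & H').
    exists d. split; [easy|]. intros k u Hk Hu Hkd Hud.
    apply (H k (u * beta_max k)); [now apply H'|]. apply profile_spec; [lra|easy]. }
  destruct (Req_dec u0 1) as [->|Hu1].
  { exists 1. split; [lra|]. intros k u Hk Hu _ _ _.
    assert (profile k0 1 = 0).
    { apply dval_eq. rewrite Rmult_1_l. apply value_beta_max. lra. }
    generalize (profile_bounds k u ltac:(lra) Hu). lra. }
  assert (Hlt1 : u0 < 1) by (destruct Hu0 as [_ [X|X]]; [easy|congruence]).
  destruct (Req_dec u0 0) as [->|Hu0'].
  2:{ destruct (Hcoer 0%nat ltac:(lia) ltac:(lra)) as (d & Hd & H).
      - assert (0 < u0) by (destruct Hu0 as [[X|X] _]; [easy|congruence]).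
        rewrite drift_0. assert (0 < u0 * beta_max k0 * ln 3) by (apply Rmult_lt_0_compat; [apply Rmult_lt_0_compat|]; lra). lra.
      - exists d. split; [easy|]. intros; now apply H. }
  destruct (Rlt_dec k0 2) as [Hlt|Hge].
  { destruct (Hcoer 2%nat ltac:(lia) ltac:(lra)) as (d & Hd & H).
    - rewrite drift_2. assert (ln (k0 - 1) < ln 1) as X by (apply ln_increasing; lra).
      rewrite ln_1 in X. lra.
    - exists d. split; [easy|]. intros; now apply H. }
  assert (Hsame : exists d, 0 < d /\ forall k, Rabs (k - k0) < d -> k = k0 \/ k0 <> 2 -> profile k 0 = profile k0 0).
  { destruct (Req_dec k0 2) as [E|E].
    - exists 1. split; [lra|]. intros k _ [->|]; [easy|lra].
    - exists (k0 - 2). split; [lra|]. intros k Hk _. apply Rabs_def2 in Hk.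
      unfold profile. rewrite !Rmult_0_l.
      rewrite (dval_eq _ _ _ (value_zero_large k ltac:(lra))).
      now rewrite (dval_eq _ _ _ (value_zero_large k0 ltac:(lra))). }
  destruct Hsame as (d & Hd & Hs).
  exists (Rmin d eps). split; [apply Rmin_pos; easy|].
  intros k u Hk Hu Hkd Hud Hor.
  assert (M1 := Rmin_l d eps). assert (M2 := Rmin_r d eps).
  assert (X := profile_ge_linear k u ltac:(lra) Hu).
  rewrite (Hs k ltac:(lra) Hor) in X.
  assert (P := profile_bounds k0 0 ltac:(lra) ltac:(lra)).
  rewrite Rminus_0_r, Rabs_right in Hud by lra. nra.
Qed.

(** * The graph of the spectrum *)

Lemma dist2_ge p q : Rabs (fst p - fst q) <= dist2 p q /\ Rabs (snd p - snd q) <= dist2 p q.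
Proof.
  unfold dist2. rewrite <- (sqrt_Rsqr_abs (fst p - fst q)), <- (sqrt_Rsqr_abs (snd p - snd q)).
  unfold Rsqr. generalize (pow2_ge_0 (fst p - fst q)), (pow2_ge_0 (snd p - snd q)). intros.
  split; apply sqrt_le_1_alt; lra.
Qed.

Lemma dist2_le p q : dist2 p q <= Rabs (fst p - fst q) + Rabs (snd p - snd q).
Proof.
  unfold dist2. assert (A := Rabs_pos (fst p - fst q)). assert (B := Rabs_pos (snd p - snd q)).
  rewrite <- (sqrt_square (Rabs (fst p - fst q) + Rabs (snd p - snd q))) by lra.
  apply sqrt_le_1_alt. rewrite <- (pow2_abs (fst p - fst q)), <- (pow2_abs (snd p - snd q)). nra.
Qed.

Lemma admissible_slope lam : admissible lam -> 1 < 6 * lam < 5 /\ 2 <= 6 * lam * (6 * lam).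
Proof. intros H. destruct (admissible_bounds lam H). split; lra. Qed.

Lemma alpha_min_eq lam : alpha_min lam = 1 - beta_max (6 * lam).
Proof. reflexivity. Qed.

Lemma spectrum_profile lam u : admissible lam -> 0 <= u <= 1 ->
  spectrum (F lam) (1 - u * beta_max (6 * lam)) = Finite (profile (6 * lam) u).
Proof.
  intros Hadm Hu. destruct (admissible_slope lam Hadm) as (Hk & _).
  assert (P := beta_max_pos (6 * lam) ltac:(lra)).
  apply spectrum_value; [easy| |apply profile_spec; lra].
  fold (beta_max (6 * lam)). nra.
Qed.

Lemma graph_profile lam p : admissible lam -> graph lam p <->
  exists u, 0 <= u <= 1 /\ p = (1 - u * beta_max (6 * lam), profile (6 * lam) u).
Proof.
  intros Hadm. destruct (admissible_slope lam Hadm) as (Hk & _).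
  assert (P := beta_max_pos (6 * lam) ltac:(lra)).
  unfold graph. rewrite alpha_min_eq. split.
  - intros (Hr & Hs). set (u := (1 - fst p) / beta_max (6 * lam)).
    assert (Hu : u * beta_max (6 * lam) = 1 - fst p) by (unfold u; field; lra).
    assert (Hu01 : 0 <= u <= 1).
    { split; [apply Rdiv_le_0_compat; lra|apply Rle_div_l; lra]. }
    exists u. split; [easy|].
    assert (E := spectrum_profile lam u Hadm Hu01). rewrite Hu in *.
    replace (1 - (1 - fst p)) with (fst p) in * by ring.
    rewrite <- Hs in E. injection E as E. destruct p; simpl in *. now rewrite E.
  - intros (u & Hu & ->). simpl. split; [nra|]. symmetry. now apply spectrum_profile.
Qed.

(** For a fixed [k] the profile is continuous in [u], also at [k = 2], by the alternative [k = k0]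
    of [profile_lower]. *)
Lemma graph_closed lam p : admissible lam ->
  (forall eps, 0 < eps -> exists q, graph lam q /\ dist2 p q < eps) -> graph lam p.
Proof.
  intros Hadm H. destruct (admissible_slope lam Hadm) as (Hk & _).
  set (k := 6 * lam) in *.
  assert (P := beta_max_pos k ltac:(lra)). set (b := beta_max k) in *.
  assert (Happ : forall eps, 0 < eps -> exists u, 0 <= u <= 1 /\
    Rabs (fst p - (1 - u * b)) < eps /\ Rabs (snd p - profile k u) < eps).
  { intros eps He. destruct (H eps He) as (q & Hq & Hd).
    apply graph_profile in Hq as (u & Hu & ->); [|easy]. exists u. split; [easy|].
    destruct (dist2_ge p (1 - u * beta_max (6 * lam), profile (6 * lam) u)) as [D1 D2].
    simpl in D1, D2. fold k in D1, D2, Hd; fold b in D1, D2, Hd. lra. }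
  assert (Hr : 1 - b <= fst p <= 1).
  { split; apply Rnot_lt_le; intros Hlt.
    - destruct (Happ (1 - b - fst p) ltac:(lra)) as (u & Hu & H1 & _). apply Rabs_def2 in H1. nra.
    - destruct (Happ (fst p - 1) ltac:(lra)) as (u & Hu & H1 & _). apply Rabs_def2 in H1. nra. }
  set (v := (1 - fst p) / b).
  assert (Hv : v * b = 1 - fst p) by (unfold v; field; lra).
  assert (Hv01 : 0 <= v <= 1).
  { split; [apply Rdiv_le_0_compat; lra|apply Rle_div_l; lra]. }
  apply graph_profile; [easy|]. exists v. split; [easy|]. fold k b.
  rewrite Hv. replace (1 - (1 - fst p)) with (fst p) by ring.
  enough (snd p = profile k v) as E by (destruct p; simpl in *; now rewrite E).
  apply Rminus_diag_uniq, Rabs_eq_0, Rle_antisym; [|apply Rabs_pos].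
  apply Rnot_lt_le. intros Hlt. set (e := Rabs (snd p - profile k v)) in *.
  destruct (profile_upper k v (e / 3) ltac:(lra) Hv01 ltac:(lra)) as (d1 & Hd1 & U).
  destruct (profile_lower k v (e / 3) ltac:(lra) Hv01 ltac:(lra)) as (d2 & Hd2 & L).
  set (m := Rmin (e / 3) (Rmin (d1 * b) (d2 * b))).
  assert (Hm : 0 < m) by (repeat apply Rmin_pos; try apply Rmult_lt_0_compat; lra).
  assert (M1 : m <= e / 3) by apply Rmin_l.
  assert (M2 : m <= d1 * b) by (eapply Rle_trans; [apply Rmin_r|apply Rmin_l]).
  assert (M3 : m <= d2 * b) by (eapply Rle_trans; [apply Rmin_r|apply Rmin_r]).
  destruct (Happ m Hm) as (u & Hu & H1 & H2).
  assert (Huv : Rabs (u - v) * b < m).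
  { rewrite <- (Rabs_right b) by lra. rewrite <- Rabs_mult.
    replace ((u - v) * b) with (fst p - (1 - u * b)) by (rewrite Rmult_minus_distr_r, Hv; ring). easy. }
  assert (X1 : Rabs (u - v) < d1) by (apply (Rmult_lt_reg_r b); lra).
  assert (X2 : Rabs (u - v) < d2) by (apply (Rmult_lt_reg_r b); lra).
  assert (Z : Rabs (k - k) = 0) by (rewrite Rminus_diag; apply Rabs_R0).
  specialize (U k u ltac:(lra) Hu ltac:(lra) X1).
  specialize (L k u ltac:(lra) Hu ltac:(lra) X2 (or_introl eq_refl)).
  assert (e <= 2 * (e / 3)); [|lra].
  unfold e at 1. apply Rabs_def2 in H2. apply Rabs_le. lra.
Qed.

Lemma graph_compact lam : admissible lam -> nonempty_compact2 (graph lam).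
Proof.
  intros Hadm. destruct (admissible_slope lam Hadm) as (Hk & _). split; [|split].
  - exists (1 - 0 * beta_max (6 * lam), profile (6 * lam) 0). apply graph_profile; [easy|].
    exists 0. split; [lra|easy].
  - exists 2. intros p Hp. apply graph_profile in Hp as (u & Hu & ->); [|easy].
    eapply Rle_trans; [apply dist2_le|]. simpl. rewrite !Rminus_0_r.
    assert (B := profile_bounds (6 * lam) u ltac:(lra) Hu).
    assert (M := beta_max_lt1 (6 * lam) Hk). fold (beta_max (6 * lam)) in M.
    rewrite !Rabs_right; nra.
  - intros p. now apply graph_closed.
Qed.

(** * The Hausdorff distance between graphs *)

Lemma excess_le A B eps : (forall p, A p -> exists q, B q /\ dist2 p q <= eps) ->
  Rbar_le (excess A B) (Finite eps).
Proof.
  intros H. unfold excess.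
  set (X := fun v => exists p, A p /\ v = dist_pt_set p B).
  apply (proj2 (proj2_sig (Rbar_ex_lub X))). intros v (p & Hp & ->).
  destruct (H p Hp) as (q & Hq & Hd).
  destruct (Glb_Rbar_correct (fun r => exists q, B q /\ r = dist2 p q)) as [G _].
  eapply Rbar_le_trans; [apply G; exists q; split; [easy|reflexivity]|]. exact Hd.
Qed.

Lemma hausdorff_lt A B eps : 0 < eps ->
  (forall p, A p -> exists q, B q /\ dist2 p q <= eps / 2) ->
  (forall p, B p -> exists q, A q /\ dist2 p q <= eps / 2) ->
  Rbar_lt (hausdorff_dist A B) (Finite eps).
Proof.
  intros He H1 H2. apply Rbar_le_lt_trans with (Finite (eps / 2)); [|simpl; lra].
  unfold hausdorff_dist, Rbar_maxi. destruct Rbar_le_dec; now apply excess_le.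
Qed.

Lemma hausdorff_ge A B p eps : A p -> (forall q, B q -> eps <= dist2 p q) ->
  Rbar_le (Finite eps) (hausdorff_dist A B).
Proof.
  intros Hp H.
  assert (E : Rbar_le (Finite eps) (excess A B)).
  { apply Rbar_le_trans with (dist_pt_set p B).
    - destruct (Glb_Rbar_correct (fun r => exists q, B q /\ r = dist2 p q)) as [_ G].
      apply G. intros r (q & Hq & ->). now apply H.
    - unfold excess. set (X := fun v => exists p, A p /\ v = dist_pt_set p B).
      apply (proj1 (proj2_sig (Rbar_ex_lub X))). now exists p. }
  unfold hausdorff_dist, Rbar_maxi. destruct Rbar_le_dec as [Hle|Hn]; [|easy].
  now apply Rbar_le_trans with (excess A B).
Qed.

(** Compactness of [[0, 1]] makes the continuity at the points [(k0, u0)] uniform; [profile k u] and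
    [profile k0 u] are both compared with the value at a nearby centre. *)
Lemma profile_uniform k0 eps : 1 < k0 < 5 -> k0 <> 2 -> 0 < eps -> exists d, 0 < d /\
  forall k u, 1 < k < 5 -> 0 <= u <= 1 -> Rabs (k - k0) < d ->
    Rabs (beta_max k - beta_max k0) < eps /\ Rabs (profile k u - profile k0 u) <= eps.
Proof.
  intros Hk0 Hne He.
  assert (Hloc : forall u0, exists d : posreal, 0 <= u0 <= 1 -> forall k u, 1 < k < 5 -> 0 <= u <= 1 ->
    Rabs (k - k0) < d -> Rabs (u - u0) < d ->
    Rabs (beta_max k - beta_max k0) < eps /\ Rabs (profile k u - profile k0 u0) <= eps / 2).
  { intros u0. destruct (classic (0 <= u0 <= 1)) as [Hu0|Hno]; [|now exists (mkposreal 1 Rlt_0_1)].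
    destruct (profile_upper k0 u0 (eps / 2) Hk0 Hu0 ltac:(lra)) as (d1 & Hd1 & U).
    destruct (profile_lower k0 u0 (eps / 2) Hk0 Hu0 ltac:(lra)) as (d2 & Hd2 & L).
    destruct (drift_close_near k0 u0 eps Hk0 Hu0 He) as (d3 & Hd3 & M).
    assert (Hd : 0 < Rmin d1 (Rmin d2 d3)) by (repeat apply Rmin_pos; easy).
    exists (mkposreal _ Hd). intros _ k u Hk Hu Hkd Hud. simpl in Hkd, Hud.
    assert (M1 : Rmin d1 (Rmin d2 d3) <= d1) by apply Rmin_l.
    assert (M2 : Rmin d1 (Rmin d2 d3) <= d2) by (eapply Rle_trans; [apply Rmin_r|apply Rmin_l]).
    assert (M3 : Rmin d1 (Rmin d2 d3) <= d3) by (eapply Rle_trans; [apply Rmin_r|apply Rmin_r]).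
    specialize (U k u Hk Hu ltac:(lra) ltac:(lra)).
    specialize (L k u Hk Hu ltac:(lra) ltac:(lra) (or_intror Hne)).
    split; [apply (M k u Hk Hu); lra|]. apply Rabs_le. lra. }
  set (delta := fun u0 => proj1_sig (constructive_indefinite_description _ (Hloc u0))).
  assert (Hdelta := fun u0 => proj2_sig (constructive_indefinite_description _ (Hloc u0))).
  change (forall u0, 0 <= u0 <= 1 -> forall k u, 1 < k < 5 -> 0 <= u <= 1 ->
    Rabs (k - k0) < delta u0 -> Rabs (u - u0) < delta u0 ->
    Rabs (beta_max k - beta_max k0) < eps /\ Rabs (profile k u - profile k0 u0) <= eps / 2) in Hdelta.
  destruct (compactness_value_1d 0 1 delta) as (d & Hd).
  exists d. split; [apply cond_pos|]. intros k u Hk Hu Hkd.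
  specialize (Hd u Hu). apply NNPP in Hd. destruct Hd as (t & Ht & Hut & Hdt).
  assert (Z : Rabs (k0 - k0) = 0) by (rewrite Rminus_diag; apply Rabs_R0).
  assert (Hpos := cond_pos (delta t)).
  destruct (Hdelta t Ht k u Hk Hu ltac:(lra) Hut) as [A1 A2].
  destruct (Hdelta t Ht k0 u Hk0 Hu ltac:(lra) Hut) as [_ A3].
  split; [easy|]. apply Rabs_le_between in A2, A3. apply Rabs_le. lra.
Qed.

Lemma graph_continuous lam0 : admissible lam0 -> lam0 <> 1 / 3 -> graph_continuous_at lam0.
Proof.
  intros Hadm0 Hne eps He. destruct (admissible_slope lam0 Hadm0) as (Hk0 & _).
  destruct (profile_uniform (6 * lam0) (eps / 4) Hk0 ltac:(lra) ltac:(lra)) as (d & Hd & H).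
  exists (d / 6). split; [lra|]. intros lam Hadm Hdist.
  destruct (admissible_slope lam Hadm) as (Hk & _).
  assert (Hkd : Rabs (6 * lam - 6 * lam0) < d).
  { rewrite <- Rmult_minus_distr_l, Rabs_mult, (Rabs_right 6) by lra. lra. }
  assert (Hclose : forall u, 0 <= u <= 1 ->
    dist2 (1 - u * beta_max (6 * lam), profile (6 * lam) u)
      (1 - u * beta_max (6 * lam0), profile (6 * lam0) u) <= eps / 2).
  { intros u Hu. destruct (H (6 * lam) u Hk Hu Hkd) as [H1 H2].
    eapply Rle_trans; [apply dist2_le|]. simpl.
    replace (1 - u * beta_max (6 * lam) - (1 - u * beta_max (6 * lam0))) with
      (- (u * (beta_max (6 * lam) - beta_max (6 * lam0)))) by ring.
    rewrite Rabs_Ropp, Rabs_mult, (Rabs_right u) by lra.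
    assert (u * Rabs (beta_max (6 * lam) - beta_max (6 * lam0)) <= 1 * (eps / 4))
      by (apply Rmult_le_compat; try apply Rabs_pos; lra).
    lra. }
  assert (Hsym : forall p q, dist2 p q = dist2 q p).
  { intros p q. unfold dist2. f_equal. ring. }
  apply hausdorff_lt; [easy| |].
  - intros p Hp. apply graph_profile in Hp as (u & Hu & ->); [|easy].
    exists (1 - u * beta_max (6 * lam0), profile (6 * lam0) u). split; [|now apply Hclose].
    apply graph_profile; [easy|]. now exists u.
  - intros p Hp. apply graph_profile in Hp as (u & Hu & ->); [|easy].
    exists (1 - u * beta_max (6 * lam), profile (6 * lam) u). split; [|rewrite Hsym; now apply Hclose].
    apply graph_profile; [easy|]. now exists u.
Qed.

Lemma sqrt2_lt : sqrt 2 < 3 / 2.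
Proof.
  assert (S := sqrt_sqrt 2 ltac:(lra)). assert (S0 := sqrt_pos 2). nra.
Qed.

(** For lambda slightly above 1/3 the right end of the graph is always the point [P], which stays
    off the closed graph at 1/3, hence at a positive distance from it. *)
Lemma graph_discontinuous : ~ graph_continuous_at (1 / 3).
Proof.
  intros H. assert (S2 := sqrt2_lt).
  assert (Hadm : admissible (1 / 3)) by (unfold admissible; lra).
  set (P := (1, ln 2 / ln 3)).
  assert (Hnot : ~ graph (1 / 3) P).
  { intros HP. apply graph_profile in HP as (u & Hu & E); [|easy].
    replace (6 * (1 / 3)) with 2 in E by field. unfold P in E. injection E as E1 E2.
    assert (M := beta_max_pos 2 ltac:(lra)).
    assert (u = 0) as -> by nra.
    assert (V := profile_spec 2 0 ltac:(lra) Hu). rewrite Rmult_0_l, <- E2 in V.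
    apply value_zero_critical in V. lra. }
  assert (Hgap : exists e, 0 < e /\ forall q, graph (1 / 3) q -> e <= dist2 P q).
  { apply NNPP. intros Hno. apply Hnot, graph_closed; [easy|]. intros eps He.
    apply NNPP. intros Hn. apply Hno. exists eps. split; [easy|].
    intros q Hq. apply Rnot_lt_le. intros Hlt. apply Hn. now exists q. }
  destruct Hgap as (e & He & Hq).
  destruct (H e He) as (d & Hd & Hc).
  (* The cap 1/3 keeps [1 / 3 + t] admissible. *)
  set (t := Rmin (d / 2) (1 / 3)).
  assert (Ht : 0 < t) by (apply Rmin_pos; lra).
  assert (T1 : t <= d / 2) by apply Rmin_l. assert (T2 : t <= 1 / 3) by apply Rmin_r.
  assert (Hadm' : admissible (1 / 3 + t)) by (unfold admissible; lra).
  specialize (Hc (1 / 3 + t) Hadm' ltac:(replace (1 / 3 + t - 1 / 3) with t by ring; rewrite Rabs_right; lra)).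
  assert (HP : graph (1 / 3 + t) P).
  { apply graph_profile; [easy|]. exists 0. split; [lra|]. unfold P. f_equal; [ring|].
    unfold profile. rewrite Rmult_0_l. symmetry. apply dval_eq, value_zero_large. lra. }
  apply (Rbar_le_not_lt _ _ (hausdorff_ge _ _ P e HP Hq)). exact Hc.
Qed.

Theorem theorem1p9 :
  (forall lam, admissible lam ->
    (* (i) support of the spectrum *)
    (forall alpha, spectrum (F lam) alpha <> m_infty <->
                   alpha_min lam <= alpha <= 1) /\
    (* (ii) multifractal formalism, strict concavity, maximum *)
    (forall alpha, alpha_min lam <= alpha <= 1 ->
       spectrum (F lam) alpha = tau_star lam (alpha + gamma lam - 1)) /\
    (forall a1 a2 t, alpha_min lam <= a1 <= 1 -> alpha_min lam <= a2 <= 1 ->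
       a1 <> a2 -> 0 < t < 1 ->
       t * real (spectrum (F lam) a1) + (1 - t) * real (spectrum (F lam) a2)
         < real (spectrum (F lam) (t * a1 + (1 - t) * a2))) /\
    (forall alpha, alpha_min lam <= alpha <= 1 ->
       Rbar_le (spectrum (F lam) alpha) (Finite 1)) /\
    alpha_min lam <= alpha_L lam <= 1 /\
    spectrum (F lam) (alpha_L lam) = Finite 1 /\
    (* (iii) the graph is a nonempty compact subset of R^2 *)
    nonempty_compact2 (graph lam)) /\
  (* (iii) continuity of lam |-> Gr(d_{F^lam}) except at 1/3 *)
  (forall lam0, admissible lam0 -> lam0 <> 1 / 3 -> graph_continuous_at lam0) /\
  ~ graph_continuous_at (1 / 3).
Proof.
  split; [|split; [exact graph_continuous|exact graph_discontinuous]].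
  intros lam Hadm. destruct (admissible_slope lam Hadm) as (Hk & Hkk).
  destruct (admissible_bounds lam Hadm) as (Hlam & _).
  set (k := 6 * lam) in *.
  assert (Hval : forall al, alpha_min lam <= al <= 1 -> value k (1 - al) (dval k (1 - al)) /\
    spectrum (F lam) al = Finite (dval k (1 - al))).
  { intros al Hal. rewrite alpha_min_eq in Hal. fold k in Hal.
    assert (V : value k (1 - al) (dval k (1 - al))) by (apply dval_spec; lra).
    split; [easy|]. replace al with (1 - (1 - al)) at 1 by ring.
    apply spectrum_value; [easy| |easy]. fold k (beta_max k). lra. }
  assert (Hpeak : alpha_min lam <= alpha_L lam <= 1 /\ value k (1 - alpha_L lam) 1).
  { assert (E : alpha_L lam = 1 - ln (k ^ 2 - 1) / (4 * ln 3 + 2 * ln 6)).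
    { unfold alpha_L. do 4 f_equal. unfold k. ring. }
    assert (R := peak_range k ltac:(lra) Hkk). rewrite alpha_min_eq. fold k.
    split; [lra|]. rewrite E.
    replace (1 - (1 - ln (k ^ 2 - 1) / (4 * ln 3 + 2 * ln 6)))
      with (ln (k ^ 2 - 1) / (4 * ln 3 + 2 * ln 6)) by ring.
    apply value_peak. lra. }
  split; [|split; [|split; [|split; [|split; [|split]]]]].
  - intros al. split.
    + intros Hne. apply NNPP. intros Hno. apply Hne. now apply spectrum_empty.
    + intros Hal. rewrite (proj2 (Hval al Hal)). easy.
  - intros al Hal. destruct (Hval al Hal) as [V ->].
    replace al with (1 - (1 - al)) at 2 by ring. symmetry. apply tau_star_value; [lra|easy].
  - intros a1 a2 t H1 H2 Hne Ht.
    assert (H3 : alpha_min lam <= t * a1 + (1 - t) * a2 <= 1) by nra.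
    destruct (Hval a1 H1) as [V1 ->]. destruct (Hval a2 H2) as [V2 ->]. destruct (Hval _ H3) as [V3 ->].
    simpl. rewrite alpha_min_eq in H1, H2. fold k in H1, H2.
    apply (value_strict_concave k (1 - a1) (1 - a2)); try lra; try easy.
    replace (t * (1 - a1) + (1 - t) * (1 - a2)) with (1 - (t * a1 + (1 - t) * a2)) by ring. easy.
  - intros al Hal. destruct (Hval al Hal) as [V ->]. exact (value_le1 _ _ _ V).
  - apply Hpeak.
  - destruct Hpeak as [HL HV]. rewrite (proj2 (Hval _ HL)). f_equal. now apply dval_eq.
  - now apply graph_compact.
Qed.
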